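(* Let $G$ be a unimodular locally compact group and let $n\ge 1$. Let $\Phi\in\mathcal P^2(G,M_n)$, i.e. $\Phi: G\to M_n(\mathbb C)$ is a continuous positive definite function all of whose entries are in $L^2(G)$. Then there exists $\Psi\in\mathbf P^2(G,M_n)$, i.e. a (not necessarily continuous) square integrable positive definite $M_n(\mathbb C)$-valued function, such that $\Phi=\Psi*\Psi$.
   Context: $G$ is equipped with a fixed Haar measure $dg$; $e$ is the identity; $M_n=M_n(\mathbb C)$; $[A]_{ij}$ is the $(i,j)$ entry. A continuous function $\Phi:G\to M_n(\mathbb C)$ is positive definite if for all finite families $\mathbf C_1,\dots,\mathbf C_l\in\mathbb C^n$ and $x_1,\dots,x_l\in G$, $\sum_{i,j=1}^{l}\mathbf C_i^{t}\,\Phi(x_i^{-1}x_j)\,\overline{\mathbf C_j}\ge 0$. The set of these is $\mathcal P(G,M_n)$. For a locally integrable $\Phi\in L^1_{loc}(G,M_n)$ and $u\in C_c(G,\mathbb C^n)$ put $\lambda(\Phi)(u)(x)=\int_G\Phi(g)u(g^{-1}x)\,dg$. Such $\Phi$ is called positive definite if $\langle\lambda(\Phi)u,u\rangle=\sum_{i=1}^n\int_G[\lambda(\Phi)u(g)]_i\overline{[u(g)]_i}\,dg\ge 0$ for all $u\in C_c(G,\mathbb C^n)$. The set of these is $\mathbf P(G,M_n)$; it contains $\mathcal P(G,M_n)$. $L^2(G,M_n)$ is the set of matrix-valued functions with all entries in $L^2(G)$; $\mathcal P^2(G,M_n)=L^2(G,M_n)\cap\mathcal P(G,M_n)$ and $\mathbf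 P^2(G,M_n)=L^2(G,M_n)\cap\mathbf P(G,M_n)$. Convolution: $[\Phi*\Psi]_{ij}=\sum_{k=1}^n[\Phi]_{ik}*[\Psi]_{kj}$, where $(f*h)(x)=\int_G f(g)h(g^{-1}x)\,dg$, whenever the integrals converge absolutely (for $L^2$ functions it is a bounded continuous function). *)

(* Defs.v *)
From HB Require Import structures.
From mathcomp Require Import all_boot all_order all_algebra.
From mathcomp Require Import all_classical all_reals all_analysis.
From mathcomp Require Import complex.
Import Order.TTheory GRing.Theory Num.Theory.
Import numFieldNormedType.Exports.

Set Implicit Arguments.
Unset Strict Implicit.
Unset Printing Implicit Defensive.

Local Open Scope classical_set_scope.
Local Open Scope ring_scope.
Local Open Scope complex_scope.

(* The distinguished point is unrelated to the group structure; it is there only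
   because measurable types are pointed. *)
HB.structure Definition PreTopologicalGroup :=
  {G of PointedTopological G & Group G}.

HB.mixin Record PreTopologicalGroup_isTopologicalGroup G
    of PreTopologicalGroup G := {
  mulg_continuous : continuous (fun xy : G * G => (xy.1 * xy.2)%g) ;
  invg_continuous : continuous (fun x : G => (x^-1)%g) ;
}.

#[short(type="topologicalGroupType")]
HB.structure Definition TopologicalGroup :=
  {G of PreTopologicalGroup G & PreTopologicalGroup_isTopologicalGroup G}.

(* As usual for locally compact groups, the Hausdorff axiom is included. *)
Definition locally_compact_group (G : topologicalGroupType) : Prop :=
  hausdorff_space G /\ locally_compact [set: G].

Notation borel G := (g_sigma_algebraType (@open G)).

Section Haar.
Context {R : realType} {G : topologicalGroupType}.
Variable mu : {measure set (borel G) -> \bar R}.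

Definition radon_measure : Prop :=
  [/\ forall K : set G, compact K -> (mu K < +oo)%E,
      forall A : set (borel G), measurable A ->
        mu A = ereal_inf [set mu U | U in [set U : set G | open U /\ A `<=` U]]
    & forall U : set G, open U ->
        mu U = ereal_sup [set mu K | K in [set K : set G |
                                           compact K /\ K `<=` U]]].

Definition left_invariant : Prop :=
  forall (x : G) (A : set (borel G)), measurable A ->
    mu [set (x * a)%g | a in (A : set G)] = mu A.

(* To be used for a Haar measure [mu]: G is unimodular when its left Haar
   measure is also right invariant. *)
Definition unimodular : Prop :=
  forall (x : G) (A : set (borel G)), measurable A ->
    mu [set (a * x)%g | a in (A : set G)] = mu A.

(* [haar_measure] means left Haar measure. *)
Definition haar_measure : Prop :=
  [/\ radon_measure, left_invariant & mu [set: G] <> 0%E].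

(* Integral of a complex-valued function; only meaningful for functions whose
   real and imaginary parts are integrable, since [Rintegral] is total. *)
Definition Cintegral (f : G -> R[i]) : R[i] :=
  (\int[mu]_x complex.Re (f x)) +i* (\int[mu]_x complex.Im (f x)).

Definition Cmeasurable (f : G -> R[i]) : Prop :=
  measurable_fun [set: borel G] (fun x => complex.Re (f x)) /\
  measurable_fun [set: borel G] (fun x => complex.Im (f x)).

(* [`|z|] lives in R[i] (with zero imaginary part), hence the projections. *)
Definition L1loc (f : G -> R[i]) : Prop :=
  Cmeasurable f /\
  forall K : set G, compact K ->
    (\int[mu]_(x in K) (complex.Re `|f x|)%:E < +oo)%E.

Definition L2 (f : G -> R[i]) : Prop :=
  Cmeasurable f /\ (\int[mu]_x ((complex.Re `|f x|) ^+ 2)%:E < +oo)%E.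

Definition Cconv (f h : G -> R[i]) (x : G) : R[i] :=
  Cintegral (fun g => f g * h (g^-1 * x)%g).

Section Matrix.
Context {n : nat}.
Implicit Types (Phi Psi : G -> 'M[R[i]]_n) (u : G -> 'cV[R[i]]_n).

Definition mxL1loc Phi : Prop := forall i j, L1loc (fun x => Phi x i j).

Definition mxL2 Phi : Prop := forall i j, L2 (fun x => Phi x i j).

Definition mxconv Phi Psi (x : G) : 'M[R[i]]_n :=
  \matrix_(i, j) \sum_k Cconv (fun g => Phi g i k) (fun g => Psi g k j) x.

(* [R[i]^o] is R[i] with the topology of its norm. *)
Definition continuous_posdef Phi : Prop :=
  continuous (Phi : G -> 'M[R[i]^o]_n) /\
  forall (l : nat) (c : 'I_l -> 'cV[R[i]]_n) (x : 'I_l -> G),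
    0 <= \sum_i \sum_j
           ((c i)^T *m Phi ((x i)^-1 * x j)%g *m map_mx conjc (c j)) 0 0.

Definition Cc u : Prop :=
  continuous (u : G -> 'cV[R[i]^o]_n) /\ compact (closure [set x | u x != 0]).

Definition lambda Phi u (x : G) : 'cV[R[i]]_n :=
  \col_i Cintegral (fun g => (Phi g *m u (g^-1 * x)%g) i 0).

Definition innerL2 (u v : G -> 'cV[R[i]]_n) : R[i] :=
  \sum_i Cintegral (fun g => u g i 0 * (v g i 0)^*).

Definition integrally_posdef Phi : Prop :=
  mxL1loc Phi /\ forall u, Cc u -> 0 <= innerL2 (lambda Phi u) u.

Definition cont_P2 Phi : Prop := mxL2 Phi /\ continuous_posdef Phi.

Definition P2 Phi : Prop := mxL2 Phi /\ integrally_posdef Phi.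

End Matrix.
End Haar.

(* Main.v *)
(** Viewed as a real matrix-valued kernel, [Phi] is the reproducing kernel of a
   Hilbert space of continuous functions with norm [H], and left translates of
   its rows are square integrable, so [H] and the [L^2] form [L] are both
   defined on finite combinations of these translates. Formally
   [H (f, g) = <T^-1 f, g>] and [L (f, g) = <f, g>], where [T] is convolution by
   [Phi], and the sought [Psi] is [T^(-1/2)] applied to the rows of [Phi].
   On the completion for [H + L] (the form domain of the Friedrichs extension)
   the Riesz theorem yields a contraction [X = (1 + T)^-1], and [T^(-1/2)] is
   the increasing limit of explicit polynomials in [X], all of them nonnegative
   combinations of the [X^i (1 - X)^j]. These polynomials are self-adjoint and
   commute with translations, which makes the approximations of [Psi] pointwise
   hermitian; since [T^(-1/2)] is isometric from [H] to [L], one gets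
   [Phi = Psi * Psi], and positivity of the polynomials gives that of [Psi].
   Unimodularity enters through the invariance of Haar measure under inversion,
   which is only needed for compactly supported continuous functions. *)

Require Import Defs.
From HB Require Import structures.
From mathcomp Require Import all_boot all_order all_algebra.
From mathcomp Require Import all_classical all_reals all_analysis.
From mathcomp Require Import complex.
From mathcomp Require Import measurable_realfun finmap ring lra.
Import Order.TTheory GRing.Theory Num.Theory.
Import numFieldNormedType.Exports.

Set Implicit Arguments.
Unset Strict Implicit.
Unset Printing Implicit Defensive.

Local Open Scope classical_set_scope.
Local Open Scope ring_scope.

(** * Positive semidefinite forms *)

(** Formally the rows of [Phi] are [T] applied to point masses, so [Psi] is the convolution kernel
    of [T^(1/2)]. The obstacle is that convolution by an L^2 function is in general unbounded on
    L^2, and that point masses do not lie in L^2: no bounded functional calculus applies to [T]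
    directly. The translated rows do lie in the form domain of [T^-1], and there only the bounded
    [X] is used, with [T^-1 = X / (1 - X)]. Convergence to [T^(-1/2)] requires that [1] is not an
    eigenvalue of [X]; this is where it matters that vectors of the completion are determined by
    their continuous functions. Scalars are real, a complex entry being a real 2 x 2 block. Complex
    linearity then becomes a commutation relation with a skew-adjoint operator, which has to be
    carried to the limit because nonnegativity in [R[i]] also asserts that the imaginary part
    vanishes. *)

(* No axioms are required: vectors are only compared through a semidefinite
   form, so that null vectors never have to be quotiented out. *)
Record wmod (R : realType) := WMod {
  wcar :> Type ;
  wadd : wcar -> wcar -> wcar ;
  wscl : R -> wcar -> wcar }.

Definition wsub (R : realType) (V : wmod R) (x y : V) : V :=
  wadd x (wscl (-1) y).

Record psd (R : realType) (V : wmod R) (f : V -> V -> R) : Prop := Psd {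
  psdC : forall x y, f x y = f y x ;
  psdDl : forall x y z, f (wadd x y) z = f x z + f y z ;
  psdZl : forall a x z, f (wscl a x) z = a * f x z ;
  psd_ge0 : forall x, 0 <= f x x }.

Definition nrm (R : realType) (V : wmod R) (f : V -> V -> R) (x : V) : R :=
  Num.sqrt (f x x).

Section PsdTheory.
Context {R : realType} {V : wmod R} {f : V -> V -> R} (pf : psd f).

Lemma psdDr x y z : f x (wadd y z) = f x y + f x z.
Proof. by rewrite psdC// psdDl// !(psdC pf _ x). Qed.

Lemma psdZr a x y : f x (wscl a y) = a * f x y.
Proof. by rewrite psdC// psdZl// psdC. Qed.

Lemma psdBl x y z : f (wsub x y) z = f x z - f y z.
Proof. by rewrite psdDl// psdZl// mulN1r. Qed.

Lemma psdBr x y z : f x (wsub y z) = f x y - f x z.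
Proof. by rewrite psdDr psdZr mulN1r. Qed.

Definition psdE := (psdBl, psdBr, psdDl pf, psdDr, psdZl pf, psdZr).

(** If [f y y] vanishes, [f x x + 2 * a * f x y] stays nonnegative for every [a], which forces
    [f x y = 0]; since [f] is only semidefinite, this case needs its own argument. *)
Lemma psd_CS x y : f x y ^+ 2 <= f x x * f y y.
Proof.
have [y0|yn0] := eqVneq (f y y) 0.
  have H a : 0 <= f x x + 2 * a * f x y.
    have := psd_ge0 pf (wadd x (wscl a y)).
    by rewrite !psdE y0 !mulr0 addr0 (psdC pf y x); congr (_ <= _); ring.
  have [->|xy0] := eqVneq (f x y) 0; first by rewrite y0 expr0n mulr0.
  have := H (- (f x x + 1) / (2 * f x y)).
  have -> : f x x + 2 * (- (f x x + 1) / (2 * f x y)) * f x y = -1.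
    by field; rewrite xy0.
  by rewrite leNgt ltrN10.
have yp : 0 < f y y by rewrite lt_def yn0 psd_ge0.
(* This vector is [f y y] times the component of [x] orthogonal to [y]; the scaling avoids a
   division. *)
have := psd_ge0 pf (wsub (wscl (f y y) x) (wscl (f x y) y)).
rewrite !psdE (psdC pf y x).
move=> H; have : 0 <= f y y * (f x x * f y y - f x y ^+ 2) by lra.
by rewrite pmulr_rge0// subr_ge0.
Qed.

Lemma nrm_ge0 x : 0 <= nrm f x. Proof. exact: sqrtr_ge0. Qed.

Lemma nrm_sq x : nrm f x ^+ 2 = f x x.
Proof. by rewrite sqr_sqrtr// psd_ge0. Qed.

Lemma psd_CSn x y : `|f x y| <= nrm f x * nrm f y.
Proof.
rewrite -ler_sqr ?nnegrE ?mulr_ge0 ?nrm_ge0//.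
by rewrite exprMn !nrm_sq -normrX ger0_norm ?sqr_ge0// psd_CS.
Qed.

Lemma nrmD x y : nrm f (wadd x y) <= nrm f x + nrm f y.
Proof.
rewrite -ler_sqr ?nnegrE ?addr_ge0 ?nrm_ge0//.
rewrite nrm_sq !psdE sqrrD !nrm_sq (psdC pf y x).
have := le_trans (ler_norm _) (psd_CSn x y); lra.
Qed.

(** Replaces vector identities: in a structure without axioms, an algebraic rearrangement yields a
    different term that [f] cannot tell apart from the original. *)
Lemma nrm_congr x y : (forall z, f x z = f y z) -> nrm f x = nrm f y.
Proof. by move=> H; rewrite /nrm H psdC// H. Qed.

Lemma nrm_tri y x z : nrm f (wsub x z) <= nrm f (wsub x y) + nrm f (wsub y z).
Proof.
rewrite -(@nrm_congr (wadd (wsub x y) (wsub y z))) ?nrmD//.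
by move=> t; rewrite !psdE; ring.
Qed.

Lemma nrmBC x y : nrm f (wsub x y) = nrm f (wsub y x).
Proof. by rewrite /nrm; congr Num.sqrt; rewrite !psdE; ring. Qed.

Lemma nrm_dist x y : `|nrm f x - nrm f y| <= nrm f (wsub x y).
Proof.
have H u v : nrm f u - nrm f v <= nrm f (wsub u v).
  rewrite lerBlDr -(@nrm_congr (wadd (wsub u v) v) u) ?nrmD//.
  by move=> t; rewrite !psdE; ring.
by rewrite ler_norml H andbT lerNl opprB nrmBC.
Qed.

Lemma nrmxx x : nrm f (wsub x x) = 0.
Proof. by rewrite /nrm !psdE !subrr sqrtr0. Qed.

Lemma psd_polar x y :
  f x y = (f (wadd x y) (wadd x y) - f (wsub x y) (wsub x y)) / 4.
Proof. by rewrite !psdE (psdC pf y x); field. Qed.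

Lemma nrm_le_sq x e : 0 <= e -> (nrm f x <= e) = (f x x <= e ^+ 2).
Proof. by move=> e0; rewrite -nrm_sq ler_sqr ?nnegrE ?nrm_ge0. Qed.

End PsdTheory.

Lemma real_cauchy_cvg (R : realType) (u : nat -> R) :
  (forall e, 0 < e -> exists N, forall m n, (N <= m)%N -> (N <= n)%N ->
     `|u m - u n| <= e) -> cvgn u.
Proof.
move=> H; apply/cauchy_cvgP/cauchy_exP => e e0.
have [N HN] := H (e / 2) ltac:(by rewrite divr_gt0).
exists (u N); exists N => // k /= Nk; rewrite /ball /=.
apply: le_lt_trans (HN _ _ (leqnn N) Nk) _.
by rewrite gtr_pMr// invf_lt1// ltr1n.
Qed.

Definition cau (R : realType) (V : wmod R) (q : V -> V -> R) (u : nat -> V) :=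
  forall e, 0 < e -> exists N, forall m n, (N <= m)%N -> (N <= n)%N ->
    nrm q (wsub (u m) (u n)) <= e.

Definition tends (R : realType) (V : wmod R) (q : V -> V -> R) (u : nat -> V)
  (x : V) := forall e, 0 < e -> exists N, forall m, (N <= m)%N ->
    nrm q (wsub (u m) x) <= e.

Definition complete_form (R : realType) (V : wmod R) (q : V -> V -> R) :=
  forall u, cau q u -> exists x, tends q u x.

(** * Continuity of the form and the Riesz representation theorem *)

Section Riesz.
Context {R : realType} {V : wmod R} {q : V -> V -> R} (pq : psd q).

Lemma tends_ip u x y : tends q u x -> (fun k => q (u k) y) @ \oo --> q x y.
Proof.
move=> ux; apply/cvgrPdist_le => e e0.
have d0 : 0 < e / (nrm q y + 1) by rewrite divr_gt0// ltr_wpDl// nrm_ge0.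
have [N HN] := ux _ d0.
exists N => // k /= Nk; rewrite distrC -psdBl//.
apply: le_trans (psd_CSn pq _ _) _.
apply: le_trans (ler_wpM2r (nrm_ge0 _) (HN _ Nk)) _.
by rewrite mulrAC ler_pdivrMr ?ltr_wpDl ?nrm_ge0// ler_pM2l// lerDl.
Qed.

Lemma tends_nrm u x : tends q u x -> (fun k => nrm q (u k)) @ \oo --> nrm q x.
Proof.
move=> ux; apply/cvgrPdist_le => e e0.
have [N HN] := ux _ e0.
by exists N => // k /= Nk; rewrite distrC (le_trans (nrm_dist pq _ _))// HN.
Qed.

Lemma tends_ip2 u w x y : tends q u x -> tends q w y ->
  (fun k => q (u k) (w k)) @ \oo --> q x y.
Proof.
move=> ux wy.
have td : tends q (fun k => wadd (u k) (w k)) (wadd x y).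
  move=> e e0; have e2 : 0 < e / 2 by rewrite divr_gt0.
  have [N HN] := ux _ e2; have [M HM] := wy _ e2.
  exists (maxn N M) => m; rewrite geq_max => /andP[/HN h1 /HM h2].
  rewrite (nrm_congr pq (y := wadd (wsub (u m) x) (wsub (w m) y))).
    by apply: le_trans (nrmD pq _ _) _; lra.
  by move=> z; rewrite !(psdE pq); ring.
have td' : tends q (fun k => wsub (u k) (w k)) (wsub x y).
  move=> e e0; have e2 : 0 < e / 2 by rewrite divr_gt0.
  have [N HN] := ux _ e2; have [M HM] := wy _ e2.
  exists (maxn N M) => m; rewrite geq_max => /andP[/HN h1 /HM h2].
  rewrite (nrm_congr pq (y := wadd (wsub (u m) x) (wsub y (w m)))).
    apply: le_trans (nrmD pq _ _) _; rewrite (nrmBC pq y); lra.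
  by move=> z; rewrite !(psdE pq); ring.
have sq a b : tends q a b -> (fun k => q (a k) (a k)) @ \oo --> q b b.
  move=> tab; have -> : (fun k => q (a k) (a k)) = (fun k => nrm q (a k) * nrm q (a k)).
    by apply/funext => k; rewrite -expr2 nrm_sq.
  by rewrite -(nrm_sq pq b) expr2; exact: (cvgM (tends_nrm tab) (tends_nrm tab)).
rewrite (psd_polar pq x y).
rewrite (_ : (fun k => _) = (fun k => (q (wadd (u k) (w k)) (wadd (u k) (w k)) -
  q (wsub (u k) (w k)) (wsub (u k) (w k))) * 4^-1)).
  exact: (cvgM (cvgB (sq _ _ td) (sq _ _ td')) (cvg_cst (4^-1 : R))).
by apply/funext => k; rewrite -(psd_polar pq).
Qed.

Lemma quad_ge0_lin0 (a b : R) : (forall t, 0 <= t * a + t ^+ 2 * b) -> a = 0.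
Proof.
move=> H; have b0 : 0 <= b by have := H 1; have := H (-1); lra.
(* The denominator [b + 1] is positive even for [b = 0], and the value at this point is minus a
   square. *)
have := H (- a / (b + 1)).
have -> : - a / (b + 1) * a + (- a / (b + 1)) ^+ 2 * b =
  - (a ^+ 2 / (b + 1) ^+ 2) by field; lra.
rewrite oppr_ge0 pmulr_lle0; last by rewrite invr_gt0 exprn_gt0//; lra.
by move=> a0; apply/eqP; rewrite -sqrf_eq0 eq_le a0 sqr_ge0.
Qed.

(** The representing vector minimizes [q x x - 2 * phi x]: minimizing sequences are Cauchy by the
    parallelogram identity at midpoints, and the first variation at the minimum is the desired
    equation. [x0] makes the set of values nonempty, since [wmod] provides no zero. *)
Lemma riesz (x0 : V) (phi : V -> R) (M : R) : complete_form q ->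
  (forall x y, phi (wadd x y) = phi x + phi y) ->
  (forall a x, phi (wscl a x) = a * phi x) ->
  (forall x, `|phi x| <= M * nrm q x) ->
  exists z, forall x, q z x = phi x.
Proof.
move=> cq phiD phiZ phiM.
pose F x := q x x - 2 * phi x.
have FM x : - M ^+ 2 <= F x.
  rewrite /F -nrm_sq//; have := le_trans (ler_norm _) (phiM x).
  have := sqr_ge0 (nrm q x - M); rewrite sqrrB; lra.
pose A := [set F x | x in [set: V]].
have hiA : has_inf A.
  split; first by exists (F x0), x0.
  by exists (- M ^+ 2) => _ [x _ <-].
have iF x : inf A <= F x by apply: ge_inf; [exact: hiA.2|exists x].
have /choice[u Hu] k : exists x, F x < inf A + k.+1%:R^-1.
  have kp : 0 < k.+1%:R^-1 :> R by rewrite invr_gt0.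
  have [_ [x _ <-] Hx] := inf_adherent kp hiA.
  by exists x.
have uu k l : q (wsub (u k) (u l)) (wsub (u k) (u l)) <=
    2 * (k.+1%:R^-1 + l.+1%:R^-1).
  have := iF (wscl (1 / 2) (wadd (u k) (u l))).
  have := Hu k; have := Hu l.
  rewrite /F phiZ phiD !(psdE pq) (psdC pq (u l) (u k)).
  move: (k.+1%:R^-1) (l.+1%:R^-1) => a b; lra.
have cu : cau q u.
  move=> e e0.
  (* The threshold is [e ^+ 2 / 4]; the factor 2 and the two terms in [uu] bring it back to
     [e ^+ 2]. *)
  have [N] := near_infty_natSinv_lt (PosNum (divr_gt0 (exprn_gt0 2 e0) (ltr0Sn R 3))).
  move=> _ HN; exists N => m n Nm Nn.
  rewrite (nrm_le_sq pq _ (ltW e0)); apply: le_trans (uu _ _) _.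
  have := HN m Nm; have := HN n Nn => /=.
  move: (m.+1%:R^-1) (n.+1%:R^-1) (e ^+ 2) => a b c; lra.
have [z uz] := cq _ cu.
have phiz : (fun k => phi (u k)) @ \oo --> phi z.
  apply/cvgrPdist_le => e e0.
  have M0 : 0 <= M \/ M < 0 by case: (leP 0 M); [left|right].
  have d0 : 0 < e / (`|M| + 1) by rewrite divr_gt0// ltr_wpDl.
  have [N HN] := uz _ d0; exists N => // k /= Nk.
  have -> : phi z - phi (u k) = - phi (wsub (u k) z).
    by rewrite /wsub phiD phiZ; ring.
  rewrite normrN; apply: le_trans (phiM _) _.
  apply: le_trans (ler_wpM2r (nrm_ge0 _) (ler_norm M)) _.
  apply: le_trans (ler_wpM2l (normr_ge0 _) (HN _ Nk)) _.
  by rewrite mulrCA ler_piMr ?(ltW e0)// ler_pdivrMr ?mul1r ?lerDl// ltr_wpDl.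
have Fz : F z <= inf A.
  have cF : (fun k => F (u k)) @ \oo --> F z.
    have qz : (fun k => q (u k) (u k)) @ \oo --> q z z.
      have -> : (fun k => q (u k) (u k)) = (fun k => nrm q (u k) * nrm q (u k)).
        by apply/funext => k; rewrite -expr2 nrm_sq.
      by rewrite -(nrm_sq pq z) expr2; exact: cvgM (tends_nrm uz) (tends_nrm uz).
    exact: (cvgB qz (cvgM (cvg_cst (2 : R)) phiz)).
  have cI : (fun k => inf A + k.+1%:R^-1) @ \oo --> inf A + 0.
    by apply: cvgD; [exact: cvg_cst|exact: cvg_harmonic].
  rewrite -[leRHS]addr0 -(cvg_lim _ cF)// -(cvg_lim _ cI)//.
  apply: ler_lim; [by apply: cvgP cF|by apply: cvgP cI|].
  by near=> k; exact/ltW/Hu.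
exists z => x; apply/eqP; rewrite -subr_eq0; apply/eqP.
suff : 2 * (q z x - phi x) = 0 by lra.
apply: (@quad_ge0_lin0 _ (q x x)) => t.
have := le_trans Fz (iF (wadd z (wscl t x))).
rewrite /F phiD phiZ !(psdE pq) (psdC pq x z); lra.
Unshelve. all: by end_near. Qed.

End Riesz.

(** * Completion of a semidefinite form *)

Section Completion.
Context {R : realType} {V : wmod R} (q : V -> V -> R) (pq : psd q).

(** The points of the completion are the Cauchy sequences themselves; sequences with the same limit
    remain distinct, at distance zero. *)
Record cseq := CSeq { cs :> nat -> V ; csP : cau q cs }.

Lemma cau_add (a b : nat -> V) : cau q a -> cau q b ->
  cau q (fun k => wadd (a k) (b k)).
Proof.
move=> ca cb e e0; have e2 : 0 < e / 2 by rewrite divr_gt0.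
have [N HN] := ca _ e2; have [M HM] := cb _ e2.
exists (maxn N M) => m n; rewrite !geq_max => /andP[Nm Mm] /andP[Nn Mn].
rewrite (nrm_congr pq (y := wadd (wsub (a m) (a n)) (wsub (b m) (b n)))).
  apply: le_trans (nrmD pq _ _) _.
  by have := HN _ _ Nm Nn; have := HM _ _ Mm Mn; lra.
by move=> z; rewrite !(psdE pq); ring.
Qed.

Lemma nrmZ r (x : V) : nrm q (wscl r x) = `|r| * nrm q x.
Proof.
by rewrite /nrm !(psdE pq) mulrA -expr2 sqrtrM ?sqr_ge0// sqrtr_sqr.
Qed.

Lemma cau_scl r (a : nat -> V) : cau q a -> cau q (fun k => wscl r (a k)).
Proof.
move=> ca e e0.
have r0 : 0 < `|r| + 1 by rewrite ltr_wpDl.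
have [N HN] := ca _ (divr_gt0 e0 r0).
exists N => m n Nm Nn.
rewrite (nrm_congr pq (y := wscl r (wsub (a m) (a n)))); last first.
  by move=> z; rewrite !(psdE pq); ring.
rewrite nrmZ; apply: le_trans (ler_wpM2l (normr_ge0 _) (HN _ _ Nm Nn)) _.
by rewrite mulrCA ler_piMr ?(ltW e0)// ler_pdivrMr ?mul1r ?lerDl.
Qed.

Definition completion : wmod R :=
  WMod (fun a b => CSeq (cau_add (csP a) (csP b)))
       (fun r a => CSeq (cau_scl r (csP a))).

Lemma cau_cst (v : V) : cau q (fun=> v).
Proof. by move=> e e0; exists 0%N => *; rewrite nrmxx// ltW. Qed.

Definition emb (v : V) : completion := CSeq (cau_cst v).

(** The form [phi] need not be the completed one: [H], [L] and their sum must all live on the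
    completion for the sum. The limit exists as soon as [phi] is dominated by [q], see [ext_cvg]. *)
Definition ext (phi : V -> V -> R) (a b : completion) : R :=
  limn (fun k => phi (cs a k) (cs b k)).

Section Ext.
Variables (phi : V -> V -> R) (pphi : psd phi).
Hypothesis phiq : forall x, phi x x <= q x x.

Lemma nrm_dom x : nrm phi x <= nrm q x.
Proof. by rewrite /nrm ler_sqrt ?psd_ge0. Qed.

Lemma cau_nrm_cvg (a : nat -> V) : cau q a -> cvgn (fun k => nrm phi (a k)).
Proof.
move=> ca; apply: real_cauchy_cvg => e e0.
have [N HN] := ca _ e0; exists N => m n Nm Nn.
apply: le_trans (nrm_dist pphi _ _) _.
exact: le_trans (nrm_dom _) (HN _ _ Nm Nn).
Qed.

Lemma ext_cvg (a b : completion) :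
  (fun k => phi (cs a k) (cs b k)) @ \oo --> ext phi a b.
Proof.
suff : cvgn (fun k => phi (cs a k) (cs b k)) by [].
have sq (u : nat -> V) : cau q u -> cvgn (fun k => phi (u k) (u k)).
  move=> /cau_nrm_cvg cu.
  have -> : (fun k => phi (u k) (u k)) = (fun k => nrm phi (u k) * nrm phi (u k)).
    by apply/funext => k; rewrite -expr2 nrm_sq.
  exact: is_cvgM.
have cab := sq _ (cau_add (csP a) (csP b)).
have cab' := sq _ (cau_add (csP a) (cau_scl (-1) (csP b))).
have -> : (fun k => phi (cs a k) (cs b k)) =
    (fun k => (phi (wadd (a k) (b k)) (wadd (a k) (b k)) -
     phi (wsub (a k) (b k)) (wsub (a k) (b k))) * 4^-1).
  by apply/funext => k; rewrite -psd_polar.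
exact: (is_cvgM (is_cvgB cab cab') (is_cvg_cst (4^-1 : R))).
Qed.

Arguments ext_cvg a b : clear implicits.

Lemma psd_ext : psd (ext phi).
Proof.
split=> [a b|a b c|r a b|a].
- rewrite /ext.
  suff -> : (fun k => phi (cs a k) (cs b k)) = (fun k => phi (cs b k) (cs a k)) by [].
  by apply/funext => k; rewrite psdC.
- rewrite {1}/ext (_ : (fun k => _) = (fun k => phi (cs a k) (cs c k) + phi (cs b k) (cs c k))).
    exact: (cvg_lim (@Rhausdorff R) (cvgD (ext_cvg a c) (ext_cvg b c))).
  by apply/funext => k /=; rewrite psdDl.
- rewrite {1}/ext (_ : (fun k => _) = (fun k => r * phi (cs a k) (cs b k))).
    exact: (cvg_lim (@Rhausdorff R) (cvgM (cvg_cst r) (ext_cvg a b))).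
  by apply/funext => k /=; rewrite psdZl.
- apply: limr_ge; first exact: (cvgP _ (ext_cvg a a)).
  by apply: nearW => k; exact: psd_ge0.
Qed.

Lemma ext_emb v w : ext phi (emb v) (emb w) = phi v w.
Proof. exact: (cvg_lim (@Rhausdorff R) (cvg_cst (phi v w))). Qed.

Lemma ext_emb_cvg (a : completion) w :
  (fun k => phi (cs a k) w) @ \oo --> ext phi a (emb w).
Proof. exact: (ext_cvg a (emb w)). Qed.

End Ext.
Arguments ext_cvg {phi} pphi phiq a b : rename.
Arguments ext_emb_cvg {phi} pphi phiq a w : rename.

Let qq x : q x x <= q x x. Proof. by []. Qed.
Let pQ := psd_ext pq qq.

Lemma emb_dense (a : completion) : tends (ext q) (fun k => emb (cs a k)) a.
Proof.
move=> e e0; have [N HN] := csP a e0; exists N => m Nm.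
rewrite (nrm_le_sq pQ _ (ltW e0)); apply: limr_le.
  by exact: (cvgP _ (ext_cvg pq qq (wsub (emb (cs a m)) a) (wsub (emb (cs a m)) a))).
near=> k; rewrite -(nrm_le_sq pq _ (ltW e0)); apply: HN => //.
by near: k; exists N.
Unshelve. all: by end_near. Qed.

(** Diagonal argument: each [u n] is replaced by one term of its own Cauchy sequence at distance at
    most [n.+1%:R^-1], and the sequence of these terms is the limit. *)
Lemma completion_complete : complete_form (ext q).
Proof.
move=> u cu.
have i0 (n : nat) : 0 < n.+1%:R^-1 :> R by rewrite invr_gt0.
have /choice[N HN] n : exists N, nrm (ext q) (wsub (emb (cs (u n) N)) (u n)) <= n.+1%:R^-1.
  by have [N HN] := emb_dense (u n) (i0 n); exists N; exact: HN.
pose x n := cs (u n) (N n).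
have small e : 0 < e -> exists M, forall n, (M <= n)%N -> n.+1%:R^-1 <= e :> R.
  move=> e0; have [M _ HM] := near_infty_natSinv_lt (PosNum e0).
  by exists M => n Mn; exact/ltW/HM.
have xu n : nrm (ext q) (wsub (emb (x n)) (u n)) <= n.+1%:R^-1 by exact: HN.
have cx : cau q x.
  move=> e e0; have e3 : 0 < e / 3 by rewrite divr_gt0.
  have [M HM] := small _ e3; have [K HK] := cu _ e3.
  exists (maxn M K) => m n; rewrite !geq_max => /andP[Mm Km] /andP[Mn Kn].
  have -> : nrm q (wsub (x m) (x n)) = nrm (ext q) (wsub (emb (x m)) (emb (x n))).
    by rewrite /nrm !(psdE pq) !(psdE pQ) !ext_emb.
  apply: le_trans (nrm_tri pQ (u m) _ _) _.
  have := nrm_tri pQ (u n) (u m) (emb (x n)).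
  rewrite (nrmBC pQ (u n) (emb (x n))).
  have := xu m; have := xu n; have := HM _ Mm; have := HM _ Mn; have := HK _ _ Km Kn.
  move: (m.+1%:R^-1) (n.+1%:R^-1) => a b; lra.
exists (CSeq cx) => e e0; have e2 : 0 < e / 2 by rewrite divr_gt0.
have [M HM] := small _ e2; have [K HK] := emb_dense (CSeq cx) e2.
exists (maxn M K) => m; rewrite geq_max => /andP[Mm Km].
have := nrm_tri pQ (emb (x m)) (u m) (CSeq cx); rewrite (nrmBC pQ (u m) (emb (x m))).
have hk : nrm (ext q) (wsub (emb (x m)) (CSeq cx)) <= e / 2 := HK _ Km.
move: hk; have := xu m; have := HM _ Mm.
move: (m.+1%:R^-1) => a; lra.
Qed.

End Completion.
Arguments ext_cvg {R V q} pq {phi} pphi phiq a b.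
Arguments ext_emb_cvg {R V q} pq {phi} pphi phiq a w.

(** * Polynomial approximation of the square root *)

Section Cone.
Context {R : realType}.
Implicit Types p s : {poly R}.

(* Evaluated at a self-adjoint operator [0 <= X <= 1], these polynomials are
   positive operators: see [mom_cone_ge0]. *)
Inductive cone : {poly R} -> Prop :=
| cone_mon i j : cone ('X^i * (1 - 'X) ^+ j)
| cone_add p s : cone p -> cone s -> cone (p + s)
| cone_scl a p : 0 <= a -> cone p -> cone (a%:P * p).

Lemma cone1 : cone 1.
Proof. by have := cone_mon 0 0; rewrite !expr0 mulr1. Qed.

Lemma coneX : cone 'X.
Proof. by have := cone_mon 1 0; rewrite expr0 mulr1. Qed.

Lemma cone1X : cone (1 - 'X).
Proof. by have := cone_mon 0 1; rewrite expr0 mul1r. Qed.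

Lemma cone0 : cone 0.
Proof. by have := cone_scl (lexx 0) cone1; rewrite mul0r. Qed.

Lemma cone_mul p s : cone p -> cone s -> cone (p * s).
Proof.
elim=> [i j|p1 p2 _ H1 _ H2 cs|a p1 a0 _ H1 cs].
- elim=> [i' j'|p1 p2 _ H1 _ H2|a p1 a0 _ H1].
  + rewrite mulrACA -!exprD; exact: cone_mon.
  + by rewrite mulrDr; exact: cone_add.
  + by rewrite mulrCA; exact: cone_scl.
- by rewrite mulrDl; apply: cone_add; [exact: H1|exact: H2].
- by rewrite -mulrA; apply: cone_scl => //; exact: H1.
Qed.

Lemma cone_exp p n : cone p -> cone (p ^+ n).
Proof.
by move=> cp; elim: n => [|n IH]; [exact: cone1|rewrite exprS; exact: cone_mul].
Qed.

Let hf : {poly R} := (2^-1)%:P.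

Let hf2 : hf * 2 = 1.
Proof.
by rewrite /hf -[2]/(2%:R) -polyC_natr -polyCM mulVf.
Qed.

Let cone_hf p : cone p -> cone (hf * p).
Proof. by apply: cone_scl; rewrite invr_ge0. Qed.

(* [sqw k] decreases to [1 - sqrt (x (1 - x))], being the classical iteration
   for the square root of [x (1 - x)]; then [sqp k] increases to
   [(x (1 - x))^(-1/2)]. *)
Fixpoint sqw k : {poly R} :=
  if k is k'.+1 then hf * ((1 - 'X + 'X^2) + sqw k' ^+ 2) else 1.

(** With [a = x (1 - x)] and [y = sqp k], this is the residual [1 - a y^2], while [sqw k] is
    [1 - a y]; see [sq_inv]. Apart from the generator [1 - 'X], the recursions contain no
    subtraction, which makes membership in the cone visible. *)
Fixpoint sqt k : {poly R} :=
  if k is k'.+1 then hf * (sqt k' * (sqw k' + sqw k)) else 1.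

Fixpoint sqp k : {poly R} :=
  if k is k'.+1 then sqp k' + hf * sqt k' else 0.

Lemma cone_sqw k : cone (sqw k).
Proof.
elim: k => [|k IH] /=; first exact: cone1.
apply: cone_hf; apply: cone_add; last exact: cone_exp.
by apply: cone_add; [exact: cone1X|apply: cone_exp; exact: coneX].
Qed.

Lemma cone_sqt k : cone (sqt k).
Proof.
elim: k => [|k IH]; first exact: cone1.
rewrite [sqt _]/=; apply: cone_hf; apply: cone_mul => //.
by apply: cone_add; [exact: cone_sqw|exact: (cone_sqw k.+1)].
Qed.

Lemma cone_sqpS k : cone (sqp k.+1 - sqp k).
Proof.
by rewrite /= addrC addKr; apply: cone_hf; exact: cone_sqt.
Qed.

Lemma cone_sqpB k m : (k <= m)%N -> cone (sqp m - sqp k).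
Proof.
elim: m => [|m IH]; first by rewrite leqn0 => /eqP ->; rewrite subrr; exact: cone0.
rewrite leq_eqVlt => /predU1P[->|]; first by rewrite subrr; exact: cone0.
rewrite ltnS => /IH km; rewrite (_ : _ - _ = (sqp m.+1 - sqp m) + (sqp m - sqp k)).
  by apply: cone_add => //; exact: cone_sqpS.
by rewrite addrA subrK.
Qed.

Lemma cone_sqp k : cone (sqp k).
Proof. by have := cone_sqpB (leq0n k); rewrite subr0. Qed.

Lemma sq_inv k : sqw k = 1 - (1 - 'X) * 'X * sqp k /\
  sqt k = 1 - (1 - 'X) * 'X * sqp k ^+ 2.
Proof.
elim: k => [|k [Hw Ht]]; first by rewrite /= expr0n !mulr0 subr0.
have Hw' : sqw k.+1 = 1 - (1 - 'X) * 'X * sqp k.+1.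
  have -> : sqw k.+1 = hf * ((1 - 'X + 'X^2) + sqw k ^+ 2) by [].
  have -> : sqp k.+1 = sqp k + hf * sqt k by [].
  rewrite Hw Ht; apply/eqP; rewrite -subr_eq0; apply/eqP.
  (* The constant 1/2 is abstracted for [ring], so the two sides agree only up to a multiple of
     [hf * 2 - 1]. *)
  transitivity ((hf * 2 - 1) * (1 - (1 - 'X) * 'X * sqp k)); last first.
    by rewrite hf2 subrr mul0r.
  move: hf (sqp k) => h y; ring.
split=> //.
have -> : sqt k.+1 = hf * (sqt k * (sqw k + sqw k.+1)) by [].
have -> : sqp k.+1 = sqp k + hf * sqt k by [].
apply/eqP; rewrite -subr_eq0 Hw' Hw /= -/hf Ht; apply/eqP.
transitivity ((hf * 2 - 1) * (1 - (1 - 'X) * 'X * sqp k ^+ 2)); first by move: hf (sqp k) => h y; ring.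
by rewrite hf2 subrr mul0r.
Qed.

Lemma sqtE k : sqt k = 1 - (1 - 'X) * 'X * sqp k ^+ 2.
Proof. by have [] := sq_inv k. Qed.

Lemma cone_1sqt k : cone (1 - sqt k).
Proof.
rewrite sqtE opprB addrC subrK; apply: cone_mul.
  by apply: cone_mul; [exact: cone1X|exact: coneX].
by apply: cone_exp; exact: cone_sqp.
Qed.

(** With [a = x (1 - x)], [y_k = sqp k] and [t_k = sqt k], the decrease is exactly
    [t_k a (y_k + y_(k+1)) / 2], and [y_k >= 1/2] as soon as [k > 0], whereas [y_0 = 0]. *)
Lemma cone_sqt_dec k : (0 < k)%N ->
  cone (sqt k - sqt k.+1 - (2^-1)%:P * ((1 - 'X) * 'X * sqt k)).
Proof.
case: k => // k _; rewrite -/hf.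
have h1 j : cone (sqp j.+1 - hf).
  have := cone_sqpB (ltn0Sn j); by rewrite [X in _ - X]/= mulr1 add0r.
have -> : sqt k.+1 - sqt k.+2 - hf * ((1 - 'X) * 'X * sqt k.+1) =
  sqt k.+1 * (hf * ((1 - 'X) * 'X * ((sqp k.+1 - hf) + (sqp k.+2 - hf)))).
  have [Hw _] := sq_inv k.+1; have [Hw' _] := sq_inv k.+2.
  have -> : sqt k.+2 = hf * (sqt k.+1 * (sqw k.+1 + sqw k.+2)) by [].
  rewrite Hw Hw'; apply/eqP; rewrite -subr_eq0; apply/eqP.
  transitivity ((hf * 2 - 1) * (- sqt k.+1 * (1 - hf * ((1 - 'X) * 'X)))); last first.
    by rewrite hf2 subrr mul0r.
  move: hf (sqp k.+1) (sqp k.+2) (sqt k.+1) => h y y' t; ring.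
apply: cone_mul; first exact: cone_sqt.
apply: cone_hf; apply: cone_mul; last by apply: cone_add; exact: h1.
by apply: cone_mul; [exact: cone1X|exact: coneX].
Qed.

Lemma cone_1Xn n : cone (1 - 'X^n).
Proof.
rewrite -[X in X - _](expr1n _ n) subrXX; apply: cone_mul; first exact: cone1X.
elim/big_ind : _ => [||i _]; [exact: cone0|exact: cone_add|].
by rewrite expr1n mul1r; apply: cone_exp; exact: coneX.
Qed.

End Cone.

(** * Polynomial functional calculus for a pair of forms *)

Section Friedrichs.
Context {R : realType} {E : wmod R} (Q H L : E -> E -> R) (x0 : E).
Hypothesis pQ : psd Q.
Hypothesis pH : psd H.
Hypothesis pL : psd L.
Hypothesis QHL : forall x y, Q x y = H x y + L x y.
Hypothesis cQ : complete_form Q.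

Implicit Types (p s : {poly R}) (f g : E).

Lemma H_le_Q x : H x x <= Q x x.
Proof. by rewrite QHL lerDl psd_ge0. Qed.

Lemma L_le_Q x : L x x <= Q x x.
Proof. by rewrite QHL lerDr psd_ge0. Qed.

Lemma ex_opX : exists X : E -> E, forall f g, Q (X f) g = H f g.
Proof.
have /choice[X HX] f : exists y, forall g, Q y g = H f g.
  apply: (riesz (M := nrm H f) pQ x0 cQ) => [x y|a x|x].
  - exact: psdDr.
  - exact: psdZr.
  - apply: le_trans (psd_CSn pH _ _) _; apply: ler_wpM2l; first exact: nrm_ge0.
    by rewrite /nrm ler_sqrt ?psd_ge0// H_le_Q.
by exists X.
Qed.

(* [opX] is [(1 + T)^-1] where [H (f, g) = <T^-1 f, g>] for the form [L]. *)
Definition opX : E -> E := sval (cid ex_opX).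

Lemma opXE f g : Q (opX f) g = H f g.
Proof. exact: (svalP (cid ex_opX)). Qed.

Lemma opX_sym f g : Q (opX f) g = Q f (opX g).
Proof. by rewrite opXE psdC// (psdC pQ) opXE. Qed.

Lemma opX_iter_sym i f g : Q (iter i opX f) g = Q f (iter i opX g).
Proof.
by elim: i f g => // i IH f g; rewrite iterS opX_sym IH -iterSr.
Qed.

(** The matrix coefficient [Q (p(X) f, g)]. For these scalars the identities in [p] are exact
    equalities, while the vectors [p(X) f] only make sense up to null vectors. *)
Definition mom (f g : E) (p : {poly R}) : R :=
  \sum_(i < size p) p`_i * Q (iter i opX f) g.

Lemma momE f g p N : (size p <= N)%N ->
  mom f g p = \sum_(i < N) p`_i * Q (iter i opX f) g.
Proof.
move=> pN; rewrite /mom (big_ord_widen N (fun i => p`_i * Q (iter i opX f) g))//.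
rewrite big_mkcond; apply: eq_bigr => i _; case: ifPn => //.
by rewrite -leqNgt => /(nth_default 0) ->; rewrite mul0r.
Qed.

Lemma momD f g p s : mom f g (p + s) = mom f g p + mom f g s.
Proof.
rewrite !(@momE _ _ _ (maxn (size p) (size s))) ?leq_maxl ?leq_maxr ?size_polyD//.
by rewrite -big_split; apply: eq_bigr => i _; rewrite coefD mulrDl.
Qed.

Lemma momZ f g a p : mom f g (a%:P * p) = a * mom f g p.
Proof.
rewrite mul_polyC (@momE _ _ _ (size p)) ?size_scale_leq// /mom mulr_sumr.
by apply: eq_bigr => i _; rewrite coefZ mulrA.
Qed.

Lemma momN f g p : mom f g (- p) = - mom f g p.
Proof. by rewrite -mulN1r -polyCN momZ mulN1r. Qed.

Lemma momB f g p s : mom f g (p - s) = mom f g p - mom f g s.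
Proof. by rewrite momD momN. Qed.

Lemma mom0 f g : mom f g 0 = 0.
Proof. by rewrite /mom size_poly0 big_ord0. Qed.

Lemma mom1 f g : mom f g 1 = Q f g.
Proof. by rewrite /mom size_poly1 big_ord1 coef1 mul1r. Qed.

Lemma momC f g a : mom f g a%:P = a * Q f g.
Proof. by rewrite -[a%:P]mulr1 momZ mom1. Qed.

Lemma momMX f g p : mom f g (p * 'X) = mom (opX f) g p.
Proof.
rewrite (@momE _ _ _ (size p).+1); last first.
  by rewrite (leq_trans (size_polyMleq _ _))// size_polyX addn2.
rewrite big_ord_recl coefMX /= mul0r add0r /mom; apply: eq_bigr => i _.
by rewrite coefMX /= -iterSr.
Qed.

Lemma mom_sym f g p : mom f g p = mom g f p.
Proof.
by apply: eq_bigr => i _; rewrite opX_iter_sym psdC.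
Qed.

Lemma ex_opP p f : exists y, forall g, Q y g = mom f g p.
Proof.
elim/poly_ind: p => [|p c [y Hy]].
  by exists (wscl 0 x0) => g; rewrite psdZl// mul0r mom0.
exists (wadd (opX y) (wscl c f)) => g.
by rewrite !(psdE pQ) opX_sym Hy momD momC mom_sym -momMX mom_sym.
Qed.

Definition opP p f : E := sval (cid (ex_opP p f)).

Lemma opPE p f g : Q (opP p f) g = mom f g p.
Proof. exact: (svalP (cid (ex_opP p f))). Qed.

Lemma momM f g p s : mom f (opP s g) p = mom f g (p * s).
Proof.
elim/poly_ind: p f => [|p c IH] f; first by rewrite mul0r !mom0.
rewrite mulrDl !momD !momC momMX IH mulrAC momMX momZ; congr (_ + _ * _).
by rewrite psdC// opPE mom_sym.
Qed.

Lemma opP_mul f g p s : Q (opP p f) (opP s g) = mom f g (p * s).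
Proof. by rewrite opPE momM. Qed.

Lemma opP_sym p f g : Q (opP p f) g = Q f (opP p g).
Proof. by rewrite opPE (psdC pQ f) opPE mom_sym. Qed.

Lemma opP_H p f g : H (opP p f) g = mom f g (p * 'X).
Proof.
by rewrite -opXE opX_sym opPE mom_sym -momMX mom_sym.
Qed.

Lemma opP_L p f g : L (opP p f) g = mom f g (p * (1 - 'X)).
Proof.
rewrite mulrBr mulr1 momB -opP_H -opPE QHL; ring.
Qed.

Lemma opP_H_sym p f g : H (opP p f) g = H f (opP p g).
Proof. by rewrite (psdC pH f) !opP_H mom_sym. Qed.

Lemma opP_LL f g p s : L (opP p f) (opP s g) = mom f g (p * (1 - 'X) * s).
Proof. by rewrite opP_L momM. Qed.

Lemma momX f g : mom f g 'X = H f g.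
Proof. by rewrite -['X]mul1r momMX mom1 opXE. Qed.

Lemma mom1X f g : mom f g (1 - 'X) = L f g.
Proof. by rewrite momB mom1 momX QHL; ring. Qed.

(** This is [X^2 <= X]. With [t = Q (X f, X f) = H (f, X f)], Cauchy-Schwarz for [H] and [H <= Q]
    give [t^2 <= H (f, f) t]. *)
Lemma QXX_le_H f : Q (opX f) (opX f) <= H f f.
Proof.
have CS := psd_CS pH f (opX f).
have HQ := H_le_Q (opX f).
have E1 : Q (opX f) (opX f) = H f (opX f) by rewrite opXE.
have [t0|t0] := leP (H f (opX f)) 0.
  by rewrite E1; apply: le_trans t0 (psd_ge0 pH f).
rewrite -(ler_pM2r t0) E1 -expr2; apply: le_trans CS _.
by rewrite -E1 ler_wpM2l// psd_ge0.
Qed.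

Lemma momX1X_ge0 f : 0 <= mom f f ('X * (1 - 'X)).
Proof.
rewrite mulrBr mulr1 momB momMX !momX subr_ge0 (psdC pH) -opXE.
exact: QXX_le_H.
Qed.

Lemma mom_sq f p s : mom f f (s * p * s) = mom (opP s f) (opP s f) p.
Proof. by rewrite momM mom_sym momM (mulrC p). Qed.

Lemma mom_cone_ge0 f p : cone p -> 0 <= mom f f p.
Proof.
elim=> [k l|p1 p2 _ H1 _ H2|a p1 a0 _ H1].
- have -> : 'X^k * (1 - 'X) ^+ l = ('X^(k./2) * (1 - 'X) ^+ l./2) *
    ('X^(odd k) * (1 - 'X) ^+ odd l) * ('X^(k./2) * (1 - 'X) ^+ l./2) :> {poly R}.
    rewrite -{1}[k]odd_double_half -{1}[l]odd_double_half -!addnn !exprD; ring.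
  rewrite mom_sq; move: (opP _ f) => g.
  case: (odd k); case: (odd l); rewrite ?expr1 ?expr0 ?mulr1 ?mul1r.
  + exact: momX1X_ge0.
  + by rewrite momX psd_ge0.
  + by rewrite mom1X psd_ge0.
  + by rewrite mom1 psd_ge0.
- by rewrite momD addr_ge0.
- by rewrite momZ mulr_ge0.
Qed.

Lemma mom_cone_le f p s : cone (s - p) -> mom f f p <= mom f f s.
Proof. by move=> /(mom_cone_ge0 f); rewrite momB subr_ge0. Qed.

Lemma psd_mom p : cone p -> psd (fun f g => mom f g p).
Proof.
move=> cp; split=> [f g|f g k|a f g|f].
- exact: mom_sym.
- by rewrite mom_sym -opPE psdDr// !opPE !(mom_sym k).
- by rewrite mom_sym -opPE psdZr// opPE mom_sym.
- exact: mom_cone_ge0.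
Qed.

Hypothesis LH0 : forall f, L f f = 0 -> H f f = 0.

Lemma mom_Xn_dec f m n : (m <= n)%N -> mom f f 'X^n <= mom f f 'X^m.
Proof.
move=> mn; apply: mom_cone_le.
rewrite -(subnKC mn) exprD -{1}['X^m]mulr1 -mulrBr.
by apply: cone_mul; [apply: cone_exp; exact: coneX|exact: cone_1Xn].
Qed.

(** The moments decrease, hence [X^n f] is Cauchy for [Q]. The difference of two consecutive moments
    is the squared [L] norm of a power, so the limit vector is null for [L] and, by [LH0], for [Q].
    Spectrally, [1] is not an eigenvalue of [X]. *)
Lemma mom_Xn_cvg0 f : (fun n => mom f f 'X^n) @ \oo --> 0.
Proof.
pose a n := mom f f 'X^n.
have a0 n : 0 <= a n by apply: mom_cone_ge0; apply: cone_exp; exact: coneX.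
have adec : nonincreasing_seq a by move=> m n; exact: mom_Xn_dec.
have ac : cvgn a.
  by apply: nonincreasing_is_cvgn => //; exists 0 => _ [n _ <-].
pose u n := opP 'X^n f.
have uu m n : Q (wsub (u m) (u n)) (wsub (u m) (u n)) = a (m + m)%N - 2 * a (m + n)%N + a (n + n)%N.
  rewrite !(psdE pQ) !opP_mul -!exprD (addnC n m) /a; ring.
have uL n : L (u n) (u n) = a (n + n)%N - a (n + n).+1.
  rewrite opP_LL /a -momB; congr mom; rewrite exprS exprD; ring.
have inf_le n : limn a <= a n by apply: nonincreasing_cvgn_ge.
have asmall e : 0 < e -> exists N, forall n, (N <= n)%N -> a n <= limn a + e.
  move=> e0; have /cvgrPdist_le/(_ _ e0)[N _ HN] := ac.
  by exists N => n Nn; have := HN n Nn; rewrite ler_norml => /andP[]; lra.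
have cu : cau Q u.
  move=> e e0; have e2 : 0 < e ^+ 2 / 2 by rewrite divr_gt0 ?exprn_gt0.
  have [N HN] := asmall _ e2; exists N => m n Nm Nn.
  rewrite (nrm_le_sq pQ _ (ltW e0)) uu.
  have := HN (m + m)%N (leq_trans Nm (leq_addr _ _)).
  have := HN (n + n)%N (leq_trans Nn (leq_addr _ _)).
  have := inf_le (m + n)%N; move: (e ^+ 2) => d; lra.
have [v uv] := cQ cu.
have nLQ x : nrm L x <= nrm Q x by rewrite /nrm ler_sqrt ?psd_ge0// L_le_Q.
have Lv : L v v = 0.
  suff nv0 : nrm L v <= 0.
    by rewrite -nrm_sq//; apply/eqP; rewrite sqrf_eq0 eq_le nv0 nrm_ge0.
  rewrite leNgt; apply/negP => v0.
  have e0 : 0 < nrm L v / 4 by rewrite divr_gt0.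
  have [N HN] := uv _ e0; have [M HM] := asmall _ (exprn_gt0 2 e0).
  pose n := maxn N M.
  have h1 := le_trans (nLQ _) (HN n (leq_maxl _ _)).
  have h2 : nrm L (u n) <= nrm L v / 4.
    rewrite (nrm_le_sq pL _ (ltW e0)) uL.
    have := HM (n + n)%N (leq_trans (leq_maxr N M) (leq_addr _ _)).
    have := inf_le (n + n).+1; move: ((nrm L v / 4) ^+ 2) => d; lra.
  have := nrm_dist pL v (u n); rewrite (nrmBC pL v) ler_norml => /andP[]; lra.
have Qv : nrm Q v = 0 by rewrite /nrm QHL LH0// Lv addr0 sqrtr0.
suff l0 : limn a <= 0.
  suff -> : 0 = limn a by exact: ac.
  apply/eqP; rewrite eq_le l0 andbT; apply: limr_ge => //.
  by apply: nearW => n; exact: a0.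
rewrite leNgt; apply/negP => d0.
have e0 : 0 < Num.sqrt (limn a / 2) by rewrite sqrtr_gt0 divr_gt0.
have [N HN] := uv _ e0.
have h : nrm Q (u N) <= Num.sqrt (limn a / 2).
  apply: le_trans (HN N (leqnn _)).
  by have := nrm_dist pQ (u N) v; rewrite Qv subr0 => /(le_trans (ler_norm _)).
have h2 : Q (u N) (u N) <= limn a / 2.
  by move: h; rewrite (nrm_le_sq pQ _ (ltW e0)) sqr_sqrtr// ltW// divr_gt0.
have := inf_le (N + N)%N; have -> : a (N + N)%N = Q (u N) (u N).
  by rewrite opP_mul -exprD.
by move=> h3; have := le_trans h3 h2; rewrite leNgt ltr_pdivrMr// ltr_pMr// ltr1n.
Qed.

(** Summing [cone_sqt_dec] over [1, ..., k] telescopes to at most twice the first term; the summands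
    on the left decrease, so the last one may be counted [k] times. *)
Lemma mom_sqt_rate f k : (0 < k)%N ->
  k%:R * mom f f ((1 - 'X) * 'X * sqt k) <= 2 * Q f f.
Proof.
have ccx : cone ((1 - 'X) * 'X : {poly R}).
  by apply: cone_mul; [exact: cone1X|exact: coneX].
have step j : (0 < j)%N -> mom f f ((1 - 'X) * 'X * sqt j) <=
    2 * (mom f f (sqt j) - mom f f (sqt j.+1)).
  move=> /(@cone_sqt_dec R) /(mom_cone_ge0 f); rewrite !momB.
  rewrite (momZ f f 2^-1 ((1 - 'X) * 'X * sqt j)).
  move: (mom f f _) (mom f f _) (mom f f _) => a b c; lra.
have dec j : (0 < j)%N -> mom f f ((1 - 'X) * 'X * sqt j.+1) <=
    mom f f ((1 - 'X) * 'X * sqt j).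
  move=> j0; apply: mom_cone_le; rewrite -mulrBr; apply: cone_mul => //.
  rewrite -[X in cone X](subrK ((2^-1)%:P * ((1 - 'X) * 'X * sqt j))).
  apply: cone_add; first exact: cone_sqt_dec.
  by apply: cone_scl; rewrite ?invr_ge0//; apply: cone_mul => //; exact: cone_sqt.
suff H' : (0 < k)%N -> k%:R * mom f f ((1 - 'X) * 'X * sqt k) <=
    2 * (mom f f (sqt 1) - mom f f (sqt k.+1)).
  move=> /H' h; apply: le_trans h _.
  have := mom_cone_ge0 f (cone_sqt k.+1).
  have := mom_cone_le f (cone_1sqt 1); rewrite mom1; lra.
elim: k => // -[_ _|k IH _]; first by rewrite mul1r; exact: step.
have := IH isT; have := step k.+2 isT; have := dec k.+1 isT.
move: (mom f f _) (mom f f _) => a b d1 d2.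
have kba : k.+1%:R * b <= k.+1%:R * a by rewrite ler_wpM2l.
have -> : k.+2%:R = k.+1%:R + 1 :> R by rewrite natr1.
move=> h; rewrite [leLHS]mulrDl mul1r.
have := lerD (le_trans kba h) d2; rewrite -mulrDr => /le_trans; apply.
by rewrite addrA subrK.
Qed.

(** Writing [t] for [sqt k], expand [X t] as the sum of [X^m (1 - X) X t] over [m < N] plus
    [X^N X t], and use [X^m <= 1] and [t <= 1]. The rate is only known in the presence of [1 - X],
    which degenerates where [X] is close to 1; that region is controlled by the powers of [X]. *)
Lemma mom_sqt_bound f k N : mom f f ('X * sqt k) <=
  N%:R * mom f f ((1 - 'X) * 'X * sqt k) + mom f f 'X^(N.+1).
Proof.
have h : mom f f ('X * sqt k) <=
  N%:R * mom f f ((1 - 'X) * 'X * sqt k) + mom f f ('X^N * ('X * sqt k)).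
  elim: N => [|N IH]; first by rewrite mul0r add0r expr0 mul1r.
  have h1 : mom f f ('X^N * ('X * sqt k)) <=
      mom f f ((1 - 'X) * 'X * sqt k) + mom f f ('X^(N.+1) * ('X * sqt k)).
    rewrite -momD; apply: mom_cone_le.
    rewrite (_ : _ - _ = (1 - 'X) * 'X * sqt k * (1 - 'X^N)); last first.
      by rewrite exprS; ring.
    apply: cone_mul; last exact: cone_1Xn.
    apply: cone_mul; last exact: cone_sqt.
    by apply: cone_mul; [exact: cone1X|exact: coneX].
  have -> : N.+1%:R = N%:R + 1 :> R by rewrite natr1.
  by rewrite [X in _ <= X + _]mulrDl mul1r -addrA; apply: le_trans IH _; rewrite lerD2l.
apply: le_trans h _; rewrite lerD2l; apply: mom_cone_le.
rewrite (_ : _ - _ = 'X^(N.+1) * (1 - sqt k)); last by rewrite exprS; ring.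
by apply: cone_mul; [apply: cone_exp; exact: coneX|exact: cone_1sqt].
Qed.

Lemma cone_Xsqt k : cone ('X * sqt k : {poly R}).
Proof. by apply: cone_mul; [exact: coneX|exact: cone_sqt]. Qed.

Lemma mom_sqt_cvg0 f : (fun k => mom f f ('X * sqt k)) @ \oo --> 0.
Proof.
apply/cvgrPdist_le => e e0; have e2 : 0 < e / 2 by rewrite divr_gt0.
have /cvgrPdist_le/(_ _ e2)[N _ HN] := mom_Xn_cvg0 f.
have h1 := HN N.+1 (leqnSn N).
near=> k; rewrite sub0r normrN ger0_norm; last exact: mom_cone_ge0 (cone_Xsqt k).
apply: le_trans (mom_sqt_bound f k N) _.
move: h1; rewrite sub0r normrN ger0_norm; last first.
  by apply: mom_cone_ge0; apply: cone_exp; exact: coneX.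
move=> h1; rewrite [leRHS]splitr; apply: lerD => //.
have k0 : (0 < k)%N by near: k; exists 1%N.
have k0R : 0 < k%:R :> R by rewrite ltr0n.
have := mom_sqt_rate f k0; rewrite -ler_pdivlMl// => h.
apply: le_trans (ler_wpM2l (ler0n _ N) h) _.
rewrite mulrCA ler_pdivrMl//.
have : N%:R * (2 * Q f f) / (e / 2) <= k%:R.
  by near: k; exact: nbhs_infty_ger.
by rewrite ler_pdivrMr// mulrC.
Unshelve. all: by end_near. Qed.

Lemma mom_sqt_cvg0_pair f g : (fun k => mom f g ('X * sqt k)) @ \oo --> 0.
Proof.
apply/cvgrPdist_le => e e0.
have cg (x : E) : (fun k => nrm (fun u v => mom u v ('X * sqt k)) x) @ \oo --> 0.
  by rewrite -sqrtr0; apply: continuous_cvg; [exact: sqrt_continuous|exact: mom_sqt_cvg0].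
have := @cvgM _ _ _ _ _ _ _ _ (cg f) (cg g); rewrite mulr0.
move=> /(_ _)/cvgrPdist_le/(_ _ e0)[N _ HN].
exists N => // k Nk; rewrite sub0r normrN.
apply: le_trans (psd_CSn (psd_mom (cone_Xsqt k)) f g) _.
by have := HN k Nk; rewrite sub0r normrN => /(le_trans (ler_norm _)).
Qed.

(* [opR k] approximates [T^(-1/2) = sqrt (X / (1 - X))], an isometry from [H]
   to [L]; the factorization [opR k = X (opS k)] turns pairings for [H + L] into
   pairings for [H]. *)
Definition opR k : E -> E := opP ('X * sqp k).
Definition opS k : E -> E := opP (sqp k).

Lemma opR_Q k f g : Q (opR k f) g = H (opS k f) g.
Proof. by rewrite opP_H opPE mulrC. Qed.

Lemma opR_Qsym k f g : Q (opR k f) g = Q f (opR k g).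
Proof. exact: opP_sym. Qed.

Lemma opR_Hsym k f g : H (opR k f) g = H f (opR k g).
Proof. exact: opP_H_sym. Qed.

Lemma opS_Qsym k f g : Q (opS k f) g = Q f (opS k g).
Proof. exact: opP_sym. Qed.

Lemma opS_ge0 k f : 0 <= Q (opS k f) f.
Proof. by rewrite opPE mom_cone_ge0//; exact: cone_sqp. Qed.

(** For [y = sqp k] and [t = sqt k], the product [(1 - X) (X y)^2] equals [X (1 - t)]: the defect of
    isometry is exactly what [mom_sqt_cvg0] makes small. *)
Lemma opR_L_pair k f g :
  L (opR k f) (opR k g) = H f g - mom f g ('X * sqt k).
Proof. by rewrite opP_LL -momX -momB; congr mom; rewrite sqtE; ring. Qed.

Lemma opR_isometry f g : (fun k => L (opR k f) (opR k g)) @ \oo --> H f g.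
Proof.
rewrite (_ : (fun k => _) = (fun k => H f g - mom f g ('X * sqt k))); last first.
  by apply/funext => k; exact: opR_L_pair.
rewrite -[X in _ --> X]subr0.
exact: (cvgB (cvg_cst _) (mom_sqt_cvg0_pair f g)).
Qed.

Lemma opR_cau f : cau L (fun k => opR k f).
Proof.
move=> e e0.
have /cvgrPdist_le/(_ _ (exprn_gt0 2 e0))[N _ HN] := mom_sqt_cvg0 f.
have main k m : (N <= k)%N -> (k <= m)%N -> nrm L (wsub (opR m f) (opR k f)) <= e.
  move=> Nk km; rewrite (nrm_le_sq pL _ (ltW e0)).
  have hk := HN k Nk; rewrite sub0r normrN in hk.
  apply: le_trans (le_trans (ler_norm _) hk).
  rewrite !(psdE pL) !opP_LL -!momB; apply: mom_cone_le.
  (* Subtracting the polynomial of the squared distance from ['X * sqt k] leaves ['X * sqt m + d],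
     which lies in the cone because [sqp] increases. *)
  pose d : {poly R} := 2 * (1 - 'X) * ('X * 'X) * (sqp k * (sqp m - sqp k)).
  rewrite (_ : _ - _ = 'X * sqt m + d); last by rewrite !sqtE /d; ring.
  apply: cone_add; first exact: cone_Xsqt.
  have c2 : cone (2 : {poly R}).
    by rewrite -[2]/(1 + 1); apply: cone_add; exact: cone1.
  apply: cone_mul; last by apply: cone_mul; [exact: cone_sqp|exact: cone_sqpB].
  apply: cone_mul; first by apply: cone_mul => //; exact: cone1X.
  by apply: cone_mul; exact: coneX.
exists N => m n Nm Nn; have [mn|/ltnW nm] := leqP n m; first exact: main.
by rewrite nrmBC//; exact: main.
Qed.

(** * Commutation with symmetries of both forms *)

Section Equivariance.
Variables ga ga' : E -> E.
Hypothesis gaQ : forall f g, Q (ga f) g = Q f (ga' g).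
Hypothesis gaH : forall f g, H (ga f) g = H f (ga' g).

(** [X] is determined by [Q] and [H], so it commutes with every [ga] having the same adjoint for
    both. The formulation through an adjoint covers left translations as well as the skew-adjoint
    imaginary unit. *)
Lemma opP_equiv p f g : Q (opP p (ga f)) g = Q (opP p f) (ga' g).
Proof.
rewrite !opPE; apply: eq_bigr => -[i _] _ /=; congr (_ * _).
elim: i f => [|i IH] f; first exact: gaQ.
rewrite !iterSr -IH !(opX_iter_sym _ (opX (ga f))) !(opX_iter_sym _ (ga _)).
by rewrite opXE gaH -opXE gaQ.
Qed.

Lemma opP_equivH p f g : H (opP p (ga f)) g = H (opP p f) (ga' g).
Proof.
have hX r t : H (opP p r) t = Q (opP (p * 'X) r) t by rewrite opP_H opPE.
by rewrite !hX opP_equiv.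
Qed.

End Equivariance.
End Friedrichs.

(** * Square integrable functions *)

(* A total and measurable limit; oddness keeps limits of hermitian functions
   hermitian at every point. *)
Definition plim (R : realType) (u : nat -> R) : R :=
  (fine (limn_esup (EFin \o u)) + fine (limn_einf (EFin \o u))) / 2.

Lemma plimN (R : realType) (u : nat -> R) : plim (fun k => - u k) = - plim u.
Proof.
rewrite /plim (_ : EFin \o _ = -%E \o (EFin \o u))//.
by rewrite limn_esupN limn_einfN !fineN; ring.
Qed.

Lemma cvg_plim (R : realType) (u : nat -> R) l : u @ \oo --> l -> plim u = l.
Proof.
move=> ul; have : (EFin \o u) @ \oo --> l%:E by apply: cvg_EFin => //; exact: nearW.
by move=> /cvg_limn_einf_sup[hi hs]; rewrite /plim hi hs /=; lra.
Qed.

Section SquareIntegrable.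
Context {d} {T : measurableType d} {R : realType} (mu : {measure set T -> \bar R}).
Implicit Types f g h : T -> R.

Definition sqint f := measurable_fun [set: T] f /\
  mu.-integrable [set: T] (EFin \o (fun x => f x ^+ 2)).

Definition l2 f g : R := \int[mu]_x (f x * g x).

Lemma sqint_mul f g : sqint f -> sqint g ->
  mu.-integrable [set: T] (EFin \o (fun x => f x * g x)).
Proof.
move=> [mf f2] [mg g2].
apply: (le_integrable _ _ _ (integrableD _ f2 g2)) => //.
  by apply/measurable_EFinP; exact: measurable_funM.
move=> x _ /=; rewrite lee_fin [leRHS]ger0_norm ?addr_ge0 ?sqr_ge0//.
rewrite normrM -(normr_id (f x)) -(normr_id (g x)) !normr_id.
have := sqr_ge0 (`|f x| - `|g x|).
have := sqr_ge0 (`|f x|); have := sqr_ge0 (`|g x|).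
rewrite -[f x ^+ 2]real_normK ?num_real// -[g x ^+ 2]real_normK ?num_real//.
move: `|f x| `|g x| => a b; nra.
Qed.

Lemma sqint_measurable f : sqint f -> measurable_fun [set: T] f.
Proof. by case. Qed.

Lemma sqint_sq f : sqint f -> mu.-integrable [set: T] (EFin \o (fun x => f x ^+ 2)).
Proof. by case. Qed.

Lemma sqintD f g : sqint f -> sqint g -> sqint (fun x => f x + g x).
Proof.
move=> sf sg; have [mf f2] := sf; have [mg g2] := sg.
split; first exact: measurable_funD.
rewrite (_ : _ \o _ = (fun x => ((f x ^+ 2)%:E + (g x ^+ 2)%:E) + 2%:E * (f x * g x)%:E)%E).
  apply: integrableD => //; first exact: integrableD.
  by apply: integrableZl => //; exact: sqint_mul.
by apply/funext => x /=; rewrite -EFinM -!EFinD; congr EFin; ring.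
Qed.

Lemma sqintZ a f : sqint f -> sqint (fun x => a * f x).
Proof.
move=> [mf f2]; split; first exact: measurable_funM.
rewrite (_ : _ \o _ = (fun x => (a ^+ 2)%:E * (f x ^+ 2)%:E)%E).
  exact: integrableZl.
by apply/funext => x /=; rewrite -EFinM exprMn.
Qed.

Lemma sqintN f : sqint f -> sqint (fun x => - f x).
Proof. by move=> /(sqintZ (-1)); under eq_fun do rewrite mulN1r. Qed.

Lemma sqintB f g : sqint f -> sqint g -> sqint (fun x => f x - g x).
Proof. by move=> sf /sqintN; exact: sqintD. Qed.

Lemma sqint0 : sqint (fun=> 0).
Proof.
split; first exact: measurable_cst.
by rewrite (_ : _ \o _ = cst 0%E) ?integrable0//; apply/funext => x /=; rewrite expr0n.
Qed.

Lemma l2C f g : l2 f g = l2 g f.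
Proof. by apply: eq_Rintegral => x _; rewrite mulrC. Qed.

Lemma l2Dl f g h : sqint f -> sqint g -> sqint h ->
  l2 (fun x => f x + g x) h = l2 f h + l2 g h.
Proof.
move=> sf sg sh; rewrite /l2 -RintegralD//; try exact: sqint_mul.
by apply: eq_Rintegral => x _; rewrite mulrDl.
Qed.

Lemma l2Zl a f h : sqint f -> sqint h -> l2 (fun x => a * f x) h = a * l2 f h.
Proof.
move=> sf sh; rewrite /l2 -RintegralZl//; last exact: sqint_mul.
by apply: eq_Rintegral => x _; rewrite mulrA.
Qed.

Lemma l2_ge0 f : 0 <= l2 f f.
Proof. by apply: Rintegral_ge0 => x _; rewrite -expr2 sqr_ge0. Qed.

Lemma l2E f : sqint f -> (l2 f f)%:E = (\int[mu]_x (f x ^+ 2)%:E)%E.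
Proof.
move=> sf; rewrite /l2 /Rintegral; under eq_integral do rewrite -expr2.
by rewrite fineK//; apply: integrable_fin_num => //; exact: sqint_sq.
Qed.

Lemma sqint_le f B : measurable_fun [set: T] f ->
  (\int[mu]_x (f x ^+ 2)%:E <= B%:E)%E -> sqint f /\ l2 f f <= B.
Proof.
move=> mf fB; have sf : sqint f.
  split=> //; apply/integrableP; split.
    by apply/measurable_EFinP; exact: measurable_funX.
  apply: le_lt_trans (ltry B); apply: le_trans fB.
  by under eq_integral do rewrite /= ger0_norm ?sqr_ge0//.
by split=> //; rewrite -lee_fin l2E.
Qed.

Lemma l2_fatou (u : nat -> T -> R) g B : (forall m, sqint (u m)) ->
  measurable_fun [set: T] g ->
  {ae mu, forall x, (fun m => u m x) @ \oo --> g x} ->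
  (\forall m \near \oo, l2 (u m) (u m) <= B) -> sqint g /\ l2 g g <= B.
Proof.
move=> su mg ug uB; apply: sqint_le => //.
apply: (@le_trans _ _ (\int[mu]_x limn_einf (fun m => (u m x ^+ 2)%:E))%E).
  apply: ae_ge0_le_integral => //.
  - by move=> x _; rewrite lee_fin sqr_ge0.
  - by apply/measurable_EFinP; exact: measurable_funX.
  - move=> x _; rewrite limn_einf_lim; apply: lime_ge.
      by apply/cvg_ex; eexists; exact: cvg_einfs_sup.
    apply: nearW => m; apply: le_ereal_inf_tmp => _ [k _ <-].
    by rewrite lee_fin sqr_ge0.
  - rewrite (_ : (fun x => _) = (fun x => - limn_esup (fun m => - (u m x ^+ 2)%:E))%E).
      apply: measurableT_comp => //; apply: measurable_fun_limn_esup => m.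
      apply: measurableT_comp => //; apply/measurable_EFinP.
      by apply: measurable_funX; exact: sqint_measurable.
    by apply/funext => x; rewrite -limn_einfN; congr limn_einf; apply/funext => m /=; rewrite opprK.
  - move: ug; apply: filterS => x ux _.
    have : (fun m => (u m x ^+ 2)%:E) @ \oo --> (g x ^+ 2)%:E.
      apply: cvg_EFin; first by apply: nearW.
      by rewrite /comp /= expr2; under eq_fun do rewrite expr2; exact: cvgM.
    by move=> /cvg_limn_einf_sup[-> _].
apply: le_trans (fatou mu measurableT _ _) _.
- by move=> m; apply/measurable_EFinP; apply: measurable_funX; exact: sqint_measurable.
- by move=> m x _; rewrite lee_fin sqr_ge0.
have [N _ HN] := uB.
rewrite limn_einf_lim; apply: lime_le.
  by apply/cvg_ex; eexists; exact: cvg_einfs_sup.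
apply: nearW => n; apply: (@le_trans _ _ (\int[mu]_x (u (maxn n N) x ^+ 2)%:E)%E).
  by apply: ereal_inf_lbound; exists (maxn n N) => //=; exact: leq_maxl.
by rewrite -l2E// lee_fin; apply: HN; exact: leq_maxr.
Qed.

Lemma measurable_plim (u : nat -> T -> R) :
  (forall k, measurable_fun [set: T] (u k)) ->
  measurable_fun [set: T] (fun x => plim (fun k => u k x)).
Proof.
move=> mu_; rewrite /plim; apply: measurable_funM => //; apply: measurable_funD.
  apply: measurableT_comp => //; apply: measurable_fun_limn_esup => m.
  exact/measurable_EFinP.
apply: measurableT_comp => //.
rewrite (_ : (fun x => _) = (fun x => - limn_esup (fun m => - (u m x)%:E))%E).
  apply: measurableT_comp => //; apply: measurable_fun_limn_esup => m.
  by apply: measurableT_comp => //; apply/measurable_EFinP.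
by apply/funext => x; rewrite -limn_einfN; congr limn_einf; apply/funext => m /=; rewrite opprK.
Qed.

(** The series of the [4 ^+ k * dl k x ^+ 2] has integral at most the sum of the [(4 / 8) ^+ k],
    that is 2, hence is finite almost everywhere; at such points [dl k x] is bounded by a fixed
    multiple of [2^-1 ^+ k]. *)
Lemma fast_cauchy_ae_cvg (u : nat -> T -> R) : (forall k, sqint (u k)) ->
  (forall k, l2 (fun x => u k.+1 x - u k x) (fun x => u k.+1 x - u k x) <= 8^-1 ^+ k) ->
  {ae mu, forall x, cvgn (fun k => u k x)}.
Proof.
move=> su fu; pose dl k x := u k.+1 x - u k x.
have sd k : sqint (dl k) by exact: sqintB.
pose g x := (\sum_(k <oo) (4 ^+ k * dl k x ^+ 2)%:E)%E.
have t0 k x : (0 <= (4 ^+ k * dl k x ^+ 2)%:E)%E.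
  by rewrite lee_fin mulr_ge0 ?sqr_ge0// exprn_ge0.
have mt k : measurable_fun [set: T] (fun x => (4 ^+ k * dl k x ^+ 2)%:E).
  apply/measurable_EFinP; apply: measurable_funM => //.
  by apply: measurable_funX; exact: sqint_measurable.
have mg : measurable_fun [set: T] g.
  by apply: ge0_emeasurable_sum => // k x _ _; exact: t0.
have g0 x : (0 <= g x)%E by apply: nneseries_ge0 => k _ _; exact: t0.
have ig : mu.-integrable [set: T] g.
  apply/integrableP; split=> //.
  under eq_integral do rewrite gee0_abs//.
  rewrite integral_nneseries//; apply: (@le_lt_trans _ _ 2%:E); last exact: ltry.
  have itk k : (\int[mu]_x (4 ^+ k * dl k x ^+ 2)%:E <= (2^-1 ^+ k)%:E)%E.
    under eq_integral do rewrite EFinM.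
    rewrite ge0_integralZl//; last 2 first.
    - apply/measurable_EFinP; apply: measurable_funX; exact: sqint_measurable.
    - by move=> x _; rewrite lee_fin sqr_ge0.
    rewrite -l2E// -EFinM lee_fin.
    apply: le_trans (ler_wpM2l (exprn_ge0 _ _) (fu k)) _ => //.
    by rewrite -exprMn; apply: lerXn2r; rewrite ?nnegrE//; lra.
  have i0 k : (0 <= \int[mu]_x (4 ^+ k * dl k x ^+ 2)%:E)%E by exact: integral_ge0.
  apply: lime_le; first by apply: is_cvg_nneseries => k _ _; exact: i0.
  apply: nearW => n; apply: (@le_trans _ _ (\sum_(0 <= k < n) (2^-1 ^+ k)%:E)%E).
    by apply: lee_sum => k _; exact: itk.
  rewrite sumEFin lee_fin.
  suff -> : \sum_(0 <= k < n) 2^-1 ^+ k = 2 - 2 * 2^-1 ^+ n :> R.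
    by rewrite gerBl mulr_ge0// exprn_ge0// invr_ge0.
  elim: n => [|n IH]; first by rewrite big_nil expr0; ring.
  by rewrite big_nat_recr//= IH exprS; lra.
have := integrable_ae measurableT ig; apply: filterS => x /(_ I) gx.
have gM k : `|dl k x| <= Num.sqrt (fine (g x)) * 2^-1 ^+ k.
  rewrite -ler_sqr ?nnegrE// ?mulr_ge0 ?sqrtr_ge0 ?exprn_ge0// ?invr_ge0//.
  rewrite real_normK ?num_real// exprMn sqr_sqrtr ?fine_ge0//.
  rewrite -exprM mulnC exprM.
  rewrite -[leLHS](mulKf (_ : 4 ^+ k != 0)) ?expf_neq0//.
  rewrite mulrC (_ : 2^-1 ^+ 2 = 4^-1 :> R); last by field.
  rewrite exprVn ler_pM2r ?invr_gt0 ?exprn_gt0//.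
  rewrite -lee_fin fineK//.
  have := @nneseries_lim_ge R (fun k => (4 ^+ k * dl k x ^+ 2)%:E) xpredT 0 k.+1
    (fun n _ _ => t0 n x).
  apply: le_trans; rewrite big_nat_recr//= leeDr//.
  by apply: sume_ge0 => j _; exact: t0.
have cs : cvgn (series (fun k => dl k x)).
  apply: normed_cvg; apply: series_le_cvg gM _ => [n|n|].
  - exact: normr_ge0.
  - by rewrite mulr_ge0 ?sqrtr_ge0// exprn_ge0// invr_ge0.
  apply: is_cvg_geometric_series.
  by rewrite ger0_norm ?invr_ge0// invf_lt1// ltr1n.
rewrite (_ : (fun k => u k x) = (fun k => u 0 x + series (fun k => dl k x) k)).
  by apply: is_cvgD => //; exact: is_cvg_cst.
apply/funext => k; rewrite /series /=; elim: k => [|k IH].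
  by rewrite big_nil addr0.
by rewrite big_nat_recr//= addrA -IH /dl; ring.
Qed.

(** The limit is an explicit [plim], defined at every point, so that pointwise symmetries of the
    [u k] survive. Convergence in L^2 is Fatou's lemma for [u m - u k] as [m] grows. *)
Lemma riesz_fischer (u : nat -> T -> R) : (forall k, sqint (u k)) ->
  (forall k, l2 (fun x => u k.+1 x - u k x) (fun x => u k.+1 x - u k x) <= 8^-1 ^+ k) ->
  (forall e, 0 < e -> exists N, forall m k, (N <= m)%N -> (N <= k)%N ->
    l2 (fun x => u m x - u k x) (fun x => u m x - u k x) <= e) ->
  let f x := plim (fun k => u k x) in
  sqint f /\ forall e, 0 < e -> exists N, forall k, (N <= k)%N ->
    l2 (fun x => f x - u k x) (fun x => f x - u k x) <= e.
Proof.
move=> su fu cu f.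
have mf : measurable_fun [set: T] f.
  by apply: measurable_plim => k; exact: sqint_measurable.
have aeu : {ae mu, forall x, (fun k => u k x) @ \oo --> f x}.
  have := fast_cauchy_ae_cvg su fu; apply: filterS => x cx.
  by rewrite /f (cvg_plim cx).
have main e : 0 < e -> exists N, forall k, (N <= k)%N ->
    sqint (fun x => f x - u k x) /\
    l2 (fun x => f x - u k x) (fun x => f x - u k x) <= e.
  move=> e0; have [N HN] := cu _ e0; exists N => k Nk.
  apply: (@l2_fatou (fun m x => u m x - u k x)) => [m||| ].
  - exact: sqintB.
  - by apply: measurable_funB => //; exact: sqint_measurable.
  - move: aeu; apply: filterS => x ux.
    by apply: cvgB => //; exact: cvg_cst.
  - by exists N => // m /= Nm; exact: HN.
split; last by move=> e /main[N HN]; exists N => k /HN[].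
have [N /(_ _ (leqnn N))[sN _]] := main 1 ltr01.
have := sqintD sN (su N); congr sqint.
by apply/funext => x; rewrite subrK.
Qed.

End SquareIntegrable.

(** * Haar measure *)

Section HaarIntegral.
Context {R : realType} {G : topologicalGroupType}.
Variable mu : {measure set (borel G) -> \bar R}.
Implicit Types (f g : G -> R) (x y z : G) (K : set G).

Lemma open_borel (U : set G) : open U -> measurable (U : set (borel G)).
Proof. by move=> oU; apply: sub_sigma_algebra. Qed.

Lemma closed_borel (F : set G) : closed F -> measurable (F : set (borel G)).
Proof.
move=> cF; rewrite -[F]setCK; apply: measurableC; apply: open_borel.
exact: closed_openC.
Qed.

Lemma continuous_borel f : continuous f -> measurable_fun [set: borel G] f.
Proof.
move=> /continuousP cf; apply: (measurability _ (RGenOpens.measurableE R)).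
move=> _ [_ [a [b ->] <-]]; rewrite setTI; apply: open_borel.
exact/cf/interval_open.
Qed.

Lemma continuous_borel_map (f : G -> G) : continuous f ->
  measurable_fun [set: borel G] (f : borel G -> borel G).
Proof.
move=> /continuousP cf; apply: (@measurability _ _ (borel G) (borel G) setT f (@open G)) => //.
by move=> _ [a oa <-]; rewrite setTI; apply: open_borel; exact: cf.
Qed.

Lemma mulg_cvg (f g : G -> G) : continuous f -> continuous g ->
  continuous (fun x => f x * g x)%g.
Proof.
move=> cf cg x.
apply: (@cvg_comp _ _ _ (fun x => (f x, g x)) (fun p : G * G => p.1 * p.2)%g
  _ (nbhs (f x, g x))); last exact: (mulg_continuous (f x, g x)).
by apply: cvg_pair; [exact: cf|exact: cg].
Qed.

Lemma id_continuous : continuous (fun x : G => x).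
Proof. by move=> x; exact: cvg_id. Qed.

Lemma cst_continuousG z : continuous (fun _ : G => z).
Proof. by move=> x; exact: cvg_cst. Qed.

Lemma lmul_continuous z : continuous (fun x : G => (z * x)%g).
Proof. by apply: mulg_cvg; [exact: cst_continuousG|exact: id_continuous]. Qed.

Lemma rmul_continuous z : continuous (fun x : G => (x * z)%g).
Proof. by apply: mulg_cvg; [exact: id_continuous|exact: cst_continuousG]. Qed.

Lemma lmul_measurable z :
  measurable_fun [set: borel G] (fun x : borel G => (z * x)%g : borel G).
Proof. by apply: continuous_borel_map; exact: lmul_continuous. Qed.

Lemma rmul_measurable z :
  measurable_fun [set: borel G] (fun x : borel G => (x * z)%g : borel G).
Proof. by apply: continuous_borel_map; exact: rmul_continuous. Qed.

(** * Integrals under measure-preserving maps *)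

Section Transfer.
Variable phi : borel G -> borel G.
Hypothesis mphi : measurable_fun [set: borel G] phi.
Hypothesis muphi : forall A : set (borel G), measurable A -> mu (phi @^-1` A) = mu A.

Lemma ge0_integral_transfer (f : borel G -> \bar R) :
  measurable_fun [set: borel G] f -> (forall x, 0 <= f x)%E ->
  (\int[mu]_x f (phi x) = \int[mu]_x f x)%E.
Proof.
move=> mf f0; transitivity (\int[pushforward mu phi]_x f x)%E.
  by rewrite [RHS](ge0_integral_pushforward mphi)// => x _; exact: f0.
by apply: eq_measure_integral => A mA _; exact: muphi.
Qed.

Lemma integrable_transfer f : mu.-integrable [set: borel G] (EFin \o f) ->
  mu.-integrable [set: borel G] (EFin \o (f \o phi)).
Proof.
move=> /integrableP[mf fi]; apply/integrableP; split.
  exact: (measurableT_comp mf mphi).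
rewrite (_ : (\int[mu]_x _)%E = \int[mu]_x `|(EFin \o f) (phi x)|)%E//.
by rewrite (@ge0_integral_transfer (fun x => `|(EFin \o f) x|)%E)//; exact: measurableT_comp.
Qed.

Lemma Rintegral_transfer f : measurable_fun [set: borel G] f ->
  \int[mu]_x f (phi x) = \int[mu]_x f x.
Proof.
move=> mf; rewrite /Rintegral; congr fine.
rewrite integralE [RHS]integralE; congr (_ - _)%E.
- transitivity (\int[mu]_x ((EFin \o f)^\+ (phi x)))%E; first by apply: eq_integral => x _; rewrite ?funeposE ?funenegE.
  apply: ge0_integral_transfer.
    by apply: measurable_funepos; exact/measurable_EFinP.
  by move=> x; exact: funepos_ge0.
- transitivity (\int[mu]_x ((EFin \o f)^\- (phi x)))%E; first by apply: eq_integral => x _; rewrite ?funeposE ?funenegE.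
  apply: ge0_integral_transfer.
    by apply: measurable_funeneg; exact/measurable_EFinP.
  by move=> x; exact: funeneg_ge0.
Qed.

Lemma sqint_transfer f : sqint mu f -> sqint mu (f \o phi).
Proof.
move=> [mf fi]; split; first exact: measurableT_comp.
exact: (integrable_transfer fi).
Qed.

Lemma l2_transfer f g : sqint mu f -> sqint mu g ->
  l2 mu (f \o phi) (g \o phi) = l2 mu f g.
Proof.
move=> [mf _] [mg _]; rewrite /l2 (@Rintegral_transfer (fun x => f x * g x))//.
exact: measurable_funM.
Qed.

End Transfer.

Hypothesis HG : locally_compact_group G.
Hypothesis Hmu : haar_measure mu.

Lemma haus : hausdorff_space G. Proof. by case: HG. Qed.

Lemma compact_borel K : compact K -> measurable (K : set (borel G)).
Proof. by move=> cK; apply: closed_borel; apply: compact_closed => //; exact: haus. Qed.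

Lemma compact_fin K : compact K -> (mu K < +oo)%E.
Proof. by case: Hmu => -[H _ _] _ _; exact: H. Qed.

Lemma lmul_inv z (A : set (borel G)) : measurable A ->
  mu ((fun x : borel G => (z * x)%g : borel G) @^-1` A) = mu A.
Proof.
move=> mA; case: Hmu => _ linv _; rewrite -(linv z^-1%g A mA); congr (mu _).
apply/seteqP; split=> x /=.
  by move=> Azx; exists (z * x)%g => //; rewrite mulgA mulVg mul1g.
by move=> [a Aa <-]; rewrite mulgA mulgV mul1g.
Qed.

Lemma Rintegral_lmul z f : measurable_fun [set: borel G] f ->
  \int[mu]_x f (z * x)%g = \int[mu]_x f x.
Proof. exact: (Rintegral_transfer (@lmul_measurable z) (@lmul_inv z)). Qed.

Lemma sqint_lmul z f : sqint mu f -> sqint mu (fun x => f (z * x)%g).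
Proof. exact: (sqint_transfer (@lmul_measurable z) (@lmul_inv z)). Qed.

Lemma l2_lmul z f g : sqint mu f -> sqint mu g ->
  l2 mu (fun x => f (z * x)%g) (fun x => g (z * x)%g) = l2 mu f g.
Proof. exact: (l2_transfer (@lmul_measurable z) (@lmul_inv z)). Qed.

(** Finitely many translates of [U] cover a given compact set, so a null [U] makes all compact sets
    null, and inner regularity of the open set [setT] makes the whole group null. *)
Lemma open_measure_gt0 (U : set G) x : open U -> U x -> (0 < mu U)%E.
Proof.
move=> oU Ux; rewrite lt0e measure_ge0 andbT; apply/eqP => U0.
case: Hmu => -[_ _ inner] linv; apply; rewrite (inner _ openT).
apply/eqP; rewrite eq_le; apply/andP; split; last first.
  by apply: ereal_sup_ubound; exists set0; [split=> //; exact: compact0|rewrite measure0].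
apply: ge_ereal_sup => _ [K [cK _] <-].
pose tr (z : G) := (fun y : G => (z * y)%g) @^-1` U.
have otr z : open (tr z) by move/continuousP : (@lmul_continuous z); apply.
have tr0 z : mu (tr z) = 0 by rewrite lmul_inv//; exact: open_borel.
have : cover_compact K by rewrite -compact_cover.
move=> /(_ _ setT tr (fun z _ => otr z)) [].
  by move=> y _; exists (x * y^-1)%g => //; rewrite /tr /= -mulgA mulVg mulg1.
move=> D _ KD.
have oB (s : seq G) : measurable (\bigcup_(z in [set` s]) tr z : set (borel G)).
  by apply: open_borel; exact: (@bigcup_open G _ [set` s] tr (fun z _ => otr z)).
suff H (s : seq G) : mu (\bigcup_(z in [set` s]) tr z) = 0.
  rewrite -(H D); apply: (le_measure mu _ _ KD).
  - by apply/mem_set; exact: compact_borel.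
  - by apply/mem_set; exact: oB.
elim: s => [|z s IH].
  by rewrite (_ : \bigcup_(z in _) _ = set0) ?measure0// -subset0 => y [z].
have -> : \bigcup_(y in [set` (z :: s)]) tr y = tr z `|` \bigcup_(y in [set` s]) tr y.
  apply/seteqP; split=> t.
    by move=> [y /=]; rewrite inE => /predU1P[-> ty|ys ty]; [left|right; exists y].
  by move=> [tz|[y /= ys ty]]; [exists z|exists y] => //=; rewrite inE ?eqxx ?ys ?orbT.
apply/eqP; rewrite -measure_le0.
apply: le_trans (measureU2 _ _ _) _; [exact: open_borel|exact: oB|].
have e1 : (mu (tr z) <= 0)%E by rewrite tr0.
have e2 : (mu (\bigcup_(y in [set` s]) tr y) <= 0)%E by rewrite IH.
exact: (adde_le0 e1 e2).
Qed.

End HaarIntegral.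

(** * Compactly supported continuous kernels and their iterated integrals *)

Section CompactSupport.
Context {R : realType} {G : topologicalGroupType}.
Variable mu : {measure set (borel G) -> \bar R}.
Hypothesis HG : locally_compact_group G.
Hypothesis Hmu : haar_measure mu.
Implicit Types (f g : G -> R) (x y z : G) (K : set G).

Definition csupp K f := [/\ compact K, continuous f & forall x, ~ K x -> f x = 0].

Lemma csupp_bounded K f : csupp K f -> exists2 C, 0 < C & forall x, `|f x| <= C.
Proof.
move=> [cK cf f0].
have : compact (f @` K) by apply: continuous_compact => //; exact: continuous_subspaceT.
move=> /compact_bounded[N [_ HN]].
exists (`|N| + 1); first by rewrite ltr_wpDl.
have lt : N < `|N| + 1 by apply: le_lt_trans (ler_norm _) _; rewrite ltrDl.
move=> x; have [Kx|nKx] := pselect (K x).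
  by apply: (HN _ lt); exists x.
by rewrite f0// normr0 addr_ge0.
Qed.

Lemma bounded_set_integral (B : set (borel G)) f c : measurable B ->
  (mu B < +oo)%E -> measurable_fun [set: borel G] f ->
  (forall x, B x -> `|f x| <= c) ->
  mu.-integrable B (EFin \o f) /\ `|\int[mu]_(x in B) f x| <= c * fine (mu B).
Proof.
move=> mB fB mf fc.
have iB : mu.-integrable B (EFin \o f).
  apply: measurable_bounded_integrable => //; first exact: measurable_funS mf.
  exists c; split; first exact: num_real.
  by move=> M cM x Bx; apply: le_trans (fc _ Bx) (ltW cM).
split=> //; apply: le_trans (le_normr_Rintegral mB iB) _.
rewrite -Rintegral_cst//; apply: le_Rintegral => //.
- by have /integrable_norm := iB.
- apply: measurable_bounded_integrable => //.
  by exists `|c|; split; [exact: num_real|move=> M cM x _; exact: ltW].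
Qed.

Lemma csupp_measurable K f : csupp K f -> measurable_fun [set: borel G] f.
Proof. by case=> _ cf _; exact: continuous_borel. Qed.

Lemma Rintegral_csupp K f : csupp K f -> \int[mu]_x f x = \int[mu]_(x in K) f x.
Proof.
move=> [_ _ f0]; rewrite [RHS]Rintegral_mkcond; apply: eq_Rintegral => x _.
by rewrite patchE; case: ifPn => // /negP xK; rewrite f0// => /mem_set.
Qed.

Lemma csupp_integrable K f : csupp K f -> mu.-integrable [set: borel G] (EFin \o f).
Proof.
move=> sf; have [cK cf f0] := sf; have [C _ HC] := csupp_bounded sf.
have mK := compact_borel HG cK.
have [iK _] := bounded_set_integral mK (compact_fin Hmu cK) (csupp_measurable sf) (fun x _ => HC x).
have : mu.-integrable [set: borel G] ((EFin \o f) \_ (K : set (borel G))).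
  by rewrite -integrable_mkcond.
apply: eq_integrable => // x _; rewrite patchE; case: ifPn => // /negP xK.
by rewrite /= f0// => /mem_set.
Qed.

Lemma csupp_mul K f g : csupp K f -> continuous g -> csupp K (fun x => f x * g x).
Proof.
move=> [cK cf f0] cg; split=> //; first by move=> x; apply: cvgM; [exact: cf|exact: cg].
by move=> x /f0 ->; rewrite mul0r.
Qed.

Lemma csupp_sqint K f : csupp K f -> sqint mu f.
Proof.
move=> sf; split; first exact: csupp_measurable sf.
have cf : continuous f by case: sf.
have := csupp_integrable (csupp_mul sf cf).
by under [in X in X -> _]eq_fun do rewrite -expr2.
Qed.

Definition kernel_csupp (K1 K2 : set G) (k : G -> G -> R) :=
  [/\ compact K1, compact K2, continuous (fun p : G * G => k p.1 p.2)
    & forall x y, ~ (K1 x /\ K2 y) -> k x y = 0].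

Lemma kernel_csuppC K1 K2 k : kernel_csupp K1 K2 k ->
  kernel_csupp K2 K1 (fun y x => k x y).
Proof.
move=> [c1 c2 ck k0]; split=> //; last by move=> y x n; apply: k0 => -[? ?]; apply: n.
move=> [y x]; apply: (@cvg_comp _ _ _ (fun p : G * G => (p.2, p.1))
  (fun p : G * G => k p.1 p.2) _ (nbhs (x, y))); last exact: (ck (x, y)).
by apply: cvg_pair; [exact: cvg_snd|exact: cvg_fst].
Qed.

Lemma kernel_csupp_r K1 K2 k x : kernel_csupp K1 K2 k -> csupp K2 (k x).
Proof.
move=> [c1 c2 ck k0]; split=> //; last by move=> y n; apply: k0 => -[].
move=> y; apply: (@cvg_comp _ _ _ (fun y : G => (x, y))
  (fun p : G * G => k p.1 p.2) _ (nbhs (x, y))); last exact: (ck (x, y)).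
by apply: cvg_pair; [exact: cvg_cst|exact: cvg_id].
Qed.

Lemma kernel_csupp_l K1 K2 k y : kernel_csupp K1 K2 k -> csupp K1 (fun x => k x y).
Proof. by move=> /kernel_csuppC/kernel_csupp_r. Qed.

(** Tube lemma over the compact [K1]; outside [K1] the kernel vanishes. *)
Lemma kernel_unif K1 K2 k y0 e : kernel_csupp K1 K2 k -> 0 < e ->
  \forall y \near y0, forall x, `|k x y - k x y0| <= e.
Proof.
move=> [c1 c2 ck k0] e0.
have e2 : 0 < e / 2 by rewrite divr_gt0.
have H x : K1 x -> \forall x' \near x & y \near y0, `|k x' y - k x' y0| <= e.
  move=> K1x; have /cvgrPdist_le/(_ _ e2) ckx := ck (x, y0).
  have [[U V] /= [Ux Vy] UV] := ckx.
  exists (U, V) => //= -[x' y'] /= [Ux' Vy'].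
  have h1 : `|k x y0 - k x' y'| <= e / 2 := UV (x', y') (conj Ux' Vy').
  have h2 : `|k x y0 - k x' y0| <= e / 2 := UV (x', y0) (conj Ux' (nbhs_singleton Vy)).
  have -> : k x' y' - k x' y0 = (k x y0 - k x' y0) - (k x y0 - k x' y') by ring.
  by apply: le_trans (ler_normB _ _) _; rewrite [leRHS]splitr lerD.
have : \forall y \near y0, K1 `<=` (fun x => `|k x y - k x y0| <= e).
  exact: ((compact_near_coveringP K1).1 c1 G (nbhs y0) (fun y x => `|k x y - k x y0| <= e) _ H).
apply: filterS => y Hy x; have [Kx|nK] := pselect (K1 x); first exact: Hy.
by rewrite !k0 ?subrr ?normr0 ?(ltW e0)//; move=> [].
Qed.

Lemma subset_compact_fin (B : set (borel G)) K : compact K -> measurable B ->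
  B `<=` K -> (mu B < +oo)%E.
Proof.
move=> cK mB BK; apply: le_lt_trans (compact_fin Hmu cK).
by apply: (le_measure mu _ _ BK); apply/mem_set => //; exact: (compact_borel HG cK).
Qed.

(** A measurable piece [B] is allowed because Fubini is proved by cutting [K1] into pieces.
    Continuity is the uniform estimate of [kernel_unif] integrated over a set of finite measure. *)
Lemma kernel_integral_csupp K1 K2 k (B : set (borel G)) : kernel_csupp K1 K2 k ->
  measurable B -> B `<=` K1 -> csupp K2 (fun y => \int[mu]_(x in B) k x y).
Proof.
move=> sk mB BK; have [c1 c2 ck k0] := sk; split=> //; last first.
  move=> y nK; rewrite (@eq_Rintegral _ _ _ _ B (fun=> 0)); last first.
    by move=> x _; rewrite k0// => -[].
  by rewrite Rintegral_cst// mul0r.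
have fB := subset_compact_fin c1 mB BK.
have iB y : mu.-integrable B (EFin \o (fun x => k x y)).
  by apply: integrableS (csupp_integrable (kernel_csupp_l y sk)).
move=> y0; apply/cvgrPdist_le => e e0.
have c0 : 0 < fine (mu B) + 1 by rewrite ltr_wpDl// fine_ge0.
have := kernel_unif y0 sk (divr_gt0 e0 c0); apply: filterS => y Hy.
rewrite -RintegralB//.
have mk : measurable_fun [set: borel G] (fun x => k x y0 - k x y).
  by apply: measurable_funB; exact: csupp_measurable (kernel_csupp_l _ sk).
have bk x : B x -> `|k x y0 - k x y| <= e / (fine (mu B) + 1).
  by move=> _; rewrite distrC; exact: Hy.
have [_ /le_trans] := bounded_set_integral mB fB mk bk; apply.
by rewrite mulrAC ler_pdivrMr// ler_pM2l// lerDl.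
Qed.

Lemma kernel_integral_csupp_full K1 K2 k : kernel_csupp K1 K2 k ->
  csupp K2 (fun y => \int[mu]_x k x y).
Proof.
move=> sk; have [c1 _ _ _] := sk.
have := kernel_integral_csupp sk (compact_borel HG c1) (fun x Kx => Kx).
congr csupp; apply/funext => y.
by rewrite -Rintegral_csupp//; exact: kernel_csupp_l sk.
Qed.

(** Both iterated integrals are compared with the integral of [k x0] times the measure of [B]. The
    bound is proportional to that measure, so it adds up over a partition whatever the number of
    pieces. *)
Lemma kernel_fubini_small K1 K2 k e x0 (B : set (borel G)) :
  kernel_csupp K1 K2 k -> 0 < e -> measurable B -> B `<=` K1 ->
  (forall x, B x -> forall y, `|k x y - k x0 y| <= e) ->
  `|\int[mu]_(x in B) (\int[mu]_y k x y) - \int[mu]_y (\int[mu]_(x in B) k x y)|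
    <= 2 * e * fine (mu K2) * fine (mu B).
Proof.
move=> sk e0 mB BK HB; have [c1 c2 ck k0] := sk.
have fB := subset_compact_fin c1 mB BK; have f2 := compact_fin Hmu c2.
have m2 := compact_borel HG c2.
pose g x := \int[mu]_y k x y.
have sg : csupp K1 g by exact: kernel_integral_csupp_full (kernel_csuppC sk).
have mB0 : 0 <= fine (mu B) by rewrite fine_ge0.
have mK0 : 0 <= fine (mu K2) by rewrite fine_ge0.
have gg x : B x -> `|g x - g x0| <= e * fine (mu K2).
  move=> Bx; rewrite /g -RintegralB//; last 2 first.
  - exact: csupp_integrable (kernel_csupp_r _ sk).
  - exact: csupp_integrable (kernel_csupp_r _ sk).
  have sd : csupp K2 (fun y => k x y - k x0 y).
    have [_ cx nx] := kernel_csupp_r x sk; have [_ cx0 nx0] := kernel_csupp_r x0 sk.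
    split=> // y; first by apply: cvgB; [exact: cx|exact: cx0].
    by move=> nK; rewrite nx// nx0// subr0.
  rewrite (Rintegral_csupp sd).
  by have [] := bounded_set_integral m2 f2 (csupp_measurable sd) (fun y _ => HB x Bx y).
have iBg : mu.-integrable B (EFin \o g) by apply: integrableS (csupp_integrable sg).
have iBc (c : R) : mu.-integrable B (EFin \o (fun=> c)).
  have mc : measurable_fun [set: borel G] (fun _ : G => c) by exact: measurable_cst.
  by have [] := bounded_set_integral mB fB mc (fun x _ => lexx `|c|).
have h1 : `|\int[mu]_(x in B) g x - g x0 * fine (mu B)| <= e * fine (mu K2) * fine (mu B).
  rewrite -Rintegral_cst// -RintegralB//.
  have mg : measurable_fun [set: borel G] (fun x => g x - g x0).
    by apply: measurable_funB => //; exact: csupp_measurable sg.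
  by have [] := bounded_set_integral mB fB mg gg.
have sh := kernel_integral_csupp sk mB BK.
have h2 : `|g x0 * fine (mu B) - \int[mu]_y (\int[mu]_(x in B) k x y)| <=
    e * fine (mu B) * fine (mu K2).
  rewrite /g -RintegralZr//; last exact: csupp_integrable (kernel_csupp_r _ sk).
  have [_ cx0 nx0] := kernel_csupp_r x0 sk.
  have sx : csupp K2 (fun y => k x0 y * fine (mu B)).
    split=> // [y|y nK]; last by rewrite nx0// mul0r.
    by apply: cvgM; [exact: cx0|exact: cvg_cst].
  rewrite -RintegralB//; last 2 first.
  - exact: csupp_integrable sx.
  - exact: csupp_integrable sh.
  have sd : csupp K2 (fun y => k x0 y * fine (mu B) - \int[mu]_(x in B) k x y).
    have [_ ch nh] := sh; have [_ cs ns] := sx.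
    split=> // y; first by apply: cvgB; [exact: cs|exact: ch].
    by move=> nK; rewrite ns// nh// subr0.
  rewrite (Rintegral_csupp sd).
  suff bk y : K2 y -> `|k x0 y * fine (mu B) - \int[mu]_(x in B) k x y| <= e * fine (mu B).
    by have [] := bounded_set_integral m2 f2 (csupp_measurable sd) bk.
  move=> _; rewrite -(Rintegral_cst mu mB) -RintegralB//; last first.
    by apply: integrableS (csupp_integrable (kernel_csupp_l y sk)).
  have mk : measurable_fun [set: borel G] (fun x => k x0 y - k x y).
    by apply: measurable_funB => //; exact: csupp_measurable (kernel_csupp_l y sk).
  have bk x : B x -> `|k x0 y - k x y| <= e by move=> Bx; rewrite distrC; exact: HB.
  by have [] := bounded_set_integral mB fB mk bk.
rewrite -/g in h1 *.
have -> : \int[mu]_(x in B) \int[mu]_y k x y = \int[mu]_(x in B) g x by [].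
rewrite -(subrKA (g x0 * fine (mu B))); apply: le_trans (ler_normD _ _) _.
apply: le_trans (lerD h1 h2) _; lra.
Qed.

(* The general Fubini theorem does not apply: [mu] need not be sigma-finite, and
   a continuous function on [G * G] need not be measurable for the product of
   the Borel sigma-algebras. *)
Lemma kernel_fubini K1 K2 k : kernel_csupp K1 K2 k ->
  \int[mu]_x (\int[mu]_y k x y) = \int[mu]_y (\int[mu]_x k x y).
Proof.
move=> sk; have [c1 c2 ck k0] := sk.
have m1 := compact_borel HG c1.
have sg : csupp K1 (fun x => \int[mu]_y k x y).
  exact: kernel_integral_csupp_full (kernel_csuppC sk).
pose err (B : set (borel G)) :=
  \int[mu]_(x in B) (\int[mu]_y k x y) - \int[mu]_y (\int[mu]_(x in B) k x y).
have errU (A B : set (borel G)) : measurable A -> measurable B -> A `<=` K1 ->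
    B `<=` K1 -> [disjoint A & B] -> err (A `|` B) = err A + err B.
  move=> mA mB AK BK dAB; rewrite /err Rintegral_setU//; last first.
    apply: integrableS (csupp_integrable sg) => //; exact: measurableU.
  rewrite (_ : (fun y => \int[mu]_(x in A `|` B) k x y) =
    (fun y => \int[mu]_(x in A) k x y + \int[mu]_(x in B) k x y)); last first.
    apply/funext => y; rewrite Rintegral_setU//.
    by apply: integrableS (csupp_integrable (kernel_csupp_l y sk)) => //; exact: measurableU.
  rewrite RintegralD//; first ring.
  - exact: csupp_integrable (kernel_integral_csupp sk mA AK).
  - exact: csupp_integrable (kernel_integral_csupp sk mB BK).
have main e : 0 < e -> `|err K1| <= 2 * e * fine (mu K2) * fine (mu K1).
  move=> e0.
  have /choice[U HU] x0 : exists U : set G, [/\ open U, U x0 &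
      forall x, U x -> forall y, `|k x y - k x0 y| <= e].
    have := kernel_unif x0 (kernel_csuppC sk) e0.
    by rewrite -nbhs_nearE nbhsE => -[U [oU Ux] HU]; exists U.
  have : cover_compact K1 by rewrite -compact_cover.
  move=> /(_ _ setT U) [|y _|D _ KD].
  - by move=> z _; have [] := HU z.
  - by exists y => //; have [] := HU y.
  (* Generalized to every measurable part of [K1] covered by the listed neighbourhoods, so that the
     part inside the first one can be split off. *)
  suff H (s : seq G) : forall B : set (borel G), measurable B -> B `<=` K1 ->
      (forall x, B x -> exists2 z, z \in s & U z x) ->
      `|err B| <= 2 * e * fine (mu K2) * fine (mu B).
    by apply: (H D) => // x /KD[z zD Ux]; exists z.
  elim: s => [|z s IH] B mB BK BU.
    have -> : B = set0 by rewrite -subset0 => x /BU[].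
    rewrite /err Rintegral_set0.
    rewrite (_ : (fun y => \int[mu]_(x in set0) k x y) = (fun=> 0)); last first.
      by apply/funext => y; rewrite Rintegral_set0.
    by rewrite Rintegral_cst// mul0r subr0 normr0 measure0 mulr0.
  have oz : measurable (U z : set (borel G)) by apply: open_borel; have [] := HU z.
  have mBU : measurable (B `&` U z) by exact: measurableI.
  have mBD : measurable (B `\` U z) by exact: measurableD.
  have dBB : [disjoint B `&` U z & B `\` U z].
    by apply/disj_setPS => x [[_ Ux] [_ nUx]].
  have EB : B = (B `&` U z) `|` (B `\` U z) by rewrite setUIDK.
  have -> : fine (mu B) = fine (mu (B `&` U z)) + fine (mu (B `\` U z)).
    rewrite {1}EB measureU//; last by apply/disj_set2P.
    by rewrite fineD// ge0_fin_numE//; apply: (subset_compact_fin c1) => // x [Bx _]; exact: BK.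
  rewrite {1}EB errU//; last 2 first.
  - by move=> x [/BK].
  - by move=> x [/BK].
  rewrite mulrDr; apply: le_trans (ler_normD _ _) _; apply: lerD.
    apply: (@kernel_fubini_small K1 K2 k e z) => // [x [/BK]//|x [_ Ux] y].
    by have [_ _] := HU z; apply.
  apply: IH => // [x [/BK]//|x [Bx nUx]].
  by have [t] := BU _ Bx; rewrite inE => /predU1P[->//|ts Ut]; exists t.
have e1 : err K1 = 0.
  apply/eqP; rewrite -normr_eq0 eq_le normr_ge0 andbT leNgt; apply/negP => h.
  pose c := 2 * fine (mu K2) * fine (mu K1).
  have c0 : 0 <= c by rewrite /c !mulr_ge0// fine_ge0.
  have c1' : 0 < c + 1 by rewrite ltr_wpDl.
  (* For this [e] the bound is a multiple of the error itself by a factor less than 1; [c + 1]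
     covers the case [c = 0]. *)
  have := main _ (divr_gt0 h c1').
  have -> : 2 * (`|err K1| / (c + 1)) * fine (mu K2) * fine (mu K1) =
     `|err K1| * (c / (c + 1)) by rewrite /c; ring.
  by rewrite leNgt gtr_pMr// ltr_pdivrMr// mul1r ltrDl ltr01.
move: e1 => /eqP; rewrite /err subr_eq0 => /eqP.
rewrite -(Rintegral_csupp sg) => ->; apply: eq_Rintegral => y _.
by rewrite -(Rintegral_csupp (kernel_csupp_l y sk)).
Qed.

End CompactSupport.

(** * Invariance of a unimodular Haar measure under inversion *)

Section Inversion.
Context {R : realType} {G : topologicalGroupType}.
Variable mu : {measure set (borel G) -> \bar R}.
Hypothesis HG : locally_compact_group G.
Hypothesis Hmu : haar_measure mu.
Implicit Types (f g : G -> R) (x y z : G) (K : set G).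

(** Otherwise the nonempty open set where [f] does not vanish would be contained in a null set,
    against [open_measure_gt0]. *)
Lemma l2_continuous_eq0 f : continuous f -> sqint mu f -> l2 mu f f = 0 ->
  forall x, f x = 0.
Proof.
move=> cf sf f0 x; apply/eqP/negP => /negP fx.
have mf2 : measurable_fun [set: borel G] (fun x => (f x ^+ 2)%:E).
  apply/measurable_EFinP; apply: measurable_funX; exact: sqint_measurable sf.
have : (\int[mu]_x `|(f x ^+ 2)%:E| = 0)%E.
  rewrite (eq_integral (fun x : borel G => (f x ^+ 2)%:E)); first by rewrite -l2E// f0.
  by move=> y _; rewrite gee0_abs// lee_fin sqr_ge0.
move=> /(ae_eq_integral_abs mu measurableT mf2)[N [mN N0 fN]].
pose U := f @^-1` [set r | r != 0].
have oU : open U.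
  by move/continuousP : cf; apply; exact: open_neq.
have UN : U `<=` N.
  move=> y Uy; apply: fN => /= /(_ I) [] /eqP.
  by rewrite sqrf_eq0; apply/negP.
have := open_measure_gt0 HG Hmu oU (fx : U x).
rewrite ltNge -N0 => /negP; apply.
by apply: (le_measure mu _ _ UN); apply/mem_set => //; exact: open_borel.
Qed.

Hypothesis Uni : unimodular mu.

Lemma rmul_inv z (A : set (borel G)) : measurable A ->
  mu ((fun x : borel G => (x * z)%g : borel G) @^-1` A) = mu A.
Proof.
move=> mA; rewrite -(Uni z^-1%g mA); congr (mu _).
apply/seteqP; split=> x /=.
  by move=> Azx; exists (x * z)%g => //; rewrite -mulgA mulgV mulg1.
by move=> [a Aa <-]; rewrite -mulgA mulVg mulg1.
Qed.

Lemma Rintegral_rmul z f : measurable_fun [set: borel G] f ->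
  \int[mu]_x f (x * z)%g = \int[mu]_x f x.
Proof. exact: (Rintegral_transfer (@rmul_measurable _ z) (@rmul_inv z)). Qed.

Lemma continuous_compG (f : G -> R) (phi : G * G -> G) :
  continuous f -> continuous phi -> continuous (fun p => f (phi p)).
Proof.
move=> cf cphi p; apply: (@cvg_comp _ _ _ phi f _ (nbhs (phi p))); last exact: cf.
exact: cphi.
Qed.

Lemma mulg_cvg2 (f g : G * G -> G) : continuous f -> continuous g ->
  continuous (fun p => f p * g p)%g.
Proof.
move=> cf cg x.
apply: (@cvg_comp _ _ _ (fun p => (f p, g p)) (fun p : G * G => p.1 * p.2)%g
  _ (nbhs (f x, g x))); last exact: (mulg_continuous (f x, g x)).
by apply: cvg_pair; [exact: cf|exact: cg].
Qed.

Lemma invg_cvg2 (f : G * G -> G) : continuous f -> continuous (fun p => (f p)^-1)%g.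
Proof.
move=> cf x; apply: (@cvg_comp _ _ _ f (fun x => x^-1)%g _ (nbhs (f x))).
  exact: cf.
exact: (invg_continuous (f x)).
Qed.

Lemma compact_mulg K : compact K -> compact [set (x * y)%g | x in K & y in K].
Proof.
move=> cK.
have -> : [set (x * y)%g | x in K & y in K] = (fun p : G * G => (p.1 * p.2)%g) @` (K `*` K).
  apply/seteqP; split=> z.
    by move=> [x Kx [y Ky <-]]; exists (x, y).
  by move=> [[x y] [/= Kx Ky] <-]; exists x => //; exists y.
apply: continuous_compact; last exact: compact_setX.
by apply: continuous_subspaceT; exact: mulg_continuous.
Qed.

Lemma compact_invg K : compact K -> compact [set (x^-1)%g | x in K].
Proof.
move=> cK; apply: continuous_compact => //.
by apply: continuous_subspaceT; exact: invg_continuous.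
Qed.

(* Evaluate the double integral of [f (x^-1) * h (x * y)] in both orders, with
   [h = f ^ 2]; the integral of [h] only vanishes for [f = 0]. *)
Lemma Rintegral_inv K f : csupp K f -> \int[mu]_x f x^-1%g = \int[mu]_x f x.
Proof.
move=> sf; have [cK cf f0] := sf.
have sh : csupp K (fun x => f x * f x) by exact: csupp_mul.
have [_ ch h0] := sh.
pose h x := f x * f x.
have cfst : continuous (fun p : G * G => p.1) by move=> p; exact: cvg_fst.
have csnd : continuous (fun p : G * G => p.2) by move=> p; exact: cvg_snd.
have [hI|hI] := eqVneq (\int[mu]_x h x) 0.
  have H := l2_continuous_eq0 cf (csupp_sqint HG Hmu sf) hI.
  by apply: eq_Rintegral => x _; rewrite !H.
pose KK := [set (x * y)%g | x in K & y in K].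
have k1 : kernel_csupp [set x^-1%g | x in K] KK (fun x y => f x^-1%g * h (x * y)%g).
  split; [exact: compact_invg|exact: compact_mulg| |].
    move=> p; apply: cvgM.
      exact: (continuous_compG cf (invg_cvg2 cfst)).
    exact: (continuous_compG ch (mulg_cvg2 cfst csnd)).
  move=> x y n; have [Kx|nKx] := pselect (K x^-1%g); last by rewrite f0// mul0r.
  have [Kxy|nKxy] := pselect (K (x * y)%g); last by rewrite /h h0// mulr0.
  exfalso; apply: n; split; first by exists x^-1%g => //; rewrite invgK.
  by exists x^-1%g => //; exists (x * y)%g => //; rewrite mulgA mulVg mul1g.
have k2 : kernel_csupp K KK (fun x y => f (y * x^-1)%g * h x).
  split; [exact: cK|exact: compact_mulg| |].
    move=> p; apply: cvgM.
      exact: (continuous_compG cf (mulg_cvg2 csnd (invg_cvg2 cfst))).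
    exact: (continuous_compG ch cfst).
  move=> x y n; have [Kx|nKx] := pselect (K x); last by rewrite /h h0// mulr0.
  have [Kxy|nKxy] := pselect (K (y * x^-1)%g); last by rewrite f0// mul0r.
  exfalso; apply: n; split=> //.
  by exists (y * x^-1)%g => //; exists x => //; rewrite -mulgA mulVg mulg1.
have mh : measurable_fun [set: borel G] h by exact: csupp_measurable sh.
have e1 : \int[mu]_x (\int[mu]_y (f x^-1%g * h (x * y)%g)) =
    \int[mu]_x f x^-1%g * \int[mu]_x h x.
  have sinv : csupp [set x^-1%g | x in K] (fun x => f x^-1%g).
    split; first exact: compact_invg.
      move=> x; apply: (@cvg_comp _ _ _ (fun x => x^-1)%g f _ (nbhs x^-1%g)).
        exact: invg_continuous.
      exact: cf.
    by move=> x n; apply: f0 => Kx; apply: n; exists x^-1%g => //; rewrite invgK.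
  rewrite -RintegralZr//; last exact: csupp_integrable sinv.
  apply: eq_Rintegral => x _.
  rewrite RintegralZl//; last first.
    apply: (integrable_transfer (@lmul_measurable _ x) (lmul_inv Hmu x)).
    exact: csupp_integrable sh.
  by rewrite (Rintegral_lmul Hmu x mh).
(* Right translation by [y] in the inner integral; for a group that is not unimodular, a modular
   factor would appear here. *)
have e2 : \int[mu]_y (\int[mu]_x (f x^-1%g * h (x * y)%g)) =
    \int[mu]_y (\int[mu]_x (f (y * x^-1)%g * h x)).
  apply: eq_Rintegral => y _.
  have mk : measurable_fun [set: borel G] (fun x => f (y * x^-1)%g * h x).
    exact: csupp_measurable (kernel_csupp_l y k2).
  rewrite -(Rintegral_rmul y mk); apply: eq_Rintegral => x _.
  by rewrite invgM mulgA mulgV mul1g.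
have e3 : \int[mu]_x (\int[mu]_y (f (y * x^-1)%g * h x)) =
    \int[mu]_x f x * \int[mu]_x h x.
  rewrite -RintegralZl//; last exact: csupp_integrable sh.
  apply: eq_Rintegral => x _.
  rewrite RintegralZr//; last first.
    apply: (integrable_transfer (@rmul_measurable _ x^-1%g) (rmul_inv x^-1%g)).
    exact: csupp_integrable sf.
  by rewrite (Rintegral_rmul x^-1%g (csupp_measurable sf)).
have := kernel_fubini HG Hmu k1; rewrite e1 e2 -(kernel_fubini HG Hmu k2) e3.
by move=> /(mulIf hI).
Qed.

End Inversion.

(** * Vectors of square integrable functions *)

Section SquareIntegrableVectors.
Context {d} {T : measurableType d} {R : realType} (mu : {measure set T -> \bar R}).
Variable I : finType.

Record l2vec := L2Vec {
  l2val :> T -> I -> R ;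
  l2valP : forall i, sqint mu (fun x => l2val x i) }.

Definition l2space : wmod R :=
  WMod (fun f g : l2vec => L2Vec (fun i => sqintD (l2valP f i) (l2valP g i)))
       (fun a (f : l2vec) => L2Vec (fun i => sqintZ a (l2valP f i))).

Definition l2form (f g : l2space) : R :=
  \sum_i l2 mu (fun x => l2val f x i) (fun x => l2val g x i).

Lemma psd_l2form : psd l2form.
Proof.
split=> [f g|f g h|a f g|f].
- by apply: eq_bigr => i _; rewrite l2C.
- rewrite -big_split; apply: eq_bigr => i _ /=.
  by rewrite l2Dl//; exact: l2valP.
- rewrite mulr_sumr; apply: eq_bigr => i _ /=.
  by rewrite l2Zl//; exact: l2valP.
- by apply: sumr_ge0 => i _; exact: l2_ge0.
Qed.

Lemma l2form_sub (f g : l2space) : l2form (wsub f g) (wsub f g) =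
  \sum_i l2 mu (fun x => l2val f x i - l2val g x i) (fun x => l2val f x i - l2val g x i).
Proof.
by apply: eq_bigr => i _; congr l2; apply/funext => x /=; rewrite mulN1r.
Qed.

Lemma l2form_comp_le (f g : l2space) i :
  l2 mu (fun x => l2val f x i - l2val g x i) (fun x => l2val f x i - l2val g x i)
    <= l2form (wsub f g) (wsub f g).
Proof.
rewrite l2form_sub (bigD1 i)//=.
by rewrite lerDl sumr_ge0// => j _; exact: l2_ge0.
Qed.

End SquareIntegrableVectors.

(** * Factorization of a real matrix-valued kernel *)

Section PosdefKernel.
Context {R : realType} {G : topologicalGroupType}.
Variable mu : {measure set (borel G) -> \bar R}.
Hypothesis HG : locally_compact_group G.
Hypothesis Hmu : haar_measure mu.
Variable I : finType.
Variable K : G -> I -> I -> R.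
Hypothesis Kc : forall i j, continuous (fun x => K x i j).
Hypothesis Ks : forall i j, sqint mu (fun x => K x i j).
Hypothesis Ksym : forall x i j, K x^-1%g i j = K x j i.
Hypothesis Kpd : forall s : seq (R * (G * I)),
  0 <= \sum_(a <- s) \sum_(b <- s)
    a.1 * b.1 * K (a.2.1^-1 * b.2.1)%g a.2.2 b.2.2.

(* [(r, (y, i))] stands for [r] times the [i]-th row of [x |-> K (y^-1 * x)];
   [hat] is the corresponding function. *)
Definition combo : wmod R :=
  @WMod R (seq (R * (G * I))) cat (fun r => map (fun a => (r * a.1, a.2))).

Definition kh (s t : combo) : R := \sum_(a <- s) \sum_(b <- t)
  a.1 * b.1 * K (a.2.1^-1 * b.2.1)%g a.2.2 b.2.2.

Lemma psd_kh : psd kh.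
Proof.
split=> [s t|s t u|r s t|s]; rewrite /kh.
- rewrite exchange_big; apply: eq_bigr => a _; apply: eq_bigr => b _.
  by rewrite (mulrC b.1) -Ksym invgM invgK.
- by rewrite big_cat.
- rewrite big_map mulr_sumr; apply: eq_bigr => a _ /=; rewrite mulr_sumr.
  by apply: eq_bigr => b _; rewrite !mulrA.
- exact: Kpd.
Qed.

Definition hat (s : combo) (y : G) (j : I) : R :=
  \sum_(a <- (s : seq (R * (G * I)))) a.1 * K (a.2.1^-1 * y)%g a.2.2 j.

Definition del (y : G) (j : I) : combo := [:: (1, (y, j))].

(** The reproducing property, which becomes the definition of [hatG] on the completion. *)
Lemma kh_del s y j : kh s (del y j) = hat s y j.
Proof.
by apply: eq_bigr => a _; rewrite big_seq1 mulr1.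
Qed.

Lemma hat_continuous s j : continuous (fun y => hat s y j).
Proof.
rewrite /hat; elim: (s : seq (R * (G * I))) => [|a t IH].
  by under eq_fun do rewrite big_nil; move=> y; exact: cvg_cst.
under eq_fun do rewrite big_cons.
move=> y; apply: cvgD; last exact: IH.
apply: cvgM; first exact: cvg_cst.
apply: (@cvg_comp _ _ _ (fun y => a.2.1^-1 * y)%g (fun x => K x a.2.2 j) _
   (nbhs (a.2.1^-1 * y)%g)); last exact: Kc.
exact: lmul_continuous.
Qed.

Lemma hat_sqint s j : sqint mu (fun y => hat s y j).
Proof.
rewrite /hat; elim: (s : seq (R * (G * I))) => [|a t IH].
  by under eq_fun do rewrite big_nil; exact: sqint0.
under eq_fun do rewrite big_cons.
apply: sqintD => //; apply: sqintZ.
exact: (sqint_lmul Hmu a.2.1^-1%g (Ks a.2.2 j)).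
Qed.

Definition hatv (s : combo) : l2space mu I := L2Vec (hat_sqint s).

Definition kl (s t : combo) : R := l2form (hatv s) (hatv t).

Lemma l2vec_ext (f g : l2space mu I) : (forall x i, l2val f x i = l2val g x i) ->
  forall h, l2form f h = l2form g h.
Proof.
by move=> fg h; apply: eq_bigr => i _; congr l2; apply/funext => x; exact: fg.
Qed.

Lemma psd_kl : psd kl.
Proof.
have pl := psd_l2form mu I.
split=> [s t|s t u|r s t|s].
- exact: (psdC pl).
- rewrite /kl -(psdDl pl); apply: l2vec_ext => x i.
  by rewrite /= /hat big_cat.
- rewrite /kl -(psdZl pl); apply: l2vec_ext => x i.
  by rewrite /= /hat big_map mulr_sumr; apply: eq_bigr => a _; rewrite mulrA.
- exact: (psd_ge0 pl (hatv s)).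
Qed.

Definition kq (s t : combo) : R := kh s t + kl s t.

Lemma psd_kq : psd kq.
Proof.
have ph := psd_kh; have pl := psd_kl; rewrite /kq; split=> [s t|s t u|r s t|s].
- by rewrite (psdC ph) (psdC pl).
- by rewrite (psdDl ph) (psdDl pl) addrACA.
- by rewrite (psdZl ph) (psdZl pl) mulrDr.
- by rewrite addr_ge0// psd_ge0.
Qed.

Lemma kh_le s : kh s s <= kq s s.
Proof. by rewrite /kq lerDl psd_ge0//; exact: psd_kl. Qed.

Lemma kl_le s : kl s s <= kq s s.
Proof. by rewrite /kq lerDr psd_ge0//; exact: psd_kh. Qed.

Lemma kq_le s : kq s s <= kq s s. Proof. by []. Qed.

(** * The completed space as a space of continuous functions *)

Definition hilb : wmod R := completion psd_kq.
Definition H : hilb -> hilb -> R := ext kh.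
Definition L : hilb -> hilb -> R := ext kl.
Definition Q : hilb -> hilb -> R := ext kq.
Definition dlt y j : hilb := emb psd_kq (del y j).

Lemma pH : psd H. Proof. exact: psd_ext psd_kh kh_le. Qed.
Lemma pL : psd L. Proof. exact: psd_ext psd_kl kl_le. Qed.
Lemma pQ : psd Q. Proof. exact: psd_ext psd_kq kq_le. Qed.

Lemma QHL x y : Q x y = H x y + L x y.
Proof.
apply: (cvg_lim (@Rhausdorff R)).
exact: (cvgD (ext_cvg psd_kq psd_kh kh_le x y) (ext_cvg psd_kq psd_kl kl_le x y)).
Qed.

Lemma cQ : complete_form Q. Proof. exact: completion_complete. Qed.

Definition hatG (f : hilb) (y : G) (j : I) : R := H f (dlt y j).

Lemma hatG_emb s y j : hatG (emb psd_kq s) y j = hat s y j.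
Proof. by rewrite /hatG /H ext_emb kh_del. Qed.

Lemma H_dlt y j : H (dlt y j) (dlt y j) = K 1%g j j.
Proof.
by rewrite -[LHS]/(hatG (emb psd_kq (del y j)) y j) hatG_emb /hat big_seq1 /= mul1r mulVg.
Qed.

Lemma nrm_H_le x : nrm H x <= nrm Q x.
Proof. by rewrite /nrm ler_sqrt ?psd_ge0//; [rewrite QHL lerDl psd_ge0//; exact: pL|exact: pQ]. Qed.

Lemma nrm_L_le x : nrm L x <= nrm Q x.
Proof. by rewrite /nrm ler_sqrt ?psd_ge0//; [rewrite QHL lerDr psd_ge0//; exact: pH|exact: pQ]. Qed.

(** The evaluation vector [dlt y j] has [H] norm [Num.sqrt (K 1%g j j)], independent of [y]; hence
    convergence in the completion is uniform in [y] and the limit functions are continuous. *)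
Lemma hatG_unif f : forall e, 0 < e -> exists N, forall m, (N <= m)%N ->
  forall y j, `|hatG f y j - hat (cs f m) y j| <= e.
Proof.
move=> e e0.
pose c := \sum_j Num.sqrt (K 1%g j j) + 1.
have cj j : Num.sqrt (K 1%g j j) <= c.
  rewrite /c (bigD1 j)//= -addrA lerDl addr_ge0//.
  by apply: sumr_ge0 => i _; exact: sqrtr_ge0.
have c0 : 0 < c by rewrite ltr_wpDl// sumr_ge0// => i _; exact: sqrtr_ge0.
have [N HN] := emb_dense f (divr_gt0 e0 c0).
exists N => m /HN Nm y j; rewrite -hatG_emb -(psdBl pH).
apply: le_trans (psd_CSn pH _ _) _.
rewrite (nrmBC pH) {2}/nrm H_dlt.
apply: le_trans (ler_pM (nrm_ge0 _) (sqrtr_ge0 _) (le_trans (nrm_H_le _) Nm) (cj j)) _.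
by rewrite divfK// gt_eqF.
Qed.

Lemma hatG_cvg f y j : (fun m => hat (cs f m) y j) @ \oo --> hatG f y j.
Proof.
apply/cvgrPdist_le => e e0; have [N HN] := hatG_unif f e0.
by exists N => // m /= Nm; exact: HN.
Qed.

Lemma uniform_limit_continuous (u : nat -> G -> R) (g : G -> R) :
  (forall k, continuous (u k)) ->
  (forall e, 0 < e -> exists m, forall y, `|g y - u m y| <= e) -> continuous g.
Proof.
move=> cu ug y; apply/cvgrPdist_le => e e0.
have e3 : 0 < e / 3 by rewrite divr_gt0.
have [m Hm] := ug _ e3.
have /cvgrPdist_le/(_ _ e3) := cu m y; apply: filterS => t Ht.
have := Hm y; have := Hm t; have -> : g y - g t = (g y - u m y) + (u m y - u m t) - (g t - u m t) by ring.
move=> h1 h2; apply: le_trans (ler_normB _ _) _.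
have := ler_normD (g y - u m y) (u m y - u m t); lra.
Qed.

Lemma hatG_continuous f j : continuous (fun y => hatG f y j).
Proof.
apply: (@uniform_limit_continuous (fun m y => hat (cs f m) y j)).
  by move=> k; exact: hat_continuous.
move=> e e0; have [N HN] := hatG_unif f e0.
by exists N => y; exact: HN.
Qed.

Lemma kl_comp_le s t j : l2 mu (fun y => hat s y j - hat t y j)
    (fun y => hat s y j - hat t y j) <= kl (wsub s t) (wsub s t).
Proof.
apply: le_trans (l2form_comp_le (hatv s) (hatv t) j) _.
by rewrite /kl -!(nrm_sq (psd_l2form mu I)) (@nrm_congr _ _ _ (psd_l2form mu I) (wsub (hatv s) (hatv t)) (hatv (wsub s t)))//; 
   apply: l2vec_ext => x i; rewrite /= /hat big_cat big_map mulr_sumr; congr (_ + _); apply: eq_bigr => a _; rewrite mulrA.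
Qed.

(** The approximating functions are Cauchy in L^2 and converge pointwise to [hatG f], so Fatou
    identifies their L^2 limit with this continuous function. *)
Lemma hatG_near_l2 f j e : 0 < e -> exists N, forall m, (N <= m)%N ->
  sqint mu (fun y => hatG f y j - hat (cs f m) y j) /\
  l2 mu (fun y => hatG f y j - hat (cs f m) y j)
        (fun y => hatG f y j - hat (cs f m) y j) <= e.
Proof.
move=> e0; have se : 0 < Num.sqrt e by rewrite sqrtr_gt0.
have [N HN] := csP f se; exists N => m Nm.
apply: (@l2_fatou _ _ _ mu (fun m' y => hat (cs f m') y j - hat (cs f m) y j)).
- by move=> m'; apply: sqintB; exact: hat_sqint.
- by apply: measurable_funB; apply: continuous_borel; [exact: hatG_continuous|exact: hat_continuous].
- apply: aeW => y; apply: cvgB; [exact: hatG_cvg|exact: cvg_cst].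
- exists N => // m' /= Nm'; apply: le_trans (kl_comp_le _ _ _) _.
  apply: le_trans (kl_le _) _.
  have := HN _ _ Nm' Nm; rewrite (nrm_le_sq psd_kq _ (ltW se)) sqr_sqrtr//.
  exact: ltW.
Qed.

Lemma hatG_sqint f j : sqint mu (fun y => hatG f y j).
Proof.
have [N /(_ _ (leqnn N))[sN _]] := hatG_near_l2 f j (@ltr01 R).
have := sqintD sN (hat_sqint (cs f N) j); congr sqint.
by apply/funext => x; rewrite subrK.
Qed.

Definition hatGv (f : hilb) : l2space mu I := L2Vec (hatG_sqint f).

Lemma hatG_tends f : tends (@l2form _ _ _ mu I) (fun m => hatv (cs f m)) (hatGv f).
Proof.
move=> e e0.
have e1 : 0 < e ^+ 2 / (#|I|%:R + 1) by rewrite divr_gt0 ?exprn_gt0// ltr_wpDl.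
have /choice[N HN] j := hatG_near_l2 f j e1.
exists (\max_j N j)%N => m Nm; rewrite (nrmBC (psd_l2form mu I)).
rewrite (nrm_le_sq (psd_l2form mu I) _ (ltW e0)) l2form_sub.
apply: (@le_trans _ _ (\sum_(j : I) (e ^+ 2 / (#|I|%:R + 1)))).
  apply: ler_sum => j _; apply: (HN j m _).2.
  exact: leq_trans (leq_bigmax j) Nm.
rewrite sumr_const -[leLHS]mulr_natr mulrAC ler_pdivrMr ?ltr_wpDl//.
by rewrite ler_pM2l ?exprn_gt0// lerDl.
Qed.

Lemma hatG_add f g : forall x i, l2val (hatGv (wadd f g)) x i = l2val (wadd (hatGv f) (hatGv g)) x i.
Proof. by move=> x i; exact: (psdDl pH f g (dlt x i)). Qed.

(** Turns [L], an abstract limit, into an integral of actual functions. The diagonal case suffices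
    by polarization. *)
Lemma L_hatG f g : L f g = l2form (hatGv f) (hatGv g).
Proof.
have pl := psd_l2form mu I.
have diag h : L h h = l2form (hatGv h) (hatGv h).
  have := tends_nrm pl (hatG_tends h) => tn.
  have c2 : (fun k => kl (cs h k) (cs h k)) @ \oo --> l2form (hatGv h) (hatGv h).
    rewrite -(nrm_sq pl) expr2.
    rewrite (_ : (fun k => _) = (fun k => nrm (@l2form _ _ _ mu I) (hatv (cs h k)) *
       nrm (@l2form _ _ _ mu I) (hatv (cs h k)))).
      exact: (cvgM tn tn).
    by apply/funext => k; rewrite -expr2 nrm_sq.
  exact: (cvg_lim (@Rhausdorff R) c2).
rewrite (psd_polar pL) (psd_polar pl) !diag; congr ((_ - _) / _).
  rewrite -!(nrm_sq pl); congr (_ ^+ 2); apply: (nrm_congr pl).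
  by apply: l2vec_ext; exact: hatG_add.
rewrite -!(nrm_sq pl); congr (_ ^+ 2); apply: (nrm_congr pl).
apply: l2vec_ext => x i.
change (H (wsub f g) (dlt x i) = H f (dlt x i) + -1 * H g (dlt x i)).
by rewrite mulN1r (psdBl pH).
Qed.

(** A continuous function of zero L^2 norm vanishes everywhere, so [f] is [H]-orthogonal to every
    [dlt y j], hence to the dense set of combinations. *)
Lemma LH0 f : L f f = 0 -> H f f = 0.
Proof.
rewrite L_hatG => lf0.
have f0 y j : H f (dlt y j) = 0.
  apply: (l2_continuous_eq0 HG Hmu (hatG_continuous (f := f) (j := j)) (hatG_sqint f j)).
  apply/eqP; rewrite eq_le l2_ge0 andbT -lf0 /l2form (bigD1 j)//= lerDl.
  by apply: sumr_ge0 => i _; exact: l2_ge0.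
have f1 s : H f (emb psd_kq s) = 0.
  elim: s => [|[r [y j]] s IH].
    (* The empty combination is its own multiple by 0, hence orthogonal to everything. *)
    have pq := psdZr pH 0 f (emb psd_kq [::]); rewrite mul0r in pq.
    rewrite -pq /H; apply/esym/(cvg_lim (@Rhausdorff R)); exact: (ext_cvg psd_kq psd_kh kh_le).
  have e1 : H f (emb psd_kq ((r, (y, j)) :: s)) = H f (wadd (wscl r (dlt y j)) (emb psd_kq s)).
    have -> : (r, (y, j)) :: s = wadd (wscl r (del y j)) s :> combo by rewrite /= mulr1.
    by [].
  by rewrite e1 (psdDr pH) (psdZr pH) f0 IH mulr0 addr0.
have x0 : hilb := f.
(* Density is convergence for [Q]; writing [H f f] as [Q f (X f)] makes it applicable. *)
have := @tends_ip _ _ _ pQ _ _ (opX x0 pQ pH pL QHL cQ f) (emb_dense f).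
rewrite (psdC pQ f) opXE => c.
rewrite -(cvg_lim (@Rhausdorff R) c) (_ : (fun k => _) = (fun=> 0)).
  exact: (cvg_lim (@Rhausdorff R) (cvg_cst (0 : R))).
by apply/funext => k; rewrite (psdC pQ) opXE f1.
Qed.

(** * Isometries of combinations acting on the completion *)

Section Lift.
Variables (sg sg' : combo -> combo).
Hypothesis sgI : forall s t, kq (sg s) (sg t) = kq s t.
Hypothesis sgI' : forall s t, kq (sg' s) (sg' t) = kq s t.

Lemma cau_lift (f : hilb) : cau kq (fun k => sg (cs f k)).
Proof.
move=> e e0; have [N HN] := csP f e0; exists N => m n Nm Nn.
apply: le_trans (HN _ _ Nm Nn).
by rewrite /nrm ler_sqrt ?psd_ge0//; [rewrite !(psdE psd_kq) !sgI|exact: psd_kq].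
Qed.

Definition lift (f : hilb) : hilb := CSeq (cau_lift f).

End Lift.

(** The factor [c] is [1] for translations and [-1] for the imaginary unit, which is
    skew-adjoint. *)
Lemma lift_adjoint (sg sg' : combo -> combo)
  (sgI : forall s t, kq (sg s) (sg t) = kq s t)
  (sgI' : forall s t, kq (sg' s) (sg' t) = kq s t) (phi : combo -> combo -> R) c :
  psd phi -> (forall s, phi s s <= kq s s) ->
  (forall s t, phi (sg s) t = c * phi s (sg' t)) ->
  forall f g : hilb, ext phi (lift sgI f) g = c * ext phi f (lift sgI' g).
Proof.
move=> pphi phiq H1 f g; apply: (cvg_lim (@Rhausdorff R)).
rewrite (_ : (fun k => _) = (fun k => c * phi (cs f k) (sg' (cs g k)))).
  exact: (cvgM (cvg_cst c) (ext_cvg psd_kq pphi phiq f (lift sgI' g))).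
by apply/funext => k; rewrite -H1.
Qed.

Definition tr (w : G) (s : combo) : combo :=
  map (fun a => (a.1, ((w * a.2.1)%g, a.2.2))) (s : seq (R * (G * I))).

Lemma trK w s : tr w^-1%g (tr w s) = s.
Proof.
rewrite /tr -map_comp map_id_in// => -[r [y j]] _ /=.
by rewrite mulgA mulVg mul1g.
Qed.

Lemma kh_tr w s t : kh (tr w s) t = kh s (tr w^-1%g t).
Proof.
rewrite /kh big_map; apply: eq_bigr => a _; rewrite big_map; apply: eq_bigr => b _ /=.
by rewrite invgM mulgA.
Qed.

Lemma hat_tr w s y j : hat (tr w s) y j = hat s (w^-1 * y)%g j.
Proof.
rewrite /hat big_map; apply: eq_bigr => a _ /=.
by rewrite invgM mulgA.
Qed.

Lemma kl_tr w s t : kl (tr w s) t = kl s (tr w^-1%g t).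
Proof.
apply: eq_bigr => j _ /=.
rewrite -(l2_lmul Hmu w (hat_sqint (tr w s) j) (hat_sqint t j)); congr l2.
  by apply/funext => y; rewrite hat_tr mulgA mulVg mul1g.
by apply/funext => y; rewrite hat_tr invgK.
Qed.

Lemma kq_tr w s t : kq (tr w s) t = kq s (tr w^-1%g t).
Proof. by rewrite /kq kh_tr kl_tr. Qed.

Lemma tr_iso w s t : kq (tr w s) (tr w t) = kq s t.
Proof. by rewrite kq_tr trK. Qed.

Definition ltr w : hilb -> hilb := lift (tr_iso w).

Lemma ltr_H w f g : H (ltr w f) g = H f (ltr w^-1%g g).
Proof.
rewrite -[RHS]mul1r; apply: lift_adjoint psd_kh kh_le _ f g => s t.
by rewrite mul1r kh_tr.
Qed.

Lemma ltr_Q w f g : Q (ltr w f) g = Q f (ltr w^-1%g g).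
Proof.
rewrite -[RHS]mul1r; apply: lift_adjoint psd_kq kq_le _ f g => s t.
by rewrite mul1r kq_tr.
Qed.

(** * The kernel of the square root and the factorization *)

Let X0 : hilb := emb psd_kq [::].
Local Notation oR := (opR X0 pQ pH pL QHL cQ).
Local Notation oS := (opS X0 pQ pH pL QHL cQ).

(** Row [i] is the function of the approximate [T^(-1/2)] applied to row [i] of [K] based at the
    identity; by equivariance, the rows based at other points give its translates ([hatG_oR]). *)
Definition psik k (w : G) i j : R := hatG (oR k (dlt 1%g i)) w j.

Lemma H_oR_tr k y z i j : H (oR k (dlt y i)) (dlt z j) = psik k (y^-1 * z)%g i j.
Proof.
rewrite opR_Hsym -{1}[y]mulg1 -[LHS]/(H (ltr y (dlt 1%g i)) (oR k (dlt z j))).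
rewrite -opR_Hsym; exact: (opP_equivH X0 pQ pH pL QHL cQ (ltr_Q y) (ltr_H y)).
Qed.

Lemma hatG_oR k y i z j : hatG (oR k (dlt y i)) z j = psik k (y^-1 * z)%g i j.
Proof. exact: H_oR_tr. Qed.

Lemma psik_sym k w i j : psik k w^-1%g i j = psik k w j i.
Proof.
by rewrite /psik /hatG opR_Hsym (psdC pH) H_oR_tr invgK mulg1.
Qed.

Lemma hatG_sub_le f g j :
  l2 mu (fun y => hatG f y j - hatG g y j) (fun y => hatG f y j - hatG g y j) <=
  L (wsub f g) (wsub f g).
Proof.
rewrite L_hatG /l2form (bigD1 j)//=.
rewrite (_ : (fun y => hatG f y j - hatG g y j) = (fun y => hatG (wsub f g) y j)).
  by rewrite lerDl sumr_ge0// => i _; exact: l2_ge0.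
by apply/funext => y; rewrite /hatG (psdBl pH).
Qed.

Lemma oR_cau e : 0 < e -> exists N, forall m n, (N <= m)%N -> (N <= n)%N ->
  forall i, L (wsub (oR m (dlt 1%g i)) (oR n (dlt 1%g i)))
              (wsub (oR m (dlt 1%g i)) (oR n (dlt 1%g i))) <= e.
Proof.
move=> e0; have se : 0 < Num.sqrt e by rewrite sqrtr_gt0.
have /choice[N HN] i := opR_cau X0 pQ pH pL QHL cQ LH0 (dlt 1%g i) se.
exists (\max_i N i)%N => m n Nm Nn i.
have := HN i m n (leq_trans (leq_bigmax i) Nm) (leq_trans (leq_bigmax i) Nn).
by rewrite (nrm_le_sq pL _ (ltW se)) sqr_sqrtr// ltW.
Qed.

(** One subsequence for all rows, at the rate that [riesz_fischer] asks for. Adding up all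
    thresholds up to [k] yields an index beyond each of them. *)
Lemma ex_phi : exists phi : nat -> nat, (forall k, (k <= phi k)%N) /\
  forall k m n, (k <= m)%N -> (k <= n)%N ->
  forall i, L (wsub (oR (phi m) (dlt 1%g i)) (oR (phi n) (dlt 1%g i)))
              (wsub (oR (phi m) (dlt 1%g i)) (oR (phi n) (dlt 1%g i))) <= 8^-1 ^+ k.
Proof.
have e0 k : 0 < 8^-1 ^+ k :> R by rewrite exprn_gt0// invr_gt0.
have /choice[N HN] k := oR_cau (e0 k).
have NS k m : (k <= m)%N -> (N k <= m + \sum_(j < m.+1) N j)%N.
  move=> km; rewrite (bigD1 (Ordinal (km : k < m.+1)%N))//= addnCA.
  exact: leq_addr.
exists (fun k => k + \sum_(j < k.+1) N j)%N; split=> [k|k m n km kn i].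
  exact: leq_addr.
by apply: HN; exact: NS.
Qed.

Let phi : nat -> nat := sval (cid ex_phi).
Let phi_ge k : (k <= phi k)%N. Proof. exact: (svalP (cid ex_phi)).1. Qed.
Let phiP := (svalP (cid ex_phi)).2.

Definition Psi (w : G) (i j : I) : R := plim (fun k => psik (phi k) w i j).

Lemma Psi_sym w i j : Psi w^-1%g i j = Psi w j i.
Proof. by rewrite /Psi; congr plim; apply/funext => k; exact: psik_sym. Qed.

Lemma psik_small e : 0 < e -> exists N, forall m n, (N <= m)%N -> (N <= n)%N ->
  forall i j, l2 mu (fun y => psik (phi m) y i j - psik (phi n) y i j)
     (fun y => psik (phi m) y i j - psik (phi n) y i j) <= e.
Proof.
move=> e0; have [N HN] := oR_cau e0; exists N => m n Nm Nn i j.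
apply: le_trans (hatG_sub_le _ _ _) (HN _ _ _ _ i).
- exact: leq_trans Nm (phi_ge m).
- exact: leq_trans Nn (phi_ge n).
Qed.

Lemma Psi_rf i j : sqint mu (fun x => Psi x i j) /\ forall e, 0 < e ->
  exists N, forall k, (N <= k)%N ->
    l2 mu (fun x => Psi x i j - psik (phi k) x i j)
          (fun x => Psi x i j - psik (phi k) x i j) <= e.
Proof.
apply: (@riesz_fischer _ _ _ mu (fun k x => psik (phi k) x i j)).
- by move=> k; exact: hatG_sqint.
- move=> k; apply: le_trans (hatG_sub_le _ _ _) _.
  exact: phiP.
- move=> e /psik_small[N HN]; exists N => m k Nm Nk; exact: HN.
Qed.

Lemma Psi_sqint i j : sqint mu (fun x => Psi x i j).
Proof. exact: (Psi_rf i j).1. Qed.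

Definition Psit z i : l2space mu I :=
  L2Vec (fun j => sqint_lmul Hmu z^-1%g (Psi_sqint i j)).

(** Uniform in [z] because left invariance reduces every translate to the row based at the identity;
    this uniformity is what makes [Dv] continuous. *)
Lemma Psit_near e : 0 < e -> exists N, forall k, (N <= k)%N -> forall z i,
  nrm (@l2form _ _ _ mu I) (wsub (hatGv (oR (phi k) (dlt z i))) (Psit z i)) <= e.
Proof.
move=> e0; have pl := psd_l2form mu I.
have e1 : 0 < e ^+ 2 / (#|I|%:R + 1) by rewrite divr_gt0 ?exprn_gt0// ltr_wpDl.
have /choice[N HN] (p : I * I) := (Psi_rf p.1 p.2).2 _ e1.
exists (\max_p N p)%N => k Nk z i; rewrite (nrmBC pl).
rewrite (nrm_le_sq pl _ (ltW e0)) l2form_sub.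
apply: (@le_trans _ _ (\sum_(j : I) (e ^+ 2 / (#|I|%:R + 1)))); last first.
  rewrite sumr_const -[leLHS]mulr_natr mulrAC ler_pdivrMr ?ltr_wpDl//.
  by rewrite ler_pM2l ?exprn_gt0// lerDl.
apply: ler_sum => j _.
apply: le_trans (HN (i, j) k (leq_trans (leq_bigmax (i, j)) Nk)) => /=.
have sd : sqint mu (fun x => Psi x i j - psik (phi k) x i j).
  by apply: sqintB; [exact: Psi_sqint|exact: hatG_sqint].
have E : (fun x => l2val (Psit z i) x j - l2val (hatGv (oR (phi k) (dlt z i))) x j) =
    (fun x => Psi (z^-1 * x)%g i j - psik (phi k) (z^-1 * x)%g i j).
  by apply/funext => x; congr (_ - _); exact: hatG_oR.
have Q1 : l2 mu (fun x => l2val (Psit z i) x j - l2val (hatGv (oR (phi k) (dlt z i))) x j)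
    (fun x => l2val (Psit z i) x j - l2val (hatGv (oR (phi k) (dlt z i))) x j) =
  l2 mu (fun x => Psi x i j - psik (phi k) x i j) (fun x => Psi x i j - psik (phi k) x i j).
  exact: (etrans (congr2 (l2 mu) E E) (l2_lmul Hmu z^-1%g sd sd)).
have h := lexx (l2 mu (fun x => Psi x i j - psik (phi k) x i j)
  (fun x => Psi x i j - psik (phi k) x i j)).
rewrite -{1}Q1 in h.
exact: h.
Qed.

Lemma Psit_tends z i : tends (@l2form _ _ _ mu I)
  (fun k => hatGv (oR (phi k) (dlt z i))) (Psit z i).
Proof. by move=> e /Psit_near[N HN]; exists N => k Nk; exact: HN. Qed.

(** The [L] pairings of the approximate rows based at the identity and at [z] tend to
    [H (dlt 1 i) (dlt z j)], which is [K z i j], by the isometry property, and to the integrals on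
    the right by L^2 convergence. *)
Lemma Psi_factor z i j : K z i j =
  \sum_t l2 mu (fun x => Psi x i t) (fun x => Psi (z^-1 * x)%g j t).
Proof.
have pl := psd_l2form mu I.
have c1 := tends_ip2 pl (Psit_tends 1%g i) (Psit_tends z j).
have c2 : (fun k => l2form (hatGv (oR (phi k) (dlt 1%g i))) (hatGv (oR (phi k) (dlt z j))))
    @ \oo --> H (dlt 1%g i) (dlt z j).
  rewrite (_ : (fun k => _) = (fun k => L (oR (phi k) (dlt 1%g i)) (oR (phi k) (dlt z j)))).
    apply/cvgrPdist_le => e e0.
    have /cvgrPdist_le/(_ _ e0)[N _ HN] :=
      @opR_isometry _ _ _ _ _ X0 pQ pH pL QHL cQ LH0 (dlt 1%g i) (dlt z j).
    by exists N; [exact: Logic.I|move=> k Nk; exact: (HN (phi k) (leq_trans Nk (phi_ge k)))].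
  by apply/funext => k; rewrite L_hatG.
have e1 : H (dlt 1%g i) (dlt z j) = K z i j.
  transitivity (hat (del 1%g i) z j); first exact: hatG_emb.
  by rewrite /hat big_seq1 /= mul1r invg1 mul1g.
have e2 : H (dlt 1%g i) (dlt z j) = l2form (Psit 1%g i) (Psit z j).
  exact: (cvg_unique (@Rhausdorff R) c2 c1).
apply: (etrans (esym e1)); apply: (etrans e2).
apply: eq_bigr => t _; apply: (congr1 (fun f => l2 mu f _)).
by apply/funext => x; apply: (congr1 (fun w => Psi w i t)); rewrite invg1 mul1g.
Qed.

Lemma cvg_sumR (J : Type) (r : seq J) (F : J -> nat -> R) (l : J -> R) :
  (forall i, F i @ \oo --> l i) ->
  (fun k => \sum_(i <- r) F i k) @ \oo --> \sum_(i <- r) l i.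
Proof.
move=> Fl; elim: r => [|j r IH].
  by under eq_fun do rewrite big_nil; rewrite big_nil; exact: cvg_cst.
by under eq_fun do rewrite big_cons; rewrite big_cons; exact: (cvgD (Fl j) IH).
Qed.

(* [pi] and [eps] describe multiplication by the imaginary unit in a real basis
   permuted by it up to sign. *)
Section SkewSymmetry.
Variables (pi : I -> I) (eps : I -> R).
Hypothesis piK : involutive pi.
Hypothesis eps_pi : forall i, eps (pi i) = - eps i.
Hypothesis eps_sq : forall i, eps i * eps i = 1.
Hypothesis KJ : forall x i j, eps i * K x (pi i) j = - (eps j * K x i (pi j)).

(** The imaginary unit acting on combinations; [KJ] makes it skew-adjoint for both forms. *)
Definition jc (s : combo) : combo :=
  map (fun a => (eps a.2.2 * a.1, (a.2.1, pi a.2.2))) (s : seq (R * (G * I))).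

Lemma kh_jc s t : kh (jc s) t = - kh s (jc t).
Proof.
rewrite /kh big_map -sumrN; apply: eq_bigr => a _; rewrite big_map -sumrN.
apply: eq_bigr => b _ /=.
have := KJ (a.2.1^-1 * b.2.1)%g a.2.2 b.2.2 => h.
transitivity (a.1 * b.1 * (eps a.2.2 * K (a.2.1^-1 * b.2.1)%g (pi a.2.2) b.2.2)).
  by ring.
by rewrite h; ring.
Qed.

Lemma hat_jc s y j : hat (jc s) y j = - (eps j * hat s y (pi j)).
Proof.
rewrite /hat big_map mulr_sumr -sumrN; apply: eq_bigr => a _ /=.
transitivity (a.1 * (eps a.2.2 * K (a.2.1^-1 * y)%g (pi a.2.2) j)); first by ring.
by rewrite KJ; ring.
Qed.

Lemma l2_skew (f g : l2space mu I) :
  \sum_j l2 mu (fun x => - (eps j * l2val f x (pi j))) (fun x => l2val g x j) =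
  - \sum_j l2 mu (fun x => l2val f x j) (fun x => - (eps j * l2val g x (pi j))).
Proof.
rewrite (reindex_inj (inv_inj piK)) -sumrN /=; apply: eq_bigr => j _.
rewrite piK eps_pi.
have -> : (fun x => - (- eps j * l2val f x j)) = (fun x => eps j * l2val f x j).
  by apply/funext => x; rewrite mulNr opprK.
have -> : (fun x => - (eps j * l2val g x (pi j))) = (fun x => (- eps j) * l2val g x (pi j)).
  by apply/funext => x; rewrite mulNr.
rewrite [in RHS]l2C !l2Zl; try exact: l2valP.
by rewrite mulNr opprK l2C.
Qed.

Lemma kl_jc s t : kl (jc s) t = - kl s (jc t).
Proof.
rewrite /kl /l2form; transitivity (\sum_j l2 mu (fun x => - (eps j * hat s x (pi j))) (fun x => hat t x j)).
  apply: eq_bigr => j _; congr (l2 mu _ _).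
  by apply/funext => x; exact: hat_jc.
rewrite (l2_skew (hatv s) (hatv t)); congr (- _); apply: eq_bigr => j _; congr (l2 mu _ _).
by apply/funext => x; rewrite /= hat_jc.
Qed.

Lemma kq_jc s t : kq (jc s) t = - kq s (jc t).
Proof. by rewrite /kq kh_jc kl_jc opprD. Qed.

Lemma jc_jc s : jc (jc s) = wscl (-1) s.
Proof.
rewrite /jc /= -map_comp; apply: eq_map => -[r [y j]] /=.
by rewrite piK eps_pi mulrA mulNr eps_sq mulN1r.
Qed.

Lemma jc_iso s t : kq (jc s) (jc t) = kq s t.
Proof. by rewrite kq_jc jc_jc (psdZr psd_kq) mulN1r opprK. Qed.

Definition lj : hilb -> hilb := lift jc_iso.

Lemma lj_H f g : H (lj f) g = - H f (lj g).
Proof.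
rewrite -mulN1r; apply: lift_adjoint psd_kh kh_le _ f g => s t.
by rewrite mulN1r kh_jc.
Qed.

Lemma lj_Q f g : Q (lj f) g = - Q f (lj g).
Proof.
rewrite -mulN1r; apply: lift_adjoint psd_kq kq_le _ f g => s t.
by rewrite mulN1r kq_jc.
Qed.

Let lj' (f : hilb) : hilb := wscl (-1) (lj f).

Let lj'_H f g : H (lj f) g = H f (lj' g).
Proof. by rewrite (psdZr pH) mulN1r lj_H. Qed.

Let lj'_Q f g : Q (lj f) g = Q f (lj' g).
Proof. by rewrite (psdZr pQ) mulN1r lj_Q. Qed.

Lemma H_lj_dlt f y j : H f (lj (dlt y j)) = eps j * H f (dlt y (pi j)).
Proof.
rewrite -(psdZr pH); congr (limn _); apply/funext => k; congr (kh _ _).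
Qed.

Lemma psik_J k w i j : eps i * psik k w (pi i) j = - (eps j * psik k w i (pi j)).
Proof.
rewrite /psik /hatG !opR_Hsym (psdC pH) -H_lj_dlt (psdC pH) -opR_Hsym.
rewrite (opP_equivH X0 pQ pH pL QHL cQ lj'_Q lj'_H) (psdZr pH) mulN1r.
by rewrite H_lj_dlt -opR_Hsym.
Qed.

Lemma Psi_J w i j : eps i * Psi w (pi i) j = - (eps j * Psi w i (pi j)).
Proof.
have E k : psik (phi k) w (pi i) j = - (eps i * eps j) * psik (phi k) w i (pi j).
  have := psik_J (phi k) w i j => /(congr1 (fun t => eps i * t)).
  by rewrite mulrA eps_sq mul1r => ->; ring.
(* [plim] is known to be odd but not linear, so the relation passes to the limit because the factor
   is a sign. *)
have : eps i * eps j = 1 \/ eps i * eps j = -1.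
  have /eqP := eps_sq i; rewrite -expr2 sqrf_eq1 => /orP[]/eqP ->;
  have /eqP := eps_sq j; rewrite -expr2 sqrf_eq1 => /orP[]/eqP ->;
  rewrite ?mulrNN ?mulr1 ?mul1r ?mulN1r; tauto.
have -> : - (eps j * Psi w i (pi j)) = eps i * (- (eps i * eps j) * Psi w i (pi j)).
  move: (Psi _ _ _) => P; transitivity (- (eps i * eps i * (eps j * P))); last by ring.
  by rewrite eps_sq mul1r.
move=> H1; congr (_ * _); rewrite /Psi; under eq_fun do rewrite E.
case: H1 => ->.
  by under eq_fun do rewrite mulN1r; rewrite plimN mulN1r.
by under eq_fun do rewrite opprK mul1r; rewrite opprK mul1r.
Qed.

End SkewSymmetry.

(** * Positivity tested on compactly supported continuous vectors *)

Section TestVector.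
Variables (K0 : set G) (v : G -> I -> R).
Hypothesis vc : forall i, csupp K0 (fun x => v x i).

Let vl : l2space mu I := L2Vec (fun i => csupp_sqint HG Hmu (vc i)).

(** [v] is in L^2 but need not be a function of the completion, so it enters through its
    representative for [Q], formally [(1 - X) v]. Applying [opS k] to it approximates
    [(1 - X)^(1/2) X^(-1/2) v], that is [T^(1/2) v]. *)
Lemma ex_vst : exists z : hilb, forall f, Q z f = l2form (hatGv f) vl.
Proof.
have pl := psd_l2form mu I.
have add f g : l2form (hatGv (wadd f g)) vl = l2form (hatGv f) vl + l2form (hatGv g) vl.
  by rewrite -(psdDl pl); apply: l2vec_ext; exact: hatG_add.
apply: (riesz (M := nrm (@l2form _ _ _ mu I) vl) pQ X0 cQ) => [//|a f|f].
- rewrite -(psdZl pl); apply: l2vec_ext => x i.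
  exact: (psdZl pH a f (dlt x i)).
- apply: le_trans (psd_CSn pl _ _) _; rewrite mulrC ler_wpM2l ?nrm_ge0//.
  by apply: le_trans (nrm_L_le f); rewrite /nrm L_hatG.
Qed.

Let vst := sval (cid ex_vst).
Let vstE f : Q vst f = l2form (hatGv f) vl. Proof. exact: (svalP (cid ex_vst)). Qed.

(** The vector [T^(1/2) v] as a function defined at every point. *)
Definition Dv (y : G) (i : I) : R :=
  \sum_j l2 mu (fun x => Psi (y^-1 * x)%g i j) (fun x => v x j).

(** Moving the operator onto [dlt y i] makes both terms pairings of [v] with rows, to which
    Cauchy-Schwarz and [Psit_near] apply uniformly in [y]. *)
Lemma Dv_near e : 0 < e -> exists N, forall k, (N <= k)%N -> forall y i,
  `|Dv y i - hatG (oS (phi k) vst) y i| <= e.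
Proof.
move=> e0; have pl := psd_l2form mu I.
have c0 : 0 < nrm (@l2form _ _ _ mu I) vl + 1 by rewrite ltr_wpDl// nrm_ge0.
have [N HN] := Psit_near (divr_gt0 e0 c0); exists N => k /HN Hk y i.
have -> : hatG (oS (phi k) vst) y i = l2form (hatGv (oR (phi k) (dlt y i))) vl.
  by rewrite -vstE -opR_Qsym opR_Q.
have -> : Dv y i = l2form (Psit y i) vl by [].
rewrite distrC -(psdBl pl); apply: le_trans (psd_CSn pl _ _) _.
apply: le_trans (ler_wpM2r (nrm_ge0 _) (Hk y i)) _.
by rewrite mulrAC ler_pdivrMr// ler_pM2l// lerDl.
Qed.

Lemma Dv_continuous i : continuous (fun y => Dv y i).
Proof.
apply: (@uniform_limit_continuous (fun k y => hatG (oS (phi k) vst) y i)).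
  by move=> k; exact: hatG_continuous.
by move=> e /Dv_near[N HN]; exists N => y; exact: HN.
Qed.

(** Uniform convergence against an integrable [u], kept distinct from [v] so as to serve both for
    [v] and for its multiple by the imaginary unit. *)
Lemma Dv_pairing_cvg (K1 : set G) (u : G -> I -> R)
  (uc : forall i, csupp K1 (fun x => u x i)) :
  (fun k => \sum_i l2 mu (fun x => hatG (oS (phi k) vst) x i) (fun x => u x i)) @ \oo -->
  \sum_i l2 mu (fun x => u x i) (fun x => Dv x i).
Proof.
apply: cvg_sumR => i; apply/cvgrPdist_le => e e0.
have su : csupp K1 (fun x => `|u x i|).
  have [cK cu u0] := uc i; split=> // [x|x nK]; last by rewrite u0// normr0.
  by apply: cvg_norm; exact: cu.
have c0 : 0 < \int[mu]_x `|u x i| + 1 by rewrite ltr_wpDl// Rintegral_ge0.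
have [N HN] := Dv_near (divr_gt0 e0 c0); exists N => // k /= Nk.
have s1 : csupp K1 (fun x => u x i * Dv x i).
  by apply: csupp_mul => //; exact: Dv_continuous.
have s2 : csupp K1 (fun x => u x i * hatG (oS (phi k) vst) x i).
  by apply: csupp_mul => //; exact: hatG_continuous.
rewrite (l2C mu _ (fun x => u x i)) /l2 -RintegralB//; last 2 first.
- exact: (csupp_integrable HG Hmu s1).
- exact: (csupp_integrable HG Hmu s2).
have s3 : csupp K1 (fun x => u x i * Dv x i - u x i * hatG (oS (phi k) vst) x i).
  have [cK cu u0] := uc i; split=> // [x|x nK]; last by rewrite u0// !mul0r subr0.
  by apply: cvgB; [case: s1 => _ + _; exact|case: s2 => _ + _; exact].
have iu := csupp_integrable HG Hmu su.
have i3 := csupp_integrable HG Hmu s3.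
apply: le_trans (le_normr_Rintegral measurableT i3) _.
apply: (@le_trans _ _ (\int[mu]_x (e / (\int[mu]_x `|u x i| + 1) * `|u x i|))).
  apply: le_Rintegral => //.
  - by have /integrable_norm := i3.
  - have -> : EFin \o (fun x => e / (\int[mu]_x `|u x i| + 1) * `|u x i|) =
      (fun x => (e / (\int[mu]_x `|u x i| + 1))%:E * (`|u x i|)%:E)%E by [].
    exact: integrableZl.
  - move=> x _; rewrite -mulrBr normrM mulrC ler_wpM2r//; exact: HN.
rewrite RintegralZl// mulrAC ler_pdivrMr// ler_pM2l// lerDl //.
Qed.

(** Each approximate pairing is [Q (opS k vst) vst], nonnegative because [sqp] lies in the cone. *)
Lemma Dv_ge0 : 0 <= \sum_i l2 mu (fun x => v x i) (fun x => Dv x i).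
Proof.
rewrite -(cvg_lim (@Rhausdorff R) (Dv_pairing_cvg vc)).
apply: limr_ge; first exact: (cvgP _ (Dv_pairing_cvg vc)).
apply: nearW => k.
rewrite -[X in 0 <= X]/(l2form (hatGv (oS (phi k) vst)) vl) -vstE (psdC pQ).
exact: opS_ge0.
Qed.

Section TestSkew.
Variables (pi : I -> I) (eps : I -> R).
Hypothesis piK : involutive pi.
Hypothesis eps_pi : forall i, eps (pi i) = - eps i.
Hypothesis eps_sq : forall i, eps i * eps i = 1.
Hypothesis KJ : forall x i j, eps i * K x (pi i) j = - (eps j * K x i (pi j)).

(** This gives the vanishing of the imaginary part of the complex pairing. In the approximations,
    [J] commutes with the self-adjoint [opS k], so their product is skew-adjoint and its diagonal
    pairing at [vst] is zero. *)
Lemma Dv_skew :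
  \sum_i l2 mu (fun x => - (eps i * v x (pi i))) (fun x => Dv x i) = 0.
Proof.
have uc i : csupp K0 (fun x => - (eps i * v x (pi i))).
  have [cK cv v0] := vc (pi i); split=> // [x|x nK]; last by rewrite v0// mulr0 oppr0.
  by apply: cvgN; apply: cvgM; [exact: cvg_cst|exact: cv].
pose J := lj piK eps_pi eps_sq KJ.
have JQ f g : Q (J f) g = - Q f (J g) by exact: lj_Q.
have JQ' f g : Q (J f) g = Q f (wscl (-1) (J g)) by rewrite (psdZr pQ) mulN1r.
have JH' f g : H (J f) g = H f (wscl (-1) (J g)) by rewrite (psdZr pH) mulN1r; exact: lj_H.
rewrite -(cvg_lim (@Rhausdorff R) (Dv_pairing_cvg uc)).
apply: (cvg_lim (@Rhausdorff R)).
rewrite (_ : (fun k => _) = (fun=> 0)); first exact: cvg_cst.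
apply/funext => k; pose f := oS (phi k) vst.
have e1 : Q vst (J f) = - \sum_i l2 mu (fun x => hatG f x i) (fun x => - (eps i * v x (pi i))).
  rewrite vstE -(l2_skew piK eps_pi (hatGv f) vl); apply: eq_bigr => j _.
  congr (l2 mu _ _); apply/funext => x /=.
  by rewrite /hatG lj_H H_lj_dlt.
have e2 : Q vst (J f) = 0.
  have h1 : Q vst (J f) = - Q f (J vst) by rewrite (psdC pQ) JQ.
  have h2 : Q f (J vst) = - Q f (J vst).
    apply: etrans (opS_Qsym X0 pQ pH pL QHL cQ (phi k) vst (J vst)) _.
    apply: etrans (psdC pQ _ _) _.
    apply: etrans (opP_equiv X0 pQ pH pL QHL cQ JQ' JH' (sqp (phi k)) vst vst) _.
    by rewrite (psdZr pQ) mulN1r.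
  by rewrite h1; lra.
by have /eqP := e1; rewrite e2 eq_sym oppr_eq0 => /eqP.
Qed.

End TestSkew.
End TestVector.

End PosdefKernel.

Lemma posdef_kernel_factor {R : realType} {G : topologicalGroupType}
    (mu : {measure set (borel G) -> \bar R}) (I : finType)
    (K : G -> I -> I -> R) (pi : I -> I) (eps : I -> R) :
  locally_compact_group G -> haar_measure mu ->
  (forall i j, continuous (fun x => K x i j)) ->
  (forall i j, sqint mu (fun x => K x i j)) ->
  (forall x i j, K x^-1%g i j = K x j i) ->
  (forall s : seq (R * (G * I)), 0 <= \sum_(a <- s) \sum_(b <- s)
    a.1 * b.1 * K (a.2.1^-1 * b.2.1)%g a.2.2 b.2.2) ->
  involutive pi -> (forall i, eps (pi i) = - eps i) ->
  (forall i, eps i * eps i = 1) ->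
  (forall x i j, eps i * K x (pi i) j = - (eps j * K x i (pi j))) ->
  exists P : G -> I -> I -> R,
  [/\ forall i j, sqint mu (fun x => P x i j),
      forall x i j, P x^-1%g i j = P x j i,
      forall x i j, eps i * P x (pi i) j = - (eps j * P x i (pi j)),
      forall x i j, K x i j =
        \sum_t l2 mu (fun y => P y i t) (fun y => P (x^-1 * y)%g j t) &
      forall (K0 : set G) (v : G -> I -> R), (forall i, csupp K0 (fun x => v x i)) ->
      let D y i := \sum_j l2 mu (fun x => P (y^-1 * x)%g i j) (fun x => v x j) in
      [/\ forall i, continuous (fun y => D y i),
          0 <= \sum_i l2 mu (fun x => v x i) (fun x => D x i) &
          \sum_i l2 mu (fun x => - (eps i * v x (pi i))) (fun x => D x i) = 0]].
Proof.
move=> HG Hmu Kc Ks Ksym Kpd piK ep eq KJ.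
exists (Psi HG Hmu Kc Ks Ksym Kpd); split.
- exact: Psi_sqint.
- exact: Psi_sym.
- exact: Psi_J.
- exact: Psi_factor.
- move=> K0 v vc D; split.
  + exact: (Dv_continuous vc).
  + exact: (Dv_ge0 _ _ _ _ _ _ vc).
  + exact: (Dv_skew _ _ _ _ _ _ vc piK ep eq KJ).
Qed.

(** * Passage to complex matrices *)

Section ComplexParts.
Context {R : realType}.
Implicit Types z w : R[i].

Lemma ReD z w : complex.Re (z + w) = complex.Re z + complex.Re w.
Proof. by case: z; case: w. Qed.

Lemma ImD z w : complex.Im (z + w) = complex.Im z + complex.Im w.
Proof. by case: z; case: w. Qed.

Lemma ReM z w : complex.Re (z * w) =
  complex.Re z * complex.Re w - complex.Im z * complex.Im w.
Proof. by case: z; case: w. Qed.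

Lemma ImM z w : complex.Im (z * w) =
  complex.Re z * complex.Im w + complex.Im z * complex.Re w.
Proof. by case: z; case: w. Qed.

Lemma Re_sum (J : Type) (r : seq J) (F : J -> R[i]) :
  complex.Re (\sum_(j <- r) F j) = \sum_(j <- r) complex.Re (F j).
Proof. exact: (big_morph _ ReD). Qed.

Lemma Im_sum (J : Type) (r : seq J) (F : J -> R[i]) :
  complex.Im (\sum_(j <- r) F j) = \sum_(j <- r) complex.Im (F j).
Proof. exact: (big_morph _ ImD). Qed.

Lemma Re_conj z : complex.Re (conjc z) = complex.Re z. Proof. by case: z. Qed.
Lemma Im_conj z : complex.Im (conjc z) = - complex.Im z. Proof. by case: z. Qed.

Lemma complex_eqP z w : complex.Re z = complex.Re w -> complex.Im z = complex.Im w -> z = w.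
Proof. by case: z => a b; case: w => c d /= -> ->. Qed.

Lemma Re_norm_sq z : (complex.Re `|z|) ^+ 2 = complex.Re z ^+ 2 + complex.Im z ^+ 2.
Proof. by rewrite normc_def /= sqr_sqrtr// addr_ge0 ?sqr_ge0. Qed.

Lemma Re_norm_ge0 z : 0 <= complex.Re `|z|.
Proof. by rewrite normc_def /= sqrtr_ge0. Qed.

(* The (a, b) entry of the real 2 x 2 matrix of multiplication by [z]; the
   basis (1, 'i) is indexed by (false, true). *)
Definition part (z : R[i]) (a b : bool) : R :=
  if a == b then complex.Re z else if a then - complex.Im z else complex.Im z.

Definition unitb (a : bool) : R[i] := if a then Complex 0 1 else 1.

Lemma partE z a b : part z a b = complex.Re (unitb a * z * conjc (unitb b)).
Proof. by case: z => x y; case: a; case: b; rewrite /part /unitb /=; ring. Qed.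

End ComplexParts.

Section ComplexMatrices.
Context {R : realType} {G : topologicalGroupType}.
Variable mu : {measure set (borel G) -> \bar R}.

Lemma mx_entry_continuous m n (F : G -> 'M[R[i]]_(m, n)) i j :
  continuous (F : G -> 'M[R[i]^o]_(m, n)) -> continuous (fun x => F x i j : R[i]^o).
Proof.
move=> cF x.
apply: (@cvg_comp _ _ _ (F : G -> 'M[R[i]^o]_(m,n))
  (fun M : 'M[R[i]^o]_(m,n) => M i j) _ (nbhs (F x : 'M[R[i]^o]_(m,n)))).
  exact: cF.
exact: coord_continuous.
Qed.

Lemma Re_le_norm (z : R[i]) e : `|z| <= e%:C%C -> `|complex.Re z| <= e /\ `|complex.Im z| <= e.
Proof.
rewrite normc_def lecR => h.
split; apply: le_trans h; rewrite -sqrtr_sqr ler_sqrt ?addr_ge0 ?sqr_ge0//.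
  by rewrite lerDl sqr_ge0.
by rewrite lerDr sqr_ge0.
Qed.

Lemma ReIm_continuous (f : G -> R[i]^o) : continuous f ->
  continuous (fun x => complex.Re (f x)) /\ continuous (fun x => complex.Im (f x)).
Proof.
move=> cf.
have near x e : 0 < e -> \forall t \near x, `|f x - f t| <= e%:C%C.
  move=> e0; have /cvgrPdist_le := cf x; apply.
  by rewrite ltcR.
have B (z w : R[i]) : complex.Re (z - w) = complex.Re z - complex.Re w /\
    complex.Im (z - w) = complex.Im z - complex.Im w by case: z; case: w.
split=> x; apply/cvgrPdist_le => e /(near x); apply: filterS => t /Re_le_norm[h1 h2].
  by have [<- _] := B (f x) (f t).
by have [_ <-] := B (f x) (f t).
Qed.

Lemma L2_sqint (f : G -> R[i]) : L2 mu f <->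
  sqint mu (fun x => complex.Re (f x)) /\ sqint mu (fun x => complex.Im (f x)).
Proof.
have E : (fun x => (complex.Re `|f x| ^+ 2)%:E) =
    (fun x => (complex.Re (f x) ^+ 2 + complex.Im (f x) ^+ 2)%:E).
  by apply/funext => x; rewrite Re_norm_sq.
have me (h : G -> R) : measurable_fun [set: borel G] h ->
    measurable_fun [set: borel G] (fun x => (h x ^+ 2)%:E).
  by move=> mh; apply/measurable_EFinP; exact: measurable_funX.
split.
  move=> [[mr mi] fin]; rewrite E in fin.
  have part_le (h : G -> R) : measurable_fun [set: borel G] h ->
      (forall x, h x ^+ 2 <= complex.Re (f x) ^+ 2 + complex.Im (f x) ^+ 2) -> sqint mu h.
    move=> mh hle; split=> //; apply/integrableP; split; first exact: me.
    apply: le_lt_trans fin; apply: ge0_le_integral => //.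
    - by apply: measurableT_comp => //; exact: me.
    - by apply/measurable_EFinP; apply: measurable_funD; exact: measurable_funX.
    - by move=> x _; rewrite /= lee_fin ger0_norm ?sqr_ge0//; exact: hle.
  split; apply: part_le => // x; first by rewrite lerDl sqr_ge0.
  by rewrite lerDr sqr_ge0.
move=> [[mr ir] [mi ii]]; split=> //; rewrite E.
have := integrableD measurableT ir ii => /integrableP[_].
apply: le_lt_trans; apply: ge0_le_integral => //.
- by move=> x _; rewrite lee_fin addr_ge0 ?sqr_ge0.
- by apply/measurable_EFinP; apply: measurable_funD; exact: measurable_funX.
- by apply: measurableT_comp => //; apply: emeasurable_funD; exact: me.
- by move=> x _; rewrite /= lee_fin ger0_norm ?addr_ge0 ?sqr_ge0.
Qed.

Context {n : nat}.
Implicit Types (Phi : G -> 'M[R[i]]_n).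

Lemma mx_sandwich (A : 'M[R[i]]_n) (a b : R[i]) i j :
  ((a *: delta_mx i 0 : 'cV_n)^T *m A *m map_mx conjc (b *: delta_mx j 0 : 'cV_n)) 0 0
   = a * A i j * conjc b.
Proof.
rewrite linearZ /= trmx_delta map_mxZ map_delta_mx -!scalemxAl -scalemxAr.
by rewrite -rowE -colE !mxE mulrCA mulrC.
Qed.

Lemma posdef_scalar Phi : continuous_posdef Phi ->
  forall s : seq (R[i] * (G * 'I_n)), 0 <= \sum_(a <- s) \sum_(b <- s)
    a.1 * Phi (a.2.1^-1 * b.2.1)%g a.2.2 b.2.2 * conjc b.1.
Proof.
move=> [_ pd] s; pose t k := tnth (in_tuple s) k.
pose c k : 'cV[R[i]]_n := (t k).1 *: delta_mx (t k).2.2 0.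
have h := pd (size s) c (fun k => (t k).2.1).
suff -> : \sum_(a <- s) \sum_(b <- s)
    a.1 * Phi (a.2.1^-1 * b.2.1)%g a.2.2 b.2.2 * conjc b.1 =
  \sum_i \sum_j ((c i)^T *m Phi ((t i).2.1^-1 * (t j).2.1)%g *m map_mx conjc (c j)) 0 0.
  exact: h.
rewrite [LHS]big_tnth; apply: eq_bigr => i _.
by rewrite [LHS]big_tnth; apply: eq_bigr => j _; rewrite mx_sandwich.
Qed.

(** Polarization: for the points [1] and [x], the off-diagonal part of the nonnegative sum is real,
    and the coefficient pairs [(1, 1)] and [('i, 1)] separate the two components. *)
Lemma posdef_hermitian Phi x i j : continuous_posdef Phi ->
  Phi x^-1%g i j = conjc (Phi x j i).
Proof.
move=> pd.
have real a b : complex.Im (a * Phi x j i * conjc b + b * Phi x^-1%g i j * conjc a) = 0.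
  have h1 := ger0_Im (posdef_scalar pd [:: (a, (1%g, j))]).
  have h2 := ger0_Im (posdef_scalar pd [:: (b, (x, i))]).
  have := ger0_Im (posdef_scalar pd [:: (a, (1%g, j)); (b, (x, i))]).
  rewrite !big_seq1 in h1 h2.
  rewrite !big_cons !big_nil !addr0 /= !ImD.
  rewrite /= in h1 h2; rewrite h1 h2 invg1 mul1g mulg1; lra.
have h1 := real 1 1; have h2 := real (Complex 0 1) 1.
apply: complex_eqP; rewrite ?Re_conj ?Im_conj; move: h1 h2.
  rewrite !ImD !ImM !ReM !Re_conj !Im_conj /=; lra.
rewrite !ImD !ImM !ReM !Re_conj !Im_conj /=; lra.
Qed.

End ComplexMatrices.
Lemma Rintegral_sum d (T : measurableType d) (R : realType)
    (mu : {measure set T -> \bar R}) (J : Type) (r : seq J) (F : J -> T -> R) :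
  (forall j, mu.-integrable [set: T] (EFin \o F j)) ->
  mu.-integrable [set: T] (EFin \o (fun x => \sum_(j <- r) F j x)) /\
  \int[mu]_x (\sum_(j <- r) F j x) = \sum_(j <- r) \int[mu]_x F j x.
Proof.
move=> iF; elim: r => [|j r [IH1 IH2]].
  under eq_fun do rewrite big_nil.
  split; last by rewrite big_nil Rintegral_cst// mul0r.
  by rewrite (_ : _ \o _ = cst 0%E)//; exact: integrable0.
under eq_fun do rewrite big_cons.
split; last by rewrite big_cons RintegralD// IH2.
by rewrite (_ : _ \o _ = (EFin \o F j) \+ (EFin \o (fun x => \sum_(j <- r) F j x)))//;
   exact: integrableD.
Qed.

(** * The real kernel of a complex positive definite function *)

Section Realification.
Context {R : realType} {G : topologicalGroupType}.
Variable mu : {measure set (borel G) -> \bar R}.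
Context {n : nat}.
Variable Phi : G -> 'M[R[i]]_n.
Hypothesis P2Phi : cont_P2 mu Phi.

Let I : finType := ('I_n * bool)%type.

Definition realK (x : G) (p q : I) : R := part (Phi x p.1 q.1) p.2 q.2.
Definition flip (p : I) : I := (p.1, ~~ p.2).
Definition eps (p : I) : R := if p.2 then -1 else 1.

Lemma flipK : involutive flip.
Proof. by case=> i b; rewrite /flip /= negbK. Qed.

Lemma eps_flip p : eps (flip p) = - eps p.
Proof. by case: p => i []; rewrite /eps /= ?opprK. Qed.

Lemma eps_sq p : eps p * eps p = 1.
Proof. by case: p => i []; rewrite /eps /= ?mulrNN mul1r. Qed.

Lemma realK_flip x p q : eps p * realK x (flip p) q = - (eps q * realK x p (flip q)).
Proof.
by case: p q => [i []] [j []]; rewrite /eps /realK /part /=; ring.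
Qed.

Lemma realK_continuous p q : continuous (fun x => realK x p q).
Proof.
have [_ [cPhi _]] := P2Phi.
have [cr ci] := ReIm_continuous (@mx_entry_continuous _ _ _ _ _ p.1 q.1 cPhi).
case: p q cr ci => [i []] [j []] cr ci; rewrite /realK /part //=.
by move=> x; apply: cvgN; exact: ci.
Qed.

Lemma realK_sqint p q : sqint mu (fun x => realK x p q).
Proof.
have [/(_ p.1 q.1)/L2_sqint[sr si] _] := P2Phi.
case: p q sr si => [i []] [j []] sr si; rewrite /realK /part //=.
exact: sqintN.
Qed.

Lemma realK_sym x p q : realK x^-1%g p q = realK x q p.
Proof.
have [_ pd] := P2Phi.
rewrite /realK (posdef_hermitian x p.1 q.1 pd).
by case: p q => [i []] [j []]; case: (Phi x _ _) => a b; rewrite /part /= ?opprK.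
Qed.

(** A real coefficient [r] at [(i, b)] becomes the complex coefficient [r] or [r 'i] at [i]; by
    [partE] the real sum is the real part of the complex one. *)
Lemma realK_pd (s : seq (R * (G * I))) : 0 <= \sum_(a <- s) \sum_(b <- s)
  a.1 * b.1 * realK (a.2.1^-1 * b.2.1)%g a.2.2 b.2.2.
Proof.
have [_ pd] := P2Phi.
have := posdef_scalar pd
  (map (fun a : R * (G * I) => (a.1%:C%C * unitb a.2.2.2, (a.2.1, a.2.2.1))) s).
rewrite big_map lecE => /andP[_]; rewrite Re_sum.
congr (_ <= _); apply: eq_bigr => a _; rewrite big_map Re_sum; apply: eq_bigr => b _.
rewrite /realK partE /=.
move: (unitb _) (unitb _) (Phi _ _ _) => [c1 c2] [d1 d2] [e1 e2] /=; ring.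
Qed.

End Realification.

(** Uses [t <= 1 + t ^+ 2] and the finite measure of compact sets. *)
Lemma L2_L1loc (R : realType) (G : topologicalGroupType)
    (mu : {measure set (borel G) -> \bar R}) (f : G -> R[i]) :
  locally_compact_group G -> haar_measure mu -> L2 mu f -> L1loc mu f.
Proof.
move=> HG Hmu [[mr mi] fin]; split=> // K cK.
have mK := compact_borel HG cK.
have mn : measurable_fun [set: borel G] (fun x => complex.Re `|f x|).
  rewrite (_ : (fun x => _) = (@Num.sqrt R) \o
    (fun x => complex.Re (f x) ^+ 2 + complex.Im (f x) ^+ 2)); last first.
    by apply/funext => x; rewrite normc_def.
  apply: measurableT_comp.
    by apply: continuous_measurable_fun; exact: sqrt_continuous.
  by apply: measurable_funD; exact: measurable_funX.
apply: (@le_lt_trans _ _ (\int[mu]_(x in K) (1 + (complex.Re `|f x| ^+ 2)%:E))%E).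
  apply: ge0_le_integral => //.
  - by move=> x _; rewrite lee_fin Re_norm_ge0.
  - by apply/measurable_EFinP; exact: measurable_funS mn.
  - apply: measurable_funS (@measurableT _ (borel G)) _ _ => //.
    apply: emeasurable_funD => //; apply/measurable_EFinP; exact: measurable_funX.
  - move=> x _; rewrite -EFinD lee_fin.
    have := Re_norm_ge0 (f x); move: (complex.Re _) => t t0; nra.
rewrite ge0_integralD//; last 2 first.
  - by move=> x _; rewrite lee_fin sqr_ge0.
  - apply: measurable_funS (@measurableT _ (borel G)) _ _ => //.
    by apply/measurable_EFinP; exact: measurable_funX.
rewrite integral_cst// mul1e lte_add_pinfty//; first exact: compact_fin.
apply: le_lt_trans fin; apply: ge0_subset_integral => //.
- by apply/measurable_EFinP; exact: measurable_funX.
- by move=> x _; rewrite lee_fin sqr_ge0.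
Qed.
Lemma partM (R : realType) (z w : R[i]) a b :
  part (z * w) a b = \sum_c part z a c * part w c b.
Proof.
rewrite big_bool; case: z => z1 z2; case: w => w1 w2.
by case: a; case: b; rewrite /part /=; ring.
Qed.

Lemma part_sum (R : realType) (J : Type) (r : seq J) (F : J -> R[i]) a b :
  part (\sum_(j <- r) F j) a b = \sum_(j <- r) part (F j) a b.
Proof.
rewrite /part; case: eqP => _; first exact: Re_sum.
by case: a; rewrite Im_sum// -sumrN.
Qed.

Lemma part_conj (R : realType) (z : R[i]) a b : part (conjc z) a b = part z b a.
Proof. by case: z => x y; case: a; case: b; rewrite /part /= ?opprK. Qed.

(** * From the real kernel back to complex matrices *)

Section Complexification.
Context {R : realType} {G : topologicalGroupType}.
Variable mu : {measure set (borel G) -> \bar R}.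
Hypothesis HG : locally_compact_group G.
Hypothesis Hmu : haar_measure mu.
Hypothesis Uni : unimodular mu.
Context {n : nat}.
Let I : finType := ('I_n * bool)%type.
Variable P : G -> I -> I -> R.
Hypothesis Ps : forall p q, sqint mu (fun x => P x p q).
Hypothesis Psym : forall x p q, P x^-1%g p q = P x q p.
Hypothesis PJ : forall x p q, eps p * P x (flip p) q = - (eps q * P x p (flip q)).

(** Only the rows indexed by [false] are read; [PJ] determines the others, see [complexifyE]. *)
Definition complexify (x : G) : 'M[R[i]]_n :=
  \matrix_(i, j) Complex (P x (i, false) (j, false)) (P x (i, false) (j, true)).

Lemma complexifyE x p q : P x p q = part (complexify x p.1 q.1) p.2 q.2.
Proof.
case: p q => [i a] [j b] /=; rewrite mxE /part /=.
have h1 := PJ x (i, false) (j, false); have h2 := PJ x (i, false) (j, true).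
rewrite /eps /flip /= in h1 h2.
by case: a; case: b => //=; lra.
Qed.

Lemma complexify_L2 : mxL2 mu complexify.
Proof.
move=> i j; apply/L2_sqint; split; under eq_fun do rewrite mxE /=; exact: Ps.
Qed.

(** Hermitian symmetry turns [P (x^-1 * y) (j, b) t] into [P (y^-1 * x) t (j, b)], so that products
    of rows become a convolution, and [partM] sums over each 2 x 2 block. *)
Lemma complexify_conv_part x i j b :
  \sum_t l2 mu (fun y => P y (i, false) t) (fun y => P (x^-1 * y)%g (j, b) t) =
  part (mxconv mu complexify complexify x i j) false b.
Proof.
rewrite mxE part_sum.
rewrite (eq_bigr (fun t : I => l2 mu (fun y => P y (i, false) (t.1, t.2))
  (fun y => P (x^-1 * y)%g (j, b) (t.1, t.2)))); last by case.
rewrite -(pair_bigA _ (fun k c => l2 mu (fun y => P y (i, false) (k, c))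
  (fun y => P (x^-1 * y)%g (j, b) (k, c)))) /=.
apply: eq_bigr => k _.
have int c : mu.-integrable [set: borel G]
    (EFin \o (fun y => P y (i, false) (k, c) * P (x^-1 * y)%g (j, b) (k, c))).
  by apply: sqint_mul => //; exact: (sqint_lmul Hmu x^-1%g (Ps (j, b) (k, c))).
have [_ <-] := Rintegral_sum (index_enum bool) int.
have E : (fun y => \sum_c P y (i, false) (k, c) * P (x^-1 * y)%g (j, b) (k, c)) =
    (fun y => part (complexify y i k * complexify (y^-1 * x)%g k j) false b).
  apply/funext => y; rewrite partM; apply: eq_bigr => c _.
  rewrite -(complexifyE y (i, false) (k, c)) -(complexifyE _ (k, c) (j, b)).
  by congr (_ * _); rewrite -[RHS]Psym invgM invgK.
by rewrite E /Cconv /Cintegral; case: b {int E}.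
Qed.

(* [v] holds the real coordinates of the row vector [x |-> u (x^-1)^*]. *)
Variable u : G -> 'cV[R[i]]_n.
Hypothesis Cu : Cc u.
Let v (x : G) (p : I) : R := part (conjc (u x^-1%g p.1 0)) false p.2.
Let Ku := closure [set x | u x != 0].
Let K0 := [set x^-1%g | x in Ku].

Lemma test_csupp p : csupp K0 (fun x => v x p).
Proof.
have [cu cK] := Cu.
split; first exact: compact_invg.
  have [cr ci] := ReIm_continuous (@mx_entry_continuous _ _ _ _ _ p.1 0 cu).
  have inv (f : G -> R) : continuous f -> continuous (fun x => f x^-1%g).
    move=> cf x; apply: (@cvg_comp _ _ _ (fun x => x^-1)%g f _ (nbhs x^-1%g)).
      exact: invg_continuous.
    exact: cf.
  case: p cr ci => i [] cr ci; rewrite /v /part /=.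
    under eq_fun do rewrite Im_conj.
    by move=> x; apply: cvgN; exact: (inv _ ci).
  by under eq_fun do rewrite Re_conj; exact: (inv _ cr).
move=> x nK; have u0 : u x^-1%g = 0.
  apply/eqP/negPn/negP => /(@subset_closure _ [set y | u y != 0] x^-1%g) uK.
  by apply: nK; exists x^-1%g => //; rewrite invgK.
by rewrite /v u0 mxE part_conj /part /=; case: (p.2); rewrite //= oppr0.
Qed.

Let D (y : G) (p : I) := \sum_q l2 mu (fun x => P (y^-1 * x)%g p q) (fun x => v x q).

(** Substituting [x * g] for [g] leaves [u] at [g^-1], as in the definition of [v]. Integrability is
    recorded for the sign that [lambdaE] pulls out of the integral. *)
Lemma lambda_part x i b : D x^-1%g (i, b) =
  \int[mu]_g part ((complexify g *m u (g^-1 * x)%g) i 0) b false /\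
  mu.-integrable [set: borel G]
    (EFin \o (fun g => part ((complexify g *m u (g^-1 * x)%g) i 0) b false)).
Proof.
pose F g := part ((complexify g *m u (g^-1 * x)%g) i 0) b false.
have FE g : F (x * g)%g = \sum_q P (x * g)%g (i, b) q * v g q.
  rewrite /F mxE part_sum.
  rewrite [RHS](eq_bigr (fun t : I => P (x * g)%g (i, b) (t.1, t.2) * v g (t.1, t.2))); last by case.
  rewrite -(pair_bigA _ (fun k c => P (x * g)%g (i, b) (k, c) * v g (k, c))) /=.
  apply: eq_bigr => k _; rewrite partM; apply: eq_bigr => c _.
  by rewrite complexifyE /v part_conj /= invgM -mulgA mulVg mulg1.
have int q : mu.-integrable [set: borel G] (EFin \o (fun g => P (x * g)%g (i, b) q * v g q)).
  apply: sqint_mul; first exact: (sqint_lmul Hmu x (Ps (i, b) q)).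
  exact: (csupp_sqint HG Hmu (test_csupp q)).
have [iS eS] := Rintegral_sum (index_enum I) int.
have iF : mu.-integrable [set: borel G] (EFin \o F).
  have := integrable_transfer (@lmul_measurable _ x^-1%g) (lmul_inv Hmu x^-1%g) iS.
  congr (mu.-integrable _ (EFin \o _)); apply/funext => g /=.
  by rewrite -FE mulgA mulgV mul1g.
split=> //.
have mF : measurable_fun [set: borel G] F.
  by apply/measurable_EFinP; exact: measurable_int iF.
rewrite -(Rintegral_lmul Hmu x mF).
under [RHS]eq_Rintegral do rewrite FE.
by rewrite eS; apply: eq_bigr => q _; rewrite invgK.
Qed.

Lemma lambdaE x i : lambda mu complexify u x i 0 =
  Complex (D x^-1%g (i, false)) (- D x^-1%g (i, true)).
Proof.
have [e0 _] := lambda_part x i false; have [e1 i1] := lambda_part x i true.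
rewrite mxE /Cintegral e0 e1; congr (Complex _ _).
rewrite -mulN1r -RintegralZl//; apply: eq_Rintegral => g _.
by rewrite /part /= mulN1r opprK.
Qed.

Hypothesis Dc : forall p, continuous (fun y => D y p).
Hypothesis D0 : 0 <= \sum_p l2 mu (fun x => v x p) (fun x => D x p).
Hypothesis DJ : \sum_p l2 mu (fun x => - (eps p * v x (flip p))) (fun x => D x p) = 0.

Let prod_csupp p q : csupp K0 (fun x => v x p * D x q).
Proof. by apply: csupp_mul; [exact: test_csupp|exact: Dc]. Qed.

Let prod_integrable p q : mu.-integrable [set: borel G] (EFin \o (fun x => v x p * D x q)).
Proof. exact: (csupp_integrable HG Hmu (prod_csupp p q)). Qed.

(** [D0] provides the real part and [DJ] the vanishing of the imaginary part. Both [u] and its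
    convolution are read from [v] and [D] at inverse points, so inversion invariance is applied to
    the compactly supported products of [v] and [D]. *)
Lemma complexify_pairing_ge0 : 0 <= innerL2 mu (lambda mu complexify u) u.
Proof.
have inv F : csupp K0 F -> \int[mu]_x F x^-1%g = \int[mu]_x F x.
  exact: Rintegral_inv.
have vE g i : u g i 0 = Complex (v g^-1%g (i, false)) (- v g^-1%g (i, true)).
  rewrite /v invgK !part_conj /part /=; case: (u g i 0) => a b /=.
  by rewrite opprK.
rewrite lecE /innerL2 Re_sum Im_sum /=; apply/andP; split.
  apply/eqP.
  suff S : \sum_(j < n) \int[mu]_x complex.Im (lambda mu complexify u x j 0 * conjc (u x j 0)) =
      - \sum_p l2 mu (fun x => - (eps p * v x (flip p))) (fun x => D x p).
    by rewrite S DJ oppr0.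
  rewrite [X in - X](eq_bigr (fun t : I => l2 mu (fun x => - (eps (t.1, t.2) * v x (t.1, ~~ t.2)))
     (fun x => D x (t.1, t.2)))); last by case.
  rewrite -(pair_bigA _ (fun k c => l2 mu (fun x => - (eps (k, c) * v x (k, ~~ c))) (fun x => D x (k, c)))) /=.
  rewrite -sumrN; apply: eq_bigr => i _.
  rewrite big_bool /= /eps /=.
  have -> : l2 mu (fun x => - (-1 * v x (i, false))) (fun x => D x (i, true)) =
      \int[mu]_x (v x (i, false) * D x (i, true)).
    by apply: eq_Rintegral => x _; rewrite mulN1r opprK.
  have -> : l2 mu (fun x => - (1 * v x (i, true))) (fun x => D x (i, false)) =
      - \int[mu]_x (v x (i, true) * D x (i, false)).
    rewrite -mulN1r -RintegralZl//; apply: eq_Rintegral => x _; ring.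
  rewrite opprD opprK addrC -RintegralB//.
  rewrite -(inv (fun x => v x (i, true) * D x (i, false) - v x (i, false) * D x (i, true))); last first.
    have [cK c1 n1] := prod_csupp (i, true) (i, false).
    have [_ c2 n2] := prod_csupp (i, false) (i, true).
    split=> // [x|x nK]; first by apply: cvgB; [exact: c1|exact: c2].
    by rewrite n1// n2// subr0.
  apply: eq_Rintegral => g _; rewrite lambdaE vE ImM /=; ring.
apply: le_trans D0 _.
rewrite (eq_bigr (fun t : I => l2 mu (fun x => v x (t.1, t.2)) (fun x => D x (t.1, t.2)))); last by case.
rewrite -(pair_bigA _ (fun k c => l2 mu (fun x => v x (k, c)) (fun x => D x (k, c)))) /=.
rewrite le_eqVlt; apply/orP; left; apply/eqP; apply: eq_bigr => i _.
rewrite big_bool /= /l2 -RintegralD//.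
rewrite -(inv (fun x => v x (i, true) * D x (i, true) + v x (i, false) * D x (i, false))); last first.
  have [cK c1 n1] := prod_csupp (i, true) (i, true).
  have [_ c2 n2] := prod_csupp (i, false) (i, false).
  split=> // [x|x nK]; first by apply: cvgD; [exact: c1|exact: c2].
  by rewrite n1// n2// addr0.
apply: eq_Rintegral => g _; rewrite lambdaE vE ReM /=; ring.
Qed.

End Complexification.

Theorem mainTheorem1 (R : realType) (G : topologicalGroupType)
    (mu : {measure set (borel G) -> \bar R}) (n : nat)
    (Phi : G -> 'M[R[i]]_n) :
  locally_compact_group G -> haar_measure mu -> unimodular mu ->
  (0 < n)%N -> cont_P2 mu Phi ->
  exists Psi : G -> 'M[R[i]]_n, P2 mu Psi /\ Phi = mxconv mu Psi Psi.
Proof.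
move=> HG Hmu Uni _ P2Phi.
have [P [Ps Psym PJ Pfac Ptest]] := posdef_kernel_factor HG Hmu
  (realK_continuous P2Phi) (realK_sqint P2Phi) (realK_sym P2Phi) (realK_pd P2Phi)
  (@flipK n) (@eps_flip R n) (@eps_sq R n) (realK_flip Phi).
exists (complexify P); split.
  have PL2 := complexify_L2 Ps.
  split=> //; split; first by move=> i j; apply: L2_L1loc => //; exact: PL2.
  move=> u Cu.
  have [Dc D0 DJ] := Ptest _ _ (test_csupp Cu).
  exact: (complexify_pairing_ge0 HG Hmu Uni Ps PJ Cu Dc D0 DJ).
apply/funext => x; apply/matrixP => i j.
(* The values [false] and [true] of [b] give the real and the imaginary part of the entry. *)
have h b := etrans (Pfac x (i, false) (j, b))
  (complexify_conv_part Hmu Ps Psym PJ x i j b).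
exact: complex_eqP (h false) (h true).
Qed.
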